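(* Let $X\subset\mathcal A$ be a graded $U^+$-module realized as a submodule of $\mathcal A$ under the adjoint action of $U^+$, with weight basis $\{\psi_i\}_{i\in I_X}$, let $\{y_i\}_{i\in I_X}\subset X^*$ be the dual basis, and let $\psi_{X^*}=\sum_{i\in I_X}y_i\otimes\psi_i\in X^*\otimes X\subset X^*\otimes\mathcal A$ be the invariant tensor. Then the vector $$Z_{X^*}=\psi_{X^*}\,\mathcal S\,(1\otimes1_{\hat{\mathcal V}})=\sum_{i,k\in I_X}y_i\otimes\psi_kS_{ki}1_{\hat{\mathcal V}}$$ belongs to $X^*\otimes\hat{\mathcal V}^+$.
   Context: **The algebra $U$.** $\mathfrak g=\mathfrak g_-\oplus\mathfrak h\oplus\mathfrak g_+$ is a semisimple complex Lie algebra, $\mathrm R^+$ its positive roots, $\Pi$ the simple roots, $\Gamma_+=\mathbb Z_+\Pi$, $(\cdot,\cdot)$ the invariant form on $\mathfrak h^*$, $\rho$ the half-sum of positive roots, $h_\lambda\in\mathfrak h$ defined by $\mu(h_\lambda)=(\mu,\lambda)$. $U$ is either the quantum group $U_q(\mathfrak g)$ or the classical universal enveloping algebra $U(\mathfrak g)$. *Quantum case.* $q\in\mathbb C^\times$ is not a root of unity and $[z]_q=\frac{q^z-q^{-z}}{q-q^{-1}}$. $U=U_q(\mathfrak g)$ is generated by $e_\alpha,f_\alpha,q^{\pm h_\alpha}$ ($\alpha\in\Pi$) with $q^{h_\alpha}e_\beta=q^{(\alpha,\beta)}e_\beta q^{h_\alpha}$, $q^{h_\alpha}f_\beta=q^{-(\alpha,\beta)}f_\beta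 q^{h_\alpha}$, $[e_\alpha,f_\beta]=\delta_{\alpha\beta}[h_\alpha]_q$ and the $q$-Serre relations. $U^+,U^-,U^0$ are the subalgebras generated by the $e_\alpha$, the $f_\alpha$, the $q^{\pm h_\alpha}$; $B^\pm=U^\pm U^0$. The comultiplication is $\Delta(f_\alpha)=f_\alpha\otimes1+q^{-h_\alpha}\otimes f_\alpha$, $\Delta(e_\alpha)=e_\alpha\otimes q^{h_\alpha}+1\otimes e_\alpha$, $\Delta(q^{\pm h_\alpha})=q^{\pm h_\alpha}\otimes q^{\pm h_\alpha}$, with antipode $\gamma(e_\alpha)=-e_\alpha q^{-h_\alpha}$, $\gamma(f_\alpha)=-q^{h_\alpha}f_\alpha$, $\gamma(q^{\pm h_\alpha})=q^{\mp h_\alpha}$. A second comultiplication is $\tilde\Delta(f_\alpha)=f_\alpha\otimes1+q^{h_\alpha}\otimes f_\alpha$, $\tilde\Delta(e_\alpha)=e_\alpha\otimes q^{-h_\alpha}+1\otimes e_\alpha$, $\tilde\Delta(q^{\pm h_\alpha})=q^{\pm h_\alpha}\otimes q^{\pm h_\alpha}$. $\check{\mathcal R}=q^{-\sum_i h_i\otimes h_i}\mathcal R$ ($\{h_i\}$ an orthonormal basis of $\mathfrak h$, $\mathcal R$ the universal R-matrix for $\Delta$), chosen to lie in the completed tensor product of $U^+$ and $U^-$ (components in $U^+[\mu]\otimes U^-[-\mu]$, zero-weight component $1\otimes1$); it satisfies $\check{\mathcal R}\Delta(u)=\tilde\Delta(u)\check{\mathcal R}$ for all $u\in U$. Put $\mathcal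 F=\frac1{q-q^{-1}}(\check{\mathcal R}-1\otimes1)$ and $\varphi(z)=q^{-z}/[z]_q$. *Classical case* (the limit $q\to1$). $U=U(\mathfrak g)$, $U^\pm=U(\mathfrak g_\pm)$, $U^0=U(\mathfrak h)$, $B^\pm=U^\pm U^0$, with the usual comultiplication $\Delta$ and antipode $\gamma$; $[z]_q$ is replaced by $z$, $\mathcal F=\sum_{\alpha\in\mathrm R^+}e_\alpha\otimes f_\alpha$ (root vectors dual with respect to the invariant form), and $\varphi(z)=1/z$. **Localization.** $\hat U^0$ is the ring of fractions of $U^0$ over the elements $[h_\mu-c]_q$ ($h_\mu-c$ in the classical case), $0\ne\mu\in\Gamma_+$, with $c$ ranging in a subset of $\mathbb C$ depending on the weight structure of the algebra $\mathcal A$ below. A hat over an algebra or ideal denotes the corresponding extension of $U^0$ to $\hat U^0$. **The algebra $\mathcal A$.** $\mathcal A\supset U$ is a unital associative algebra, diagonalizable over $U^0$ (adjoint action) with finite-dimensional weight spaces, and free as a $U^-\otimes B^+$-bimodule under the regular actions (left $U^-$, right $B^+$). $\mathcal J=\mathcal J_+$ is the left ideal of $\mathcal A$ generated by all $e_\alpha$, and $\mathcal J_-$ the right ideal generated by all $f_\alpha$, $\alpha\in\Pi$. As a standing assumption there are further extensions $\hat U\subset\breve U$, $\hat{\mathcal A}\subset\breve{\mathcal A}$, $\hat{\mathcal J}_\pm\subset\breve{\mathcal J}_\pm$ with $\mathcal J_\pm=\breve{\mathcal J}_\pm\cap\mathcal A$ and a zero-weight element $\wp\in\breve U$ (extremal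 projector) with $\mathcal J_+\wp=0=\wp\mathcal J_-$, $\wp^2=\wp$, $\wp-1\in\breve{\mathcal J}_-\cap\breve{\mathcal J}_+$. $\hat{\mathcal V}=\hat{\mathcal A}/\hat{\mathcal J}$ is a left $\hat{\mathcal A}$-module, $1_{\hat{\mathcal V}}$ is the image of $1$, and $\hat{\mathcal V}^+=\{v\in\hat{\mathcal V}: e_\alpha v=0\ \forall\alpha\in\Pi\}$. (The space $\hat{\mathcal V}^+$ is identified with the Mickelsson algebra $\hat Z(\mathcal A,\mathfrak g)=N(\hat{\mathcal J})/\hat{\mathcal J}$, $N(\hat{\mathcal J})=\{a\in\hat{\mathcal A}:\hat{\mathcal J}a\subset\hat{\mathcal J}\}$.) **The left Shapovalov matrix $\mathcal S$.** For $\mu\in\Gamma_+$ let $\eta_\mu=h_\mu+(\mu,\rho)-\frac12(\mu,\mu)$. For $\mu\neq0$ let $\varphi(D)$ act on $U^+[\mu]\otimes\hat B^-[-\mu]$ by $x\otimes y\mapsto x\otimes y\,\varphi(-\eta_\mu)$. (Here $D=\mathrm{id}\otimes[d,-]$ with $d=\frac12\sum_ih_ih_i+h_\rho$.) In the completed tensor product of $U^+$ and $\hat B^-$ put $\mathcal S=\sum_{n\ge0}\mathcal S^{(n)}$, $\mathcal S^{(0)}=1\otimes1$, $\mathcal S^{(n+1)}=\varphi(D)(\mathcal F\mathcal S^{(n)})$. It is the left Shapovalov matrix, i.e. the unique element (with zero-weight component $1\otimes1$) of the completed tensor product satisfying $\Delta(e_\alpha)\mathcal S\in U^+\otimes\hat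 B^-e_\alpha$ for all $\alpha\in\Pi$. **Modules.** $U$ acts on $\mathcal A$ by the adjoint action $\mathrm{ad}(x)(a)=x^{(1)}a\,\gamma(x^{(2)})$ (Sweedler notation for $\Delta$). A $U^+$-module $X$ is graded if it extends to a $U^0$-diagonalizable $B^+$-module with finite-dimensional weight spaces; differences of weights of $X$ are assumed to lie in the root lattice. With $\pi(u)=\mathrm{ad}(u)|_X$, matrix entries are defined by $\pi(u)\psi_i=\sum_k\pi(u)_{ki}\psi_k$, and $S_X=(\pi\otimes\mathrm{id})(\mathcal S)=\sum_{k,i}e_{ki}\otimes S_{ki}$ with $S_{ki}\in\hat B^-$ and $e_{ki}$ the matrix units. $X^*$ is the right dual of $X$; with $\blacktriangleright$ its left action, it is made a right $U^+$-module by $y\triangleleft u=\gamma(u)\blacktriangleright y$, i.e. $(y\triangleleft u)(x)=y(\pi(u)x)$. $X^*\otimes\hat{\mathcal A}$ is a right $U^+\otimes\hat B^-$-module via $\triangleleft$ on $X^*$ and right multiplication on $\hat{\mathcal A}$; $\psi_{X^*}\mathcal S$ refers to this action.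
   Formalization: For infinite-dimensional X it is assumed that for each i only finitely many S_{ki} are nonzero (otherwise the sum over k may be undefined), and the tensor product of X^* with the module is completed, i.e. read as linear maps on X. *)

(* Defs.v *)
From HB Require Import structures.
From mathcomp Require Import all_boot all_order all_algebra.
From mathcomp Require Import generic_quotient ring_quotient.
From mathcomp Require Import boolp classical_sets cardinality fsbigop reals.
From mathcomp Require Import complex.

Set Implicit Arguments.
Unset Strict Implicit.
Unset Printing Implicit Defensive.

Import GRing.Theory.

Local Open Scope ring_scope.
Local Open Scope quotient_scope.

Definition bilin (K : fieldType) (V W Z : lmodType K) (f : V -> W -> Z) : Prop :=
  (forall v, linear (f v)) /\ (forall w, linear (f ^~ w)).

Definition tsum (K : fieldType) (V W : lmodType K) (Z : nmodType)
    (f : V -> W -> Z) (s : seq (V * W)) : Z :=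
  \sum_(p <- s) f p.1 p.2.

Lemma tsum_cat (K : fieldType) (V W : lmodType K) (Z : nmodType)
    (f : V -> W -> Z) s t : tsum f (s ++ t) = tsum f s + tsum f t.
Proof. exact: big_cat. Qed.

Section Bilin.
Variables (K : fieldType) (V W Z : lmodType K) (f : V -> W -> Z).
Hypothesis fB : bilin f.

Lemma bilinDl v v' w : f (v + v') w = f v w + f v' w.
Proof. by have := fB.2 w 1 v v'; rewrite !scale1r. Qed.
Lemma bilinDr v w w' : f v (w + w') = f v w + f v w'.
Proof. by have := fB.1 v 1 w w'; rewrite !scale1r. Qed.
Lemma bilin0l w : f 0 w = 0.
Proof. by apply: (addrI (f 0 w)); rewrite -bilinDl !addr0. Qed.
Lemma bilin0r v : f v 0 = 0.
Proof. by apply: (addrI (f v 0)); rewrite -bilinDr !addr0. Qed.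
Lemma bilinZl c v w : f (c *: v) w = c *: f v w.
Proof. by have := fB.2 w c v 0; rewrite !addr0 bilin0l addr0. Qed.
Lemma bilinZr c v w : f v (c *: w) = c *: f v w.
Proof. by have := fB.1 v c w 0; rewrite !addr0 bilin0r addr0. Qed.

Lemma tsum_scale c s :
  tsum f [seq (c *: p.1, p.2) | p <- s] = c *: tsum f s.
Proof.
by rewrite /tsum big_map scaler_sumr; apply: eq_bigr => p _; rewrite bilinZl.
Qed.

End Bilin.

(* An element of V (x) W is a finite formal sum of pairs (v, w); two such sums
   are identified when no bilinear map on V x W tells them apart. *)
Definition tens_eq (K : fieldType) (V W : lmodType K) (s t : seq (V * W)) : bool :=
  `[< forall (Z : lmodType K) (f : V -> W -> Z),
        bilin f -> tsum f s = tsum f t >].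

Section Tensor.
Variables (K : fieldType) (V W : lmodType K).
Implicit Types s t : seq (V * W).

Lemma tens_eqP s t : reflect
  (forall (Z : lmodType K) (f : V -> W -> Z), bilin f -> tsum f s = tsum f t)
  (tens_eq s t).
Proof. exact: asboolP. Qed.

Lemma tens_eq_equiv : equiv_class_of (@tens_eq K V W).
Proof.
split=> [s|s t|t s u].
- by apply/tens_eqP.
- by apply/tens_eqP/tens_eqP => h Z f fB; rewrite h.
- move=> /tens_eqP h1 /tens_eqP h2; apply/tens_eqP => Z f fB.
  by rewrite h1 ?h2.
Qed.

Canonical tens_eq_equivRel := EquivRelPack tens_eq_equiv.
Canonical tens_eq_encModRel := defaultEncModRel (@tens_eq K V W).

Definition tens : Type := {eq_quot (@tens_eq K V W)}.
HB.instance Definition _ := Choice.on tens.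
HB.instance Definition _ : EqQuotient _ (@tens_eq K V W) tens :=
  EqQuotient.on tens.

Definition tlift (Z : nmodType) (f : V -> W -> Z) (x : tens) : Z :=
  tsum f (repr x).

Lemma tlift_pi (Z : lmodType K) (f : V -> W -> Z) s :
  bilin f -> tlift f (\pi_tens s) = tsum f s.
Proof.
move=> fB; have : repr (\pi_tens s) = s %[mod tens] by rewrite reprK.
by move/eqquotP/tens_eqP/(_ Z f fB).
Qed.

Definition tpure (v : V) (w : W) : tens := \pi_tens [:: (v, w)].

Lemma tensP (x y : tens) :
  (forall (Z : lmodType K) (f : V -> W -> Z), bilin f -> tlift f x = tlift f y) ->
  x = y.
Proof.
move=> h; rewrite -[x]reprK -[y]reprK; apply/eqquotP/tens_eqP => Z f fB.
exact: h.
Qed.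

Definition tens0 : tens := \pi_tens [::].
Definition tens_add (x y : tens) : tens := \pi_tens (repr x ++ repr y).
Definition tens_scale (c : K) (x : tens) : tens :=
  \pi_tens [seq (c *: p.1, p.2) | p <- repr x].
Definition tens_opp (x : tens) : tens := tens_scale (-1) x.

Section Lift.
Variables (Z : lmodType K) (f : V -> W -> Z).
Hypothesis fB : bilin f.
Lemma tlift_pure v w : tlift f (tpure v w) = f v w.
Proof. by rewrite tlift_pi // /tsum big_seq1. Qed.
Lemma tlift_tens0 : tlift f tens0 = 0.
Proof. by rewrite tlift_pi // /tsum big_nil. Qed.
Lemma tlift_tadd x y : tlift f (tens_add x y) = tlift f x + tlift f y.
Proof. by rewrite tlift_pi // tsum_cat. Qed.
Lemma tlift_tscale c x : tlift f (tens_scale c x) = c *: tlift f x.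
Proof. by rewrite tlift_pi // tsum_scale. Qed.
End Lift.

Lemma tens_addA : associative tens_add.
Proof. by move=> x y z; apply: tensP => Z f fB; rewrite !tlift_tadd // addrA. Qed.
Lemma tens_addC : commutative tens_add.
Proof. by move=> x y; apply: tensP => Z f fB; rewrite !tlift_tadd // addrC. Qed.
Lemma tens_add0 : left_id tens0 tens_add.
Proof.
by move=> x; apply: tensP => Z f fB; rewrite tlift_tadd // tlift_tens0 // add0r.
Qed.
Lemma tens_addN : left_inverse tens0 tens_opp tens_add.
Proof.
move=> x; apply: tensP => Z f fB.
by rewrite tlift_tadd // tlift_tscale // tlift_tens0 // scaleN1r addNr.
Qed.

HB.instance Definition _ :=
  GRing.isZmodule.Build tens tens_addA tens_addC tens_add0 tens_addN.

Lemma tens_scaleA a b (x : tens) :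
  tens_scale a (tens_scale b x) = tens_scale (a * b) x.
Proof. by apply: tensP => Z f fB; rewrite !tlift_tscale // scalerA. Qed.
Lemma tens_scale1 : left_id 1 tens_scale.
Proof. by move=> x; apply: tensP => Z f fB; rewrite tlift_tscale // scale1r. Qed.
Lemma tens_scaleDr : right_distributive tens_scale +%R.
Proof.
move=> c x y; apply: tensP => Z f fB.
by rewrite tlift_tscale // !tlift_tadd // !tlift_tscale // scalerDr.
Qed.
Lemma tens_scaleDl (x : tens) :
  {morph tens_scale^~ x : a b / a + b}.
Proof.
move=> a b; apply: tensP => Z f fB.
by rewrite tlift_tadd // !tlift_tscale // scalerDl.
Qed.

HB.instance Definition _ := GRing.Zmodule_isLmodule.Build K tens
  tens_scaleA tens_scale1 tens_scaleDr tens_scaleDl.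

Lemma tlift_linear (Z : lmodType K) (f : V -> W -> Z) :
  bilin f -> linear (tlift f).
Proof. by move=> fB c x y; rewrite tlift_tadd // tlift_tscale. Qed.

Lemma tpure_bilin : bilin tpure.
Proof.
split=> [v c w w'|w c v v']; apply: tensP => Z f fB.
  by rewrite tlift_linear // !tlift_pure // (bilinDr fB) (bilinZr fB).
by rewrite tlift_linear // !tlift_pure // (bilinDl fB) (bilinZl fB).
Qed.

(* The (possibly infinite-dimensional) subspace P (x) Q. *)
Definition in_tens (P : V -> Prop) (Q : W -> Prop) (x : tens) : Prop :=
  exists2 s : seq (V * W), (forall p, p \in s -> P p.1 /\ Q p.2) &
                           x = \sum_(p <- s) tpure p.1 p.2.

End Tensor.

Arguments tpure {K V W} v w.

Definition tmap (K : fieldType) (V W V' W' : lmodType K)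
    (f : V -> V') (g : W -> W') (x : tens V W) : tens V' W' :=
  tlift (fun v w => tpure (f v) (g w)) x.

Section TensorAlgebra.
Variables (K : fieldType) (A B : algType K).
Notation T := (tens A B).

Definition tens_one : T := tpure 1 1.
Definition tens_mul (x y : T) : T :=
  tlift (fun a b => tlift (fun a' b' => tpure (a * a') (b * b')) y) x.

Lemma tens_mul_inner_bilin a b :
  bilin (fun (a' : A) (b' : B) => tpure (a * a') (b * b')).
Proof.
have pB := tpure_bilin A B.
split=> [v c w w'|w c v v'].
  by rewrite mulrDr -scalerAr (bilinDr pB) (bilinZr pB).
by rewrite mulrDr -scalerAr (bilinDl pB) (bilinZl pB).
Qed.

Lemma tens_mul_outer_bilin (y : T) :
  bilin (fun (a : A) (b : B) => tlift (fun a' b' => tpure (a * a') (b * b')) y).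
Proof.
have pB := tpure_bilin A B.
split=> [v c w w'|w c v v']; rewrite /tlift /tsum scaler_sumr -big_split /=;
  apply: eq_bigr => p _.
  by rewrite mulrDl -scalerAl (bilinDr pB) (bilinZr pB).
by rewrite mulrDl -scalerAl (bilinDl pB) (bilinZl pB).
Qed.

Lemma tens_mul_pure a b a' b' :
  tens_mul (tpure a b) (tpure a' b') = tpure (a * a') (b * b').
Proof.
rewrite /tens_mul tlift_pure; last exact: tens_mul_outer_bilin.
by rewrite tlift_pure //; exact: tens_mul_inner_bilin.
Qed.

Lemma tens_mul_linl (y : T) : linear (tens_mul^~ y).
Proof. exact: (tlift_linear (tens_mul_outer_bilin y)). Qed.

Lemma tens_mul_linr (x : T) : linear (tens_mul x).
Proof.
move=> c y y'.
have E z : tens_mul x z =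
    \sum_(p <- repr x) tlift (fun a b => tpure (p.1 * a) (p.2 * b)) z by [].
rewrite !E scaler_sumr -big_split /=; apply: eq_bigr => p _.
exact: (tlift_linear (tens_mul_inner_bilin p.1 p.2)).
Qed.

Lemma tens_sum_pure (x : T) : x = \sum_(p <- repr x) tpure p.1 p.2.
Proof.
apply: tensP => Z f fB.
pose F : {linear T -> Z} := HB.pack (tlift f)
  (GRing.isLinear.Build _ _ _ _ _ (tlift_linear fB)).
rewrite -[RHS]/(F _) linear_sum /= /tlift /tsum.
by apply: eq_bigr => p _; rewrite -/(tsum f _) -/(tlift f _) tlift_pure.
Qed.

Lemma tens_ind (P : T -> Prop) :
  (forall a b, P (tpure a b)) -> P 0 -> (forall x y, P x -> P y -> P (x + y)) ->
  forall x, P x.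
Proof.
move=> Pp P0 PD x; rewrite (tens_sum_pure x).
by apply: (big_ind P) => // p _; exact: Pp.
Qed.

Lemma tens_mulDl : left_distributive tens_mul +%R.
Proof.
by move=> x y z; have := tens_mul_linl z 1 x y; rewrite !scale1r.
Qed.
Lemma tens_mulDr : right_distributive tens_mul +%R.
Proof.
by move=> x y z; have := tens_mul_linr x 1 y z; rewrite !scale1r.
Qed.
Lemma tens_mul0l x : tens_mul 0 x = 0.
Proof. by apply: (addrI (tens_mul 0 x)); rewrite -tens_mulDl !addr0. Qed.
Lemma tens_mul0r x : tens_mul x 0 = 0.
Proof. by apply: (addrI (tens_mul x 0)); rewrite -tens_mulDr !addr0. Qed.
Lemma tens_mulA : associative tens_mul.
Proof.
move=> x y z; elim/tens_ind: x => [a b||x x' IH IH'].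
- elim/tens_ind: y => [a' b'||y y' IH IH'].
  + elim/tens_ind: z => [a'' b''||z z' IH IH'].
    * by rewrite !tens_mul_pure !mulrA.
    * by rewrite !tens_mul0r.
    * by rewrite !tens_mulDr IH IH'.
  + by rewrite tens_mul0l !tens_mul0r tens_mul0l.
  + by rewrite tens_mulDl !tens_mulDr tens_mulDl IH IH'.
- by rewrite !tens_mul0l.
- by rewrite !tens_mulDl IH IH'.
Qed.
Lemma tens_mul1l : left_id tens_one tens_mul.
Proof.
move=> x; elim/tens_ind: x => [a b||x x' IH IH'].
- by rewrite tens_mul_pure !mul1r.
- by rewrite tens_mul0r.
- by rewrite tens_mulDr IH IH'.
Qed.
Lemma tens_mul1r : right_id tens_one tens_mul.
Proof.
move=> x; elim/tens_ind: x => [a b||x x' IH IH'].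
- by rewrite tens_mul_pure !mulr1.
- by rewrite tens_mul0l.
- by rewrite tens_mulDl IH IH'.
Qed.

HB.instance Definition _ := GRing.Zmodule_isPzRing.Build T
  tens_mulA tens_mul1l tens_mul1r tens_mulDl tens_mulDr.

End TensorAlgebra.

Inductive in_subalg (K : fieldType) (U : algType K) (G : U -> Prop) : U -> Prop :=
| InSubalgGen x : G x -> in_subalg G x
| InSubalg1 : in_subalg G 1
| InSubalgLin c x y : in_subalg G x -> in_subalg G y -> in_subalg G (c *: x + y)
| InSubalgM x y : in_subalg G x -> in_subalg G y -> in_subalg G (x * y).

Definition subalg_pred (K : fieldType) (U : algType K) (G : U -> Prop) : {pred U} :=
  fun x => `[< in_subalg G x >].

Lemma subalg_pred_closed (K : fieldType) (U : algType K) (G : U -> Prop) :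
  subalg_closed (subalg_pred G).
Proof.
split.
- by apply/asboolP; exact: InSubalg1.
- move=> c x y /asboolP hx /asboolP hy.
  by apply/asboolP; exact: InSubalgLin.
- by move=> x y /asboolP hx /asboolP hy; apply/asboolP; exact: InSubalgM.
Qed.

HB.instance Definition _ (K : fieldType) (U : algType K) (G : U -> Prop) :=
  GRing.isSubalgClosed.Build K U (subalg_pred G) (subalg_pred_closed G).

Record subalg (K : fieldType) (U : algType K) (G : U -> Prop) := Subalg {
  subalg_val :> U;
  subalg_valP : subalg_val \in subalg_pred G
}.

HB.instance Definition _ (K : fieldType) (U : algType K) (G : U -> Prop) :=
  [isSub for @subalg_val K U G].
HB.instance Definition _ (K : fieldType) (U : algType K) (G : U -> Prop) :=
  [Choice of subalg G by <:].
HB.instance Definition _ (K : fieldType) (U : algType K) (G : U -> Prop) :=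
  [SubChoice_isSubAlgebra of subalg G by <:].

Definition in_lideal (R : nzRingType) (G : R -> Prop) (x : R) : Prop :=
  exists2 s : seq (R * R), (forall p, p \in s -> G p.2) &
                           x = \sum_(p <- s) p.1 * p.2.

Definition in_rideal (R : nzRingType) (G : R -> Prop) (x : R) : Prop :=
  exists2 s : seq (R * R), (forall p, p \in s -> G p.1) &
                           x = \sum_(p <- s) p.1 * p.2.

Section LeftIdealQuotient.
Variables (R : nzRingType) (G : R -> Prop).

Definition lideal_pred : {pred R} := fun x => `[< in_lideal G x >].

Lemma in_lidealM a x : in_lideal G x -> in_lideal G (a * x).
Proof.
move=> [s hs ->]; exists [seq (a * p.1, p.2) | p <- s].
  by move=> _ /mapP[p ps ->] /=; exact: hs.
by rewrite big_map mulr_sumr; apply: eq_bigr => p _; rewrite mulrA.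
Qed.

Lemma lideal_pred_closed : zmod_closed lideal_pred.
Proof.
split; first by apply/asboolP; exists [::]; rewrite ?big_nil.
move=> x y /asboolP[s hs ->] /asboolP hy; apply/asboolP.
have := in_lidealM (-1) hy; rewrite mulN1r => -[t ht ->].
exists (s ++ t); last by rewrite big_cat.
by move=> p; rewrite mem_cat => /orP[/hs|/ht].
Qed.

HB.instance Definition _ :=
  GRing.isZmodClosed.Build R lideal_pred lideal_pred_closed.

(* The left module R / RG; \pi 1 is its cyclic generator. *)
Definition lquot : Type := Quotient.quot lideal_pred.
HB.instance Definition _ := GRing.Zmodule.on lquot.
HB.instance Definition _ : EqQuotient R (Quotient.equiv lideal_pred) lquot :=
  EqQuotient.on lquot.

Definition lquot_pi (a : R) : lquot := \pi_(Quotient.quot lideal_pred) a.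
Definition lquot_scale (a : R) (v : lquot) : lquot := lquot_pi (a * repr v).

Lemma lquot_piP a b : lquot_pi a = lquot_pi b <-> in_lideal G (a - b).
Proof.
split=> [/eqP|h]; last apply/eqP; rewrite /lquot_pi -Quotient.idealrBE.
  by move/asboolP.
exact/asboolP.
Qed.

Lemma lquot_piB a b : lquot_pi (a - b) = lquot_pi a - lquot_pi b.
Proof. by rewrite /lquot_pi !piE. Qed.
Lemma lquot_piD a b : lquot_pi (a + b) = lquot_pi a + lquot_pi b.
Proof. by rewrite /lquot_pi !piE. Qed.

Lemma lquot_pi_repr v : lquot_pi (repr v) = v.
Proof. exact: reprK. Qed.

Lemma lquot_scale_pi a b : lquot_scale a (lquot_pi b) = lquot_pi (a * b).
Proof.
apply/lquot_piP; rewrite -mulrBr; apply: in_lidealM.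
by apply/lquot_piP; rewrite lquot_pi_repr.
Qed.

Lemma lquot_scaleA a b v : lquot_scale a (lquot_scale b v) = lquot_scale (a * b) v.
Proof. by rewrite {2}/lquot_scale lquot_scale_pi mulrA. Qed.
Lemma lquot_scale1 : left_id 1 lquot_scale.
Proof. by move=> v; rewrite /lquot_scale mul1r lquot_pi_repr. Qed.
Lemma lquot_scaleDr : right_distributive lquot_scale +%R.
Proof.
move=> a u v; rewrite -[u]lquot_pi_repr -[v]lquot_pi_repr -lquot_piD.
by rewrite !lquot_scale_pi mulrDr lquot_piD.
Qed.
Lemma lquot_scaleDl v : {morph lquot_scale^~ v : a b / a + b}.
Proof. by move=> a b; rewrite /lquot_scale mulrDl lquot_piD. Qed.

HB.instance Definition _ := GRing.Zmodule_isLmodule.Build R lquot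
  lquot_scaleA lquot_scale1 lquot_scaleDr lquot_scaleDl.

End LeftIdealQuotient.

Notation cone r := {ffun 'I_r -> nat}.
Notation root_lattice r := {ffun 'I_r -> int}.

Definition simple_root (r : nat) (i : 'I_r) : cone r := [ffun j => nat_of_bool (j == i)].
Definition height (r : nat) (mu : cone r) : nat := (\sum_i mu i)%N.
Definition cone_lattice (r : nat) (mu : cone r) : root_lattice r :=
  [ffun i => (mu i)%:Z].

(* Pi = {alpha_0, ..., alpha_(r-1)}, elements of the root lattice are given by
   their coordinates in Pi, and [lie_h i] is h_(alpha_i), that is
   alpha_j (h) = (h, lie_h j) for h in the span of the [lie_h i].  So the scalar in
   [lie_cartan_e] and [lie_cartan_f] is beta (lie_h i), beta = \sum_j beta_j alpha_j. *)
Record semisimple_lie (K : fieldType) := SemisimpleLie {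
  lie_space :> vectType K;
  lie_br : lie_space -> lie_space -> lie_space;
  lie_form : lie_space -> lie_space -> K^o;
  lie_rank : nat;
  lie_h : 'I_lie_rank -> lie_space;
  lie_pos : seq (cone lie_rank);
  lie_e : cone lie_rank -> lie_space;
  lie_f : cone lie_rank -> lie_space;
  lie_br_bilin : bilin lie_br;
  lie_br_alt : forall x, lie_br x x = 0;
  lie_jacobi : forall x y z,
    lie_br x (lie_br y z) + lie_br y (lie_br z x) + lie_br z (lie_br x y) = 0;
  lie_semisimple : forall I : {vspace lie_space},
    (forall x y, y \in I -> lie_br x y \in I) ->
    (forall x y, x \in I -> y \in I -> lie_br x y = 0) -> I = 0%VS;
  lie_form_bilin : bilin lie_form;
  lie_form_sym : forall x y, lie_form x y = lie_form y x;
  lie_form_inv : forall x y z,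
    lie_form (lie_br x y) z = lie_form x (lie_br y z);
  lie_form_nondeg : forall x, (forall y, lie_form x y = 0) -> x = 0;
  lie_pos_uniq : uniq lie_pos;
  lie_pos_neq0 : 0 \notin lie_pos;
  lie_pos_simple : forall i, simple_root i \in lie_pos;
  lie_h_abelian : forall i j, lie_br (lie_h i) (lie_h j) = 0;
  lie_cartan_e : forall i beta, beta \in lie_pos ->
    lie_br (lie_h i) (lie_e beta) =
      (\sum_j (beta j)%:R * lie_form (lie_h i) (lie_h j)) *: lie_e beta;
  lie_cartan_f : forall i beta, beta \in lie_pos ->
    lie_br (lie_h i) (lie_f beta) =
      - (\sum_j (beta j)%:R * lie_form (lie_h i) (lie_h j)) *: lie_f beta;
  lie_basis : basis_of fullv
    ([seq lie_h i | i <- enum 'I_lie_rank] ++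
     [seq lie_e beta | beta <- lie_pos] ++ [seq lie_f beta | beta <- lie_pos]);
  lie_dual : forall beta, beta \in lie_pos ->
    lie_form (lie_e beta) (lie_f beta) = 1
}.

Section Pairing.
Variables (K : fieldType) (g : semisimple_lie K).
Notation r := (lie_rank g).

(* (alpha_i, alpha_j) *)
Definition gram (i j : 'I_r) : K := lie_form (lie_h i) (lie_h j).

Definition pairing (mu nu : cone r) : K :=
  \sum_i \sum_j (mu i)%:R * (nu j)%:R * gram i j.

Definition rho_pairing (mu : cone r) : K :=
  2^-1 * \sum_(beta <- lie_pos g) pairing mu beta.

(* eta_mu = h_mu + eta_shift mu *)
Definition eta_shift (mu : cone r) : K :=
  rho_pairing mu - 2^-1 * pairing mu mu.

(* The same numbers when (alpha_i, alpha_j) = b i j are integers; the division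
   by 2 is then exact if the b i i are even. *)
Definition int_pairing (b : 'I_r -> 'I_r -> int) (mu nu : cone r) : int :=
  \sum_i \sum_j (mu i)%:Z * (nu j)%:Z * b i j.

Definition int_eta_shift (b : 'I_r -> 'I_r -> int) (mu : cone r) : int :=
  ((\sum_(beta <- lie_pos g) int_pairing b mu beta - int_pairing b mu mu)
     %/ 2)%Z.

End Pairing.

Definition comultiplicative (K : fieldType) (U : algType K)
    (Delta : U -> tens U U) : Prop :=
  [/\ linear Delta, Delta 1 = 1 &
      forall x y, Delta (x * y) = Delta x * Delta y].

Definition antimultiplicative (K : fieldType) (U : algType K)
    (gamma : U -> U) : Prop :=
  [/\ linear gamma, gamma 1 = 1 &
      forall x y, gamma (x * y) = gamma y * gamma x].

(* Components in U^+[mu] (x) U^-[-mu], mu in Gamma_+, of an element of the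
   completed tensor product. *)
Notation completed r Up Um := (cone r -> tens Up Um).

Record udata (K : fieldType) (r : nat) := UData {
  ud_alg :> algType K;
  ud_e : 'I_r -> ud_alg;
  ud_f : 'I_r -> ud_alg;
  ud_t : 'I_r -> ud_alg;                    (* h_alpha, resp. q^{h_alpha} *)
  ud_gen_p : ud_alg -> Prop;                (* generators of U^+ *)
  ud_gen_m : ud_alg -> Prop;                (* generators of U^- *)
  ud_gen_0 : ud_alg -> Prop;                (* generators of U^0 *)
  ud_Delta : ud_alg -> tens ud_alg ud_alg;
  ud_gamma : ud_alg -> ud_alg;
  ud_calF : completed r (subalg ud_gen_p) (subalg ud_gen_m);
  (* Weights of U^0 are recorded by the eigenvalues of the ud_t i: lambda (h_i)
     in the classical case, q^(lambda (h_i)) in the quantum case.  Accordingly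
     the sum of weights is the pointwise ud_wop, with unit ud_w1. *)
  ud_wop : K -> K -> K;
  ud_w1 : K;
  ud_wroot : root_lattice r -> 'I_r -> K;
  (* ud_den mu c is h_mu - c, resp. [h_mu - z]_q with c standing for q^z *)
  ud_den : cone r -> K -> ud_alg;
  (* the value of c for which ud_den mu c is eta_mu, resp. [eta_mu]_q *)
  ud_eta : cone r -> K;
  (* phi (- eta_mu) = ud_phi_num mu / ud_phi_den mu *)
  ud_phi_num : cone r -> ud_alg;
  ud_phi_den : cone r -> ud_alg
}.

Arguments ud_gen_p {K r} _ _.
Arguments ud_gen_m {K r} _ _.
Arguments ud_gen_0 {K r} _ _.

Section Classical.
Variables (K : fieldType) (g : semisimple_lie K) (U : algType K) (iota : g -> U).
Notation r := (lie_rank g).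

Definition lie_morphism (B : algType K) (j : g -> B) : Prop :=
  linear j /\ forall x y, j (lie_br x y) = j x * j y - j y * j x.

Definition enveloping_algebra : Prop :=
  lie_morphism iota /\
  forall (B : algType K) (j : g -> B), lie_morphism j ->
    exists phi : {lrmorphism U -> B}, (forall x, phi (iota x) = j x) /\
      forall psi : {lrmorphism U -> B},
        (forall x, psi (iota x) = j x) -> psi =1 phi.

Definition classical_Delta (Delta : U -> tens U U) : Prop :=
  comultiplicative Delta /\
  forall x, Delta (iota x) = tpure (iota x) 1 + tpure 1 (iota x).

Definition classical_gamma (gamma : U -> U) : Prop :=
  antimultiplicative gamma /\
  forall x, gamma (iota x) = - iota x.

Definition classical_gen_p (x : U) : Prop :=
  exists2 beta, beta \in lie_pos g & x = iota (lie_e beta).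
Definition classical_gen_m (x : U) : Prop :=
  exists2 beta, beta \in lie_pos g & x = iota (lie_f beta).

Lemma classical_e_in beta :
  beta \in lie_pos g -> iota (lie_e beta) \in subalg_pred classical_gen_p.
Proof. by move=> pb; apply/asboolP/InSubalgGen; exists beta. Qed.
Lemma classical_f_in beta :
  beta \in lie_pos g -> iota (lie_f beta) \in subalg_pred classical_gen_m.
Proof. by move=> pb; apply/asboolP/InSubalgGen; exists beta. Qed.

Definition classical_calF :
    completed r (subalg classical_gen_p) (subalg classical_gen_m) :=
  fun mu => match boolP (mu \in lie_pos g) with
  | AltTrue pmu => tpure (Subalg (classical_e_in pmu)) (Subalg (classical_f_in pmu))
  | AltFalse _ => 0
  end.

Definition classical_h (mu : cone r) : U := \sum_i (mu i)%:R *: iota (lie_h i).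

Definition classical_udata (Delta : U -> tens U U) (gamma : U -> U) : udata K r :=
  UData (fun i => iota (lie_e (simple_root i)))
        (fun i => iota (lie_f (simple_root i)))
        (fun i => iota (lie_h i))
        (fun x => exists i, x = iota (lie_h i))
        Delta gamma classical_calF
        +%R 0
        (fun lambda i => \sum_j (lambda j)%:~R * gram i j)
        (fun mu c => classical_h mu - c%:A)
        (fun mu => - eta_shift mu)
        (fun _ => 1)
        (fun mu => - (classical_h mu + (eta_shift mu)%:A)).

End Classical.

Section Quantum.
Variables (K : fieldType) (g : semisimple_lie K) (q : K).
Notation r := (lie_rank g).
Variables (b : 'I_r -> 'I_r -> int) (d : 'I_r -> nat).

(* The invariant form is normalized so that all powers of q are integral. *)
Definition normalized_form : Prop :=
  (forall i j, gram i j = (b i j)%:~R) /\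
  (forall i, (0 < d i)%N /\ b i i = (d i).*2%:Z).

Definition qnum (p : K) (n : nat) : K := (p ^+ n - p ^- n) / (p - p^-1).
Definition qfact (p : K) (n : nat) : K := \prod_(1 <= k < n.+1) qnum p k.
Definition qbinom (p : K) (n k : nat) : K :=
  qfact p n / (qfact p k * qfact p (n - k)).

(* 1 - a_ij for i <> j, where b i j = d i * a_ij *)
Definition serre_exp (i j : 'I_r) : nat := (`|b i j| %/ d i).+1.

Definition q_serre (B : algType K) (x : 'I_r -> B) : Prop :=
  forall i j, i != j ->
    \sum_(k < (serre_exp i j).+1)
      ((-1) ^+ k * qbinom (q ^+ d i) (serre_exp i j) k) *:
        (x i ^+ (serre_exp i j - k) * x j * x i ^+ k) = 0.

(* kk i and kk' i stand for q^{h_i} and q^{- h_i} *)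
Definition uq_relations (B : algType K) (e f kk kk' : 'I_r -> B) : Prop :=
  [/\ forall i, kk i * kk' i = 1 /\ kk' i * kk i = 1,
      forall i j, kk i * kk j = kk j * kk i,
      forall i j, kk i * e j = q ^ b i j *: (e j * kk i) /\
                  kk i * f j = q ^ (- b i j) *: (f j * kk i),
      forall i j, e i * f j - f j * e i =
        if i == j then (q - q^-1)^-1 *: (kk i - kk' i) else 0 &
      q_serre e /\ q_serre f].

Variables (U : algType K) (e f kk kk' : 'I_r -> U).

Definition quantum_group : Prop :=
  uq_relations e f kk kk' /\
  forall (B : algType K) (e1 f1 kk1 kk1' : 'I_r -> B),
    uq_relations e1 f1 kk1 kk1' ->
    exists phi : {lrmorphism U -> B},
      (forall i, [/\ phi (e i) = e1 i, phi (f i) = f1 i,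
                     phi (kk i) = kk1 i & phi (kk' i) = kk1' i]) /\
      forall psi : {lrmorphism U -> B},
        (forall i, [/\ psi (e i) = e1 i, psi (f i) = f1 i,
                       psi (kk i) = kk1 i & psi (kk' i) = kk1' i]) ->
        psi =1 phi.

Definition quantum_Delta (Delta : U -> tens U U) : Prop :=
  comultiplicative Delta /\
  forall i, [/\ Delta (f i) = tpure (f i) 1 + tpure (kk' i) (f i),
                Delta (e i) = tpure (e i) (kk i) + tpure 1 (e i),
                Delta (kk i) = tpure (kk i) (kk i) &
                Delta (kk' i) = tpure (kk' i) (kk' i)].

Definition quantum_Delta_tilde (Delta : U -> tens U U) : Prop :=
  comultiplicative Delta /\
  forall i, [/\ Delta (f i) = tpure (f i) 1 + tpure (kk i) (f i),
                Delta (e i) = tpure (e i) (kk' i) + tpure 1 (e i),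
                Delta (kk i) = tpure (kk i) (kk i) &
                Delta (kk' i) = tpure (kk' i) (kk' i)].

Definition quantum_gamma (gamma : U -> U) : Prop :=
  antimultiplicative gamma /\
  forall i, [/\ gamma (e i) = - (e i * kk' i), gamma (f i) = - (kk i * f i),
                gamma (kk i) = kk' i & gamma (kk' i) = kk i].

Definition quantum_gen_p (x : U) : Prop := exists i, x = e i.
Definition quantum_gen_m (x : U) : Prop := exists i, x = f i.
Definition quantum_gen_0 (x : U) : Prop := exists i, x = kk i \/ x = kk' i.

Definition quantum_wroot (lambda : root_lattice r) (i : 'I_r) : K :=
  q ^ (\sum_j lambda j * b i j).

(* U[lambda] *)
Definition quantum_weight (lambda : root_lattice r) (x : U) : Prop :=
  forall i, kk i * x = quantum_wroot lambda i *: (x * kk i).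

(* The components of Rcheck, extended by zero to the root lattice. *)
Definition lattice_ext (T : nmodType) (F : cone r -> T)
    (lambda : root_lattice r) : T :=
  if [forall i, 0 <= lambda i] then F [ffun i => `|lambda i|%N] else 0.

(* Rcheck Delta (u) = Delta_tilde (u) Rcheck in the completion of U (x) U: once
   Delta (u) and Delta_tilde (u) are decomposed with respect to the weight of
   the first tensor factor, this is an equality of (finite) sums for each
   weight kappa of the first factor. *)
Definition intertwines (Rc : cone r -> tens U U)
    (Delta Delta_tilde : U -> tens U U) : Prop :=
  forall (u : U) (s : seq (root_lattice r)) (a a' : root_lattice r -> tens U U),
    uniq s ->
    (forall lambda, lambda \in s ->
       in_tens (quantum_weight lambda) (fun=> True) (a lambda) /\
       in_tens (quantum_weight lambda) (fun=> True) (a' lambda)) ->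
    Delta u = \sum_(lambda <- s) a lambda ->
    Delta_tilde u = \sum_(lambda <- s) a' lambda ->
    forall kappa, \sum_(lambda <- s) lattice_ext Rc (kappa - lambda) * a lambda =
                  \sum_(lambda <- s) a' lambda * lattice_ext Rc (kappa - lambda).

Notation Up := (subalg quantum_gen_p).
Notation Um := (subalg quantum_gen_m).

(* These properties determine Rcheck. *)
Definition quantum_Rcheck (Delta Delta_tilde : U -> tens U U)
    (Rc : completed r Up Um) : Prop :=
  [/\ Rc 0 = 1,
      forall mu, in_tens (fun x : Up => quantum_weight (cone_lattice mu) (val x))
                         (fun y : Um => quantum_weight (- cone_lattice mu) (val y))
                         (Rc mu) &
      intertwines (fun mu => tmap val val (Rc mu)) Delta Delta_tilde].

Definition quantum_calF (Rc : completed r Up Um) : completed r Up Um :=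
  fun mu => (q - q^-1)^-1 *: (Rc mu - (if mu == 0 then 1 else 0)).

(* q^{h_mu} and q^{- h_mu} *)
Definition quantum_k (mu : cone r) : U := \prod_(i < r) kk i ^+ mu i.
Definition quantum_k' (mu : cone r) : U := \prod_(i < r) kk' i ^+ mu i.

Definition quantum_udata (Delta : U -> tens U U) (gamma : U -> U)
    (Rc : completed r Up Um) : udata K r :=
  UData e f kk quantum_gen_0 Delta gamma (quantum_calF Rc)
        *%R 1 quantum_wroot
        (fun mu c => (q - q^-1)^-1 *: (c^-1 *: quantum_k mu - c *: quantum_k' mu))
        (fun mu => q ^ (- int_eta_shift b mu))
        (fun mu => q ^ int_eta_shift b mu *: quantum_k mu)
        (fun mu => (q - q^-1)^-1 *: (q ^ (- int_eta_shift b mu) *: quantum_k' mu -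
                                     q ^ int_eta_shift b mu *: quantum_k mu)).

End Quantum.

Inductive is_U (K : fieldType) (g : semisimple_lie K) :
    udata K (lie_rank g) -> Prop :=
| ClassicalU (U : algType K) (iota : g -> U) (Delta : U -> tens U U)
    (gamma : U -> U) :
    enveloping_algebra iota -> classical_Delta iota Delta ->
    classical_gamma iota gamma ->
    is_U (classical_udata iota Delta gamma)
| QuantumU (q : K) (b : 'I_(lie_rank g) -> 'I_(lie_rank g) -> int)
    (d : 'I_(lie_rank g) -> nat) (U : algType K)
    (e f kk kk' : 'I_(lie_rank g) -> U) (Delta Delta_tilde : U -> tens U U)
    (gamma : U -> U)
    (Rc : completed (lie_rank g) (subalg (quantum_gen_p e))
                                 (subalg (quantum_gen_m f))) :
    q != 0 -> (forall n, (0 < n)%N -> q ^+ n != 1) ->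
    normalized_form b d -> quantum_group q b d e f kk kk' ->
    quantum_Delta e f kk kk' Delta -> quantum_Delta_tilde e f kk kk' Delta_tilde ->
    quantum_gamma e f kk kk' gamma ->
    quantum_Rcheck q b kk Delta Delta_tilde Rc ->
    is_U (quantum_udata q b kk kk' Delta gamma Rc).

Section Setting.
Variables (K : fieldType) (r : nat) (D : udata K r).

Notation Up := (subalg (ud_gen_p D)).
Notation Um := (subalg (ud_gen_m D)).
Notation Bp := (subalg (fun x : D => ud_gen_p D x \/ ud_gen_0 D x)).

Variables (A : algType K) (iota : {lrmorphism ud_alg D -> A}).

Definition ad (x : D) (a : A) : A :=
  tlift (fun u v => iota u * a * iota (ud_gamma v)) (ud_Delta x).

Definition weight_vector (lambda : 'I_r -> K) (a : A) : Prop :=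
  forall i, ad (ud_t D i) a = lambda i *: a.

Definition ad_diagonalizable : Prop :=
  forall a : A, exists2 s : seq A,
    (forall x, x \in s -> exists lambda, weight_vector lambda x) &
    a = \sum_(x <- s) x.

Definition bimod_act (t : tens Um Bp) (a : A) : A :=
  tlift (fun (u : Um) (v : Bp) => iota (val u) * a * iota (val v)) t.

Definition free_bimodule : Prop :=
  exists (J : choiceType) (basis : J -> A),
    (forall a : A, exists (s : seq J) (t : J -> tens Um Bp),
       a = \sum_(j <- s) bimod_act (t j) (basis j)) /\
    (forall (s : seq J) (t : J -> tens Um Bp), uniq s ->
       \sum_(j <- s) bimod_act (t j) (basis j) = 0 ->
       forall j, j \in s -> t j = 0).

(* (lambda, mu), resp. q^(lambda, mu) *)
Definition weight_pairing (lambda : 'I_r -> K) (mu : cone r) : K :=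
  \big[ud_wop D/ud_w1 D]_i iter (mu i) (ud_wop D (lambda i)) (ud_w1 D).

(* [cset mu] is the range of c in the denominators [h_mu - c]_q.  It has to
   contain the value giving eta_mu, and to be stable under the shifts caused by
   moving a denominator across a weight vector of A:
   (h_mu - c) a = a (h_mu - (c - (mu, lambda))). *)
Definition denominator_range (cset : cone r -> K -> Prop) : Prop :=
  (forall mu, mu != 0 -> cset mu (ud_eta D mu)) /\
  (forall (lambda : 'I_r -> K) (a : A), a != 0 -> weight_vector lambda a ->
     forall mu c,
       cset mu c <-> cset mu (ud_wop D c (weight_pairing lambda mu))).

Definition denominator (cset : cone r -> K -> Prop) (x : A) : Prop :=
  exists mu c, [/\ mu != 0, cset mu c & x = iota (ud_den D mu c)].

Definition denominator_prod (cset : cone r -> K -> Prop) (x : A) : Prop :=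
  exists2 s : seq A, (forall y, y \in s -> denominator cset y) &
                     x = \prod_(y <- s) y.

Variables (Ah : unitAlgType K) (loc : {lrmorphism A -> Ah}).

(* Ah is the (right) ring of fractions of A over the denominators. *)
Definition fraction_ring (cset : cone r -> K -> Prop) : Prop :=
  [/\ forall x, denominator cset x -> loc x \is a GRing.unit,
      forall z, exists a s, denominator_prod cset s /\ z = loc a * (loc s)^-1 &
      forall a, loc a = 0 -> exists2 s, denominator_prod cset s & a * s = 0].

Definition J_gen (x : A) : Prop := exists i, x = iota (ud_e D i).
Definition Jm_gen (x : A) : Prop := exists i, x = iota (ud_f D i).
Definition Jh_gen (x : Ah) : Prop := exists i, x = loc (iota (ud_e D i)).
Definition Jmh_gen (x : Ah) : Prop := exists i, x = loc (iota (ud_f D i)).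

Definition Uh_gen (cset : cone r -> K -> Prop) (x : Ah) : Prop :=
  (exists u : D, x = loc (iota u)) \/
  (exists2 y, denominator cset y & x = (loc y)^-1).

Definition extremal_projector (cset : cone r -> K -> Prop) : Prop :=
  exists (Ab : algType K) (j : {lrmorphism Ah -> Ab})
         (Ub Jp Jm : Ab -> Prop) (p : Ab),
    [/\ injective j,
        (forall x, in_subalg Ub x -> Ub x) /\
        (forall x, in_subalg (Uh_gen cset) x -> Ub (j x)),
        [/\ forall x, in_lideal Jp x -> Jp x,
            forall x, in_lideal Jh_gen x -> Jp (j x) &
            forall a, in_lideal J_gen a <-> Jp (j (loc a))],
        [/\ forall x, in_rideal Jm x -> Jm x,
            forall x, in_rideal Jmh_gen x -> Jm (j x) &
            forall a, in_rideal Jm_gen a <-> Jm (j (loc a))] &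
        [/\ Ub p /\ (forall i, GRing.comm p (j (loc (iota (ud_t D i))))),
            forall a, in_lideal J_gen a -> j (loc a) * p = 0,
            forall a, in_rideal Jm_gen a -> p * j (loc a) = 0,
            p * p = p &
            Jm (p - 1) /\ Jp (p - 1)]].

Definition Vhat : lmodType Ah := lquot Jh_gen.
Definition Vhat1 : Vhat := lquot_pi Jh_gen 1.

Definition Vhat_plus (v : Vhat) : Prop :=
  forall i, loc (iota (ud_e D i)) *: v = 0.

Definition phi (mu : cone r) : Ah :=
  loc (iota (ud_phi_num D mu)) * (loc (iota (ud_phi_den D mu)))^-1.

Definition calF (mu : cone r) : tens Up Ah :=
  tmap (fun u : Up => u) (fun v : Um => loc (iota (val v))) (ud_calF D mu).

(* The weight components of S^(n), as elements of U^+[mu] (x) Ah.  The component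
   mu of a product is the sum over mu = nu + (mu - nu). *)
Fixpoint shapovalov_n (n : nat) : completed r Up Ah :=
  match n with
  | 0%N => fun mu => if mu == 0 then 1 else 0
  | n'.+1 => fun mu =>
      if mu == 0 then 0 else
      (\sum_(nu : {ffun 'I_r -> 'I_(height mu).+1} | [forall i, (nu i <= mu i)%N])
         calF [ffun i => nat_of_ord (nu i)] *
         shapovalov_n n' [ffun i => (mu i - nu i)%N]) * tpure 1 (phi mu)
  end.

(* The component mu of S^(n) vanishes for n > height mu, as calF has no
   component of weight 0. *)
Definition shapovalov : completed r Up Ah :=
  fun mu => \sum_(n < (height mu).+1) shapovalov_n n mu.

Definition representation (B : algType K) (X : lmodType K) (act : B -> X -> X) : Prop :=
  [/\ bilin act, forall x, act 1 x = x &
      forall a b x, act (a * b) x = act a (act b x)].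

Variables (X : lmodType K) (inc : {linear X -> A}) (pi : Up -> X -> X).
Variables (I : choiceType) (psi : I -> X) (y : I -> {linear X -> K^o}).

Definition ad_submodule : Prop :=
  injective inc /\ forall (u : Up) x, inc (pi u x) = ad (val u) (inc x).

Definition dual_bases : Prop :=
  (forall i k, y i (psi k) = (i == k)%:R) /\
  (forall x, finite_set [set i | y i x != 0] /\
             x = \sum_(i \in [set: I]) y i x *: psi i).

(* X extends to a B^+-module, with psi i a weight vector of weight wt i. *)
Definition graded (wt : I -> 'I_r -> K) : Prop :=
  [/\ exists act : Bp -> X -> X,
        [/\ representation act,
            forall (u : Up) (b : Bp), val u = val b -> act b =1 pi u &
            forall (b : Bp) l i, val b = ud_t D l ->
              act b (psi i) = wt i l *: psi i],
      forall i, finite_set [set k | wt k =1 wt i] &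
      forall i k, exists beta, forall l,
        wt k l = ud_wop D (wt i l) (ud_wroot D beta l)].

(* S_ki, from pi (u) psi_i = \sum_k pi (u)_ki psi_k *)
Definition S_entry (k i : I) : Ah :=
  \sum_(mu \in [set: cone r])
    tlift (fun (u : Up) (b : Ah) => y k (pi u (psi i)) *: b) (shapovalov mu).

(* The (completed, if X is infinite-dimensional) tensor product of X^* and W is
   the space of linear maps X -> W, y (x) w being the map x |-> y (x) w.  The right
   action of u (x) b on X^* (x) Ah is then precomposition with pi (u), followed
   by right multiplication by b. *)
Definition dual_tens_act (Phi : X -> Ah) (T : completed r Up Ah) : X -> Ah :=
  fun x => \sum_(mu \in [set: cone r])
             tlift (fun (u : Up) (b : Ah) => Phi (pi u x) * b) (T mu).

Definition invariant_tensor : X -> Ah :=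
  fun x => \sum_(i \in [set: I]) y i x *: loc (inc (psi i)).

Definition Zvec : X -> Vhat :=
  fun x => dual_tens_act invariant_tensor shapovalov x *: Vhat1.

Definition in_dual_tens (P : Vhat -> Prop) (Phi : X -> Vhat) : Prop :=
  (forall (c : K) x x', Phi (c *: x + x') = c%:A *: Phi x + Phi x') /\
  (forall x, P (Phi x)).

End Setting.

Arguments Vhat_plus {K r D A} iota {Ah} loc v.

(* Main.v *)
Require Import Defs.
From mathcomp Require Import all_boot all_order all_algebra.
From mathcomp Require Import boolp classical_sets cardinality fsbigop reals.
From mathcomp Require Import complex.
From mathcomp Require Import ring.

Set Implicit Arguments.
Unset Strict Implicit.
Unset Printing Implicit Defensive.

Import GRing.Theory Num.Theory.

Local Open Scope ring_scope.

(** Write S_mu for the component of S of weight (mu, - mu) and theta_mu for the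
    inverse of phi (- eta_mu), so that the recursion defining S reads
    (F S)_mu = S_mu theta_mu.  Commuting F with Delta (e_alpha), by the
    intertwining property of the R-matrix (quantum case) or the invariance of
    the form (classical case), shows that T = Delta (e_alpha) S satisfies the
    same recursion; as T_0 = 1 (x) e_alpha and F has no component of weight 0,
    all T_mu lie in U^+ (x) B^- e_alpha, by induction on mu.  The shift
    eta_(mu + alpha) - eta_mu is controlled by 2 (alpha, rho) = (alpha, alpha),
    obtained from a trace.  Finally e_alpha a = ad (e_alpha)(a) k_alpha + a e_alpha
    turns left multiplication of Z by e_alpha into the action of T, and
    e_alpha kills the generator of V.

    To avoid flatness questions the first leg of S is mapped from U^+ to U, which
    is harmless because the adjoint action is defined on all of U. *)

(** * Tensor products *)

(** Both cases are reduced to the identities collected in [shapovalov_data], so the recursion is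
    solved only once. A weight is encoded there by the rule t x = x (a t + b), multiplicative for t
    = q^h and additive for t = h. Stating the recursion with theta instead of its inverse keeps
    denominators out of these identities, and the convention theta_0 = 0 lets the recursion for S
    include mu = 0. F alone commutes with Delta (e_alpha) only up to a term e_alpha (x) [h_alpha]_q
    in weight alpha. This defect is exactly what the passage from theta_mu to theta_(mu + alpha)
    compensates, which dictates the form of eta_mu. Since X may be infinite-dimensional, the sums
    over mu are not finite for free. Gradedness allows a single mu in each entry S_ki, so distinct
    mu cannot cancel there, and the finiteness of the columns of S_X then bounds the mu that act
    nontrivially on a given vector. *)

Section TensorLift.
Variables (K : fieldType) (V W : lmodType K) (Z : lmodType K) (f : V -> W -> Z).
Hypothesis fB : bilin f.

Lemma tliftD x y : tlift f (x + y) = tlift f x + tlift f y.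
Proof. by have := tlift_linear fB 1 x y; rewrite !scale1r. Qed.

Lemma tlift0 : tlift f 0 = 0.
Proof. by apply: (addrI (tlift f 0)); rewrite -tliftD !addr0. Qed.

Lemma tliftZ c x : tlift f (c *: x) = c *: tlift f x.
Proof. by have := tlift_linear fB c x 0; rewrite !addr0 tlift0 addr0. Qed.

Lemma tlift_sum (J : Type) (s : seq J) (P : pred J) (F : J -> tens V W) :
  tlift f (\sum_(j <- s | P j) F j) = \sum_(j <- s | P j) tlift f (F j).
Proof. by apply: (big_morph _ tliftD tlift0). Qed.

End TensorLift.

Section TensorPure.
Variables (K : fieldType) (V W : lmodType K).

Lemma tpureDl (v v' : V) (w : W) : tpure (v + v') w = tpure v w + tpure v' w.
Proof. exact: (bilinDl (tpure_bilin V W)). Qed.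
Lemma tpureDr (v : V) (w w' : W) : tpure v (w + w') = tpure v w + tpure v w'.
Proof. exact: (bilinDr (tpure_bilin V W)). Qed.
Lemma tpureZl c (v : V) (w : W) : tpure (c *: v) w = c *: tpure v w.
Proof. exact: (bilinZl (tpure_bilin V W)). Qed.
Lemma tpureZr c (v : V) (w : W) : tpure v (c *: w) = c *: tpure v w.
Proof. exact: (bilinZr (tpure_bilin V W)). Qed.
Lemma tpure0r (v : V) : tpure v (0 : W) = 0.
Proof. exact: (bilin0r (tpure_bilin V W)). Qed.
Lemma tpureBl (v v' : V) (w : W) : tpure (v - v') w = tpure v w - tpure v' w.
Proof. by rewrite tpureDl -scaleN1r tpureZl scaleN1r. Qed.
Lemma tpureNr (v : V) (w : W) : tpure v (- w) = - tpure v w.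
Proof. by rewrite -scaleN1r tpureZr scaleN1r. Qed.
Lemma tpureBr (v : V) (w w' : W) : tpure v (w - w') = tpure v w - tpure v w'.
Proof. by rewrite tpureDr tpureNr. Qed.

End TensorPure.

Section TensorMap.
Variables (K : fieldType) (V W V' W' : lmodType K).
Variables (f : {linear V -> V'}) (g : {linear W -> W'}).

Lemma tmap_bilin : bilin (fun v w => tpure (f v) (g w)).
Proof.
split=> [v c w w'|w c v v']; rewrite linearP.
  by rewrite tpureDr tpureZr.
by rewrite tpureDl tpureZl.
Qed.

Lemma tmap_pure v w : tmap f g (tpure v w) = tpure (f v) (g w).
Proof. by rewrite /tmap tlift_pure //; exact: tmap_bilin. Qed.

Lemma tmapD x y : tmap f g (x + y) = tmap f g x + tmap f g y.
Proof. exact: (tliftD tmap_bilin). Qed.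
Lemma tmap0 : tmap f g 0 = 0.
Proof. exact: (tlift0 tmap_bilin). Qed.
Lemma tmapZ c x : tmap f g (c *: x) = c *: tmap f g x.
Proof. exact: (tliftZ tmap_bilin). Qed.
Lemma tmapN x : tmap f g (- x) = - tmap f g x.
Proof. by rewrite -scaleN1r tmapZ scaleN1r. Qed.
Lemma tmap_sum (J : Type) (s : seq J) (P : pred J) (F : J -> tens V W) :
  tmap f g (\sum_(j <- s | P j) F j) = \sum_(j <- s | P j) tmap f g (F j).
Proof. exact: (tlift_sum tmap_bilin). Qed.

End TensorMap.

Section TensorRing.
Variables (K : fieldType) (A B : algType K).
Implicit Types x y : tens A B.

Lemma tpureM (a a' : A) (b b' : B) :
  tpure a b * tpure a' b' = tpure (a * a') (b * b') :> tens A B.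
Proof. exact: tens_mul_pure. Qed.

Lemma tens_scalerAl c x y : c *: (x * y) = (c *: x) * y.
Proof. by have := tens_mul_linl y c x 0; rewrite addr0 tens_mul0l addr0. Qed.

Lemma tens_scalerAr c x y : c *: (x * y) = x * (c *: y).
Proof. by have := tens_mul_linr x c y 0; rewrite addr0 tens_mul0r addr0. Qed.

End TensorRing.

Section TensorMapRing.
Variables (K : fieldType) (A B A' B' : algType K).
Variables (f : {linear A -> A'}) (g : {linear B -> B'}).

Lemma tmapM (fM : {morph f : x y / x * y}) (gM : {morph g : x y / x * y})
    (x y : tens A B) : tmap f g (x * y) = tmap f g x * tmap f g y.
Proof.
elim/tens_ind: x => [a b||x x' IH IH'].
- elim/tens_ind: y => [a' b'||y y' IH IH'].
  + by rewrite !tpureM !tmap_pure !tpureM fM gM.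
  + by rewrite mulr0 tmap0 mulr0.
  + by rewrite mulrDr !tmapD mulrDr IH IH'.
- by rewrite mul0r tmap0 mul0r.
- by rewrite mulrDl !tmapD mulrDl IH IH'.
Qed.

Lemma tmap1 : f 1 = 1 -> g 1 = 1 -> tmap f g 1 = 1.
Proof. by move=> f1 g1; rewrite {1}/GRing.one /= /tens_one tmap_pure f1 g1. Qed.

End TensorMapRing.

(** * Subspaces P (x) Q of a tensor product *)

Section InTens.
Variables (K : fieldType).

Lemma in_tens0 (V W : lmodType K) (P : V -> Prop) (Q : W -> Prop) : in_tens P Q 0.
Proof. by exists [::]; rewrite ?big_nil. Qed.

Lemma in_tens_pure (V W : lmodType K) (P : V -> Prop) (Q : W -> Prop) v w :
  P v -> Q w -> in_tens P Q (tpure v w).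
Proof.
by move=> Pv Qw; exists [:: (v, w)]; rewrite ?big_seq1 // => p; rewrite inE => /eqP->.
Qed.

Lemma in_tensD (V W : lmodType K) (P : V -> Prop) (Q : W -> Prop) x y :
  in_tens P Q x -> in_tens P Q y -> in_tens P Q (x + y).
Proof.
move=> [s hs ->] [t ht ->]; exists (s ++ t); last by rewrite big_cat.
by move=> p; rewrite mem_cat => /orP[/hs|/ht].
Qed.

Lemma in_tens_sum (V W : lmodType K) (P : V -> Prop) (Q : W -> Prop)
    (J : Type) (s : seq J) (C : pred J) (F : J -> tens V W) :
  (forall j, C j -> in_tens P Q (F j)) -> in_tens P Q (\sum_(j <- s | C j) F j).
Proof.
move=> h; apply: big_ind => //; [exact: in_tens0 | exact: in_tensD].
Qed.

Lemma in_tens_big_seq (V W : lmodType K) (P : V -> Prop) (Q : W -> Prop)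
    (J : eqType) (s : seq J) (F : J -> tens V W) :
  (forall j, j \in s -> in_tens P Q (F j)) -> in_tens P Q (\sum_(j <- s) F j).
Proof. by move=> h; rewrite big_seq; apply: in_tens_sum. Qed.

Lemma in_tens_tlift (V W V' W' : lmodType K) (P : V -> Prop) (Q : W -> Prop)
    (P' : V' -> Prop) (Q' : W' -> Prop) (f : V -> W -> tens V' W') x :
  bilin f -> (forall v w, P v -> Q w -> in_tens P' Q' (f v w)) ->
  in_tens P Q x -> in_tens P' Q' (tlift f x).
Proof.
move=> fB h [s hs ->]; rewrite tlift_sum //; apply: in_tens_big_seq => p ps.
by rewrite tlift_pure //; have [] := hs _ ps; apply: h.
Qed.

Lemma in_tens_tmap (V W V' W' : lmodType K) (P : V -> Prop) (Q : W -> Prop)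
    (P' : V' -> Prop) (Q' : W' -> Prop) (f : {linear V -> V'}) (g : {linear W -> W'}) x :
  (forall v, P v -> P' (f v)) -> (forall w, Q w -> Q' (g w)) ->
  in_tens P Q x -> in_tens P' Q' (tmap f g x).
Proof.
move=> hP hQ; apply: in_tens_tlift; first exact: tmap_bilin.
by move=> v w Pv Qw; apply: in_tens_pure; auto.
Qed.

Lemma in_tensM (A B : algType K) (P P' P'' : A -> Prop) (Q Q' Q'' : B -> Prop) x y :
  (forall a a', P a -> P' a' -> P'' (a * a')) ->
  (forall b b', Q b -> Q' b' -> Q'' (b * b')) ->
  in_tens P Q x -> in_tens P' Q' y -> in_tens P'' Q'' (x * y).
Proof.
move=> hP hQ [s hs ->] [t ht ->]; rewrite mulr_suml.
apply: in_tens_big_seq => p /hs[? ?]; rewrite mulr_sumr.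
apply: in_tens_big_seq => p' /ht[? ?]; rewrite tpureM.
by apply: in_tens_pure; auto.
Qed.

Lemma in_tensT (A B : algType K) (x : tens A B) : in_tens (fun=> True) (fun=> True) x.
Proof. by rewrite (tens_sum_pure x); apply: in_tens_sum => p _; exact: in_tens_pure. Qed.

End InTens.

(** * Convolution over the cone of weights *)

Section Cone.
Variable r : nat.
Implicit Types (mu nu : cone r) (i : 'I_r).

Definition cone_le nu mu := [forall i, (nu i <= mu i)%N].
Definition cone_sub mu nu : cone r := [ffun i => (mu i - nu i)%N].

(** Built from functions bounded by [height mu], so that it matches the index set of the sum in
    [shapovalov_n]. *)
Definition below mu : seq (cone r) :=
  [seq ([ffun i => nat_of_ord (f i)] : cone r) |
     f : {ffun 'I_r -> 'I_(height mu).+1} <-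
       enum (fun f : {ffun 'I_r -> 'I_(height mu).+1} => [forall i, (f i <= mu i)%N])].

Lemma cone_leP nu mu : reflect (forall i, (nu i <= mu i)%N) (cone_le nu mu).
Proof. exact: forallP. Qed.

Lemma cone_addE mu nu i : (mu + nu) i = (mu i + nu i)%N.
Proof. by rewrite ffunE. Qed.

Lemma cone0E i : (0 : cone r) i = 0%N.
Proof. by rewrite ffunE. Qed.

Lemma coord_le_height mu i : (mu i <= height mu)%N.
Proof. by rewrite /height (bigD1 i) //= leq_addr. Qed.

Lemma height_eq0 mu : (height mu == 0%N) = (mu == 0).
Proof.
apply/eqP/eqP => [h|->]; last by rewrite /height big1 // => i _; rewrite ffunE.
apply/ffunP => i; rewrite cone0E; apply/eqP; rewrite -leqn0 -h.
exact: coord_le_height.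
Qed.

Lemma heightD mu nu : height (mu + nu) = (height mu + height nu)%N.
Proof. by rewrite /height -big_split /=; apply: eq_bigr => i _; rewrite cone_addE. Qed.

Lemma cone_subK mu nu : cone_le nu mu -> cone_sub mu nu + nu = mu.
Proof. by move/cone_leP => h; apply/ffunP => i;
  rewrite !ffunE [RHS](esym (subnK (h i))). Qed.

Lemma height_sub mu nu : cone_le nu mu -> (height (cone_sub mu nu) + height nu)%N =
    height mu.
Proof. by move=> h; rewrite -heightD cone_subK. Qed.

Lemma mem_below nu mu : (nu \in below mu) = cone_le nu mu.
Proof.
apply/mapP/cone_leP => [[f]|h].
  by rewrite mem_enum => /forallP h -> i; rewrite ffunE.
have hlt i : (nu i < (height mu).+1)%N.
  by rewrite ltnS (leq_trans (h i)) ?coord_le_height.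
exists [ffun i => Ordinal (hlt i)].
  rewrite mem_enum unfold_in; apply/forallP => i; rewrite ffunE; exact: h.
by apply/ffunP => i; rewrite !ffunE.
Qed.

Lemma below_uniq mu : uniq (below mu).
Proof.
rewrite map_inj_uniq ?enum_uniq // => f f' /ffunP h.
by apply/ffunP => i; apply: val_inj; have := h i; rewrite !ffunE.
Qed.

Definition pred_simple i mu : cone r := [ffun j => (mu j - (j == i))%N].

Lemma pred_simpleE i mu : (0 < mu i)%N -> pred_simple i mu + simple_root i = mu.
Proof.
move=> h; apply/ffunP => j; rewrite !ffunE.
by case: eqP => [->|_]; [exact: subnK | rewrite subn0 addr0].
Qed.

Lemma pred_simpleK i mu : pred_simple i (mu + simple_root i) = mu.
Proof. by apply/ffunP => j; rewrite !ffunE; exact: addnK. Qed.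

Lemma addsimple_gt0 i mu : (0 < (mu + simple_root i)%R i)%N.
Proof. by rewrite cone_addE !ffunE eqxx addn1. Qed.

(** Translation by alpha_i, extended by zero. The guard is essential: truncated subtraction would
    otherwise evaluate F at a wrong weight. *)
Definition shift (T : nmodType) i (F : cone r -> T) mu : T :=
  if (0 < mu i)%N then F (pred_simple i mu) else 0.

Lemma shift_add (T : nmodType) i (F : cone r -> T) mu :
  shift i F (mu + simple_root i) = F mu.
Proof. by rewrite /shift addsimple_gt0 pred_simpleK. Qed.

Lemma shift0 (T : nmodType) i (F : cone r -> T) : shift i F 0 = 0.
Proof. by rewrite /shift cone0E. Qed.

(** The map nu |-> mu - nu is an involution of the interval below mu. *)
Lemma sum_below_rev (T : nmodType) (H : cone r -> cone r -> T) mu :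
  \sum_(nu <- below mu) H nu (cone_sub mu nu) =
  \sum_(nu <- below mu) H (cone_sub mu nu) nu.
Proof.
have sub_le nu : cone_le (cone_sub mu nu) mu.
  by apply/cone_leP => j; rewrite ffunE leq_subr.
have subK nu : cone_le nu mu -> cone_sub mu (cone_sub mu nu) = nu.
  by move=> /cone_leP h; apply/ffunP => j; rewrite !ffunE subKn.
rewrite (perm_big [seq cone_sub mu nu | nu <- below mu]) /=.
  by rewrite big_map; apply: eq_big_seq => nu; rewrite mem_below => /subK ->.
apply: uniq_perm; first exact: below_uniq.
  rewrite (map_inj_in_uniq (s := below mu)) ?below_uniq // => nu nu'.
  by rewrite !mem_below => h h' E; rewrite -(subK _ h) E subK.
move=> nu; rewrite mem_below; apply/idP/mapP => [h|[nu' _ ->]] //.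
by exists (cone_sub mu nu); rewrite ?mem_below ?subK.
Qed.

(** Only the nu with nu_i < mu_i contribute, and they form the interval below mu - alpha_i. *)
Lemma sum_below_shift (T : nmodType) i (H : cone r -> cone r -> T) mu :
  \sum_(nu <- below mu) shift i (H nu) (cone_sub mu nu) =
  shift i (fun la => \sum_(nu <- below la) H nu (cone_sub la nu)) mu.
Proof.
rewrite {2}/shift; case: ifP => [h|/negbT h]; last first.
  apply: big1_seq => nu _; rewrite /shift ffunE.
  by move: h; rewrite -leqNgt leqn0 => /eqP->; rewrite sub0n.
rewrite (bigID (fun nu : cone r => (nu i < mu i)%N)) /= [X in _ + X]big1 ?addr0.
  rewrite -big_filter; rewrite (perm_big (below (pred_simple i mu))) /=.
    apply: eq_big_seq => nu; rewrite mem_below => /cone_leP hnu.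
    rewrite /shift ffunE subn_gt0.
    have := hnu i; rewrite ffunE eqxx => hi.
    rewrite (leq_ltn_trans hi) ?subn1 ?prednK //; congr (H nu _).
    by apply/ffunP => j; rewrite !ffunE -!subnDA addnC.
  apply: uniq_perm; rewrite ?filter_uniq ?below_uniq // => nu.
  rewrite mem_filter !mem_below; apply/andP/cone_leP => [[hi /cone_leP hj] j|hj].
    rewrite ffunE; case: eqP => [->|_]; last by rewrite subn0.
    by rewrite subn1 -ltnS prednK.
  split; last first.
    by apply/cone_leP => j; apply: leq_trans (hj j) _; rewrite ffunE leq_subr.
  have := hj i; rewrite ffunE eqxx subn1 => hi.
  by rewrite -(prednK h) ltnS.
by move=> nu; rewrite -leqNgt => hh; rewrite /shift ffunE subn_gt0 ltnNge hh.
Qed.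

End Cone.

Section Convolution.
Variables (r : nat) (T : pzRingType).
Implicit Types F S : cone r -> T.

(** Weight component of a product in the completed tensor product. *)
Definition conv F S mu := \sum_(nu <- below mu) F nu * S (cone_sub mu nu).

Lemma convDr F S S' mu :
  conv F (fun nu => S nu + S' nu) mu = conv F S mu + conv F S' mu.
Proof. by rewrite /conv -big_split /=; apply: eq_bigr => nu _; rewrite mulrDr. Qed.

Lemma convDl F F' S mu :
  conv (fun nu => F nu + F' nu) S mu = conv F S mu + conv F' S mu.
Proof. by rewrite /conv -big_split /=; apply: eq_bigr => nu _; rewrite mulrDl. Qed.

Lemma conv_mulA F S a mu :
  conv F (fun nu => a * S nu) mu = conv (fun nu => F nu * a) S mu.
Proof. by apply: eq_bigr => nu _; rewrite mulrA. Qed.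

Lemma conv_mull F S a mu : conv (fun nu => a * F nu) S mu = a * conv F S mu.
Proof. by rewrite /conv mulr_sumr; apply: eq_bigr => nu _; rewrite mulrA. Qed.

Lemma eq_conv F F' S S' mu : F =1 F' -> S =1 S' -> conv F S mu = conv F' S' mu.
Proof. by move=> h h'; apply: eq_bigr => nu _; rewrite h h'. Qed.

Lemma conv_shiftr i F S mu : conv F (shift i S) mu = shift i (conv F S) mu.
Proof.
rewrite -(sum_below_shift i (fun nu la => F nu * S la)); apply: eq_bigr => nu _.
by rewrite /shift; case: ifP => // _; rewrite mulr0.
Qed.

Lemma conv_shiftl i F S mu : conv (shift i F) S mu = shift i (conv F S) mu.
Proof.
rewrite /conv (sum_below_rev (fun nu la => shift i F nu * S la)).
rewrite (eq_bigr (fun nu => shift i (fun la => F la * S nu) (cone_sub mu nu))).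
  rewrite (sum_below_shift i (fun nu la => F la * S nu)) /shift.
  by case: ifP => // _; rewrite -(sum_below_rev (fun nu la => F nu * S la)).
by move=> nu _; rewrite /shift; case: ifP => // _; rewrite mul0r.
Qed.

End Convolution.

(** * The recursion satisfied by [Delta (e_alpha) S] *)

Definition lmul_of (C : pzRingType) (e : C) (c : C) : Prop := exists c', c = c' * e.

Section SingularRecursion.
Variables (K : fieldType) (r : nat) (B C : algType K).
Notation T := (tens B C).
Variables (F S : cone r -> T) (i : 'I_r) (e : B) (ec k k' h : C).
Variables (theta phi : cone r -> C).

Hypothesis F0 : F 0 = 0.
Hypothesis S0 : S 0 = 1.
Hypothesis S_rec : forall mu, conv F S mu = S mu * tpure 1 (theta mu).
Hypothesis F_comm : forall mu,
  shift i F mu * tpure e k + F mu * tpure 1 ec =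
  tpure 1 ec * F mu + tpure e k' * shift i F mu -
  shift i (fun nu => if nu == 0 then tpure e h else 0) mu.
Hypothesis S_weight : forall mu,
  tpure 1 k' * S mu * tpure 1 (theta mu) - tpure 1 h * S mu =
  tpure 1 k * S mu * tpure 1 (theta (mu + simple_root i)).
Hypothesis theta_phi : forall mu, mu != 0 -> theta mu * phi mu = 1.
Hypothesis phi_ec : forall mu, mu != 0 -> lmul_of ec (ec * phi mu).

(** Component of weight mu of Delta (e_alpha) S: the summand e (x) k raises the weight of the first
    leg by alpha, the summand 1 (x) e does not. *)
Definition coprod_mul mu : T := tpure e k * shift i S mu + tpure 1 ec * S mu.

(** After F is moved past Delta (e_alpha), the part 1 (x) e reproduces theta_mu at once. In the
    other part k' S_(mu - alpha) theta_(mu - alpha) meets the defect - h S_(mu - alpha), and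
    [S_weight] recombines them into k S_(mu - alpha) theta_mu. *)
Lemma conv_coprod_mul mu : conv F coprod_mul mu = coprod_mul mu * tpure 1 (theta mu).
Proof.
have tp a : tpure e a = tpure e 1 * tpure 1 a :> T by rewrite tpureM mulr1 mul1r.
rewrite /coprod_mul convDr !conv_mulA.
rewrite conv_shiftr -conv_shiftl -convDl.
rewrite (_ : conv _ S mu = conv (fun nu => (tpure 1 ec * F nu +
    tpure e k' * shift i F nu) +
    shift i (fun la => if la == 0 then - tpure e h else 0) nu) S mu); last first.
  apply: eq_conv => // nu; rewrite /=.
  have -> : shift i (fun la => F la * tpure e k) nu = shift i F nu * tpure e k.
    by rewrite /shift; case: ifP => // _; rewrite mul0r.
  rewrite F_comm; congr (_ + _); rewrite /shift; case: ifP => _; rewrite ?oppr0 //.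
  by case: ifP => _ //; rewrite oppr0.
rewrite !convDl !conv_mull !conv_shiftl.
(* The defect is concentrated in one weight, so convolution with it is a plain multiplication. *)
have d0 la : conv (fun nu : cone r => if nu == 0 then - tpure e h else 0) S la =
    - tpure e h * S la.
  rewrite /conv (bigD1_seq 0) ?below_uniq //=; last first.
    by rewrite mem_below; apply/cone_leP => j; rewrite ffunE.
  rewrite eqxx big1 ?addr0 => [|nu /negPf->]; last by rewrite mul0r.
  by congr (_ * S _); apply/ffunP => j; rewrite !ffunE; exact: subn0.
rewrite S_rec mulrDl [RHS]addrC -!mulrA -addrA; congr (_ + _).
rewrite /shift; case: ifP => [hi|_]; last by rewrite !mulr0 mul0r mulr0 addr0.
have := S_weight (pred_simple i mu); rewrite pred_simpleE // => SW.
rewrite d0 S_rec (tp k) (tp k') (tp h) mulNr -!mulrA -mulrBr; congr (_ * _).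
by rewrite [X in X - _]mulrA SW -mulrA.
Qed.

(** Dividing by theta_mu expresses T_mu through components of smaller height. The division
    multiplies by [phi mu] on the right, under which the left ideal C e is stable by [phi_ec]. *)
Lemma coprod_mul_lideal mu : in_tens (fun=> True) (lmul_of ec) (coprod_mul mu).
Proof.
have [n] := ubnP (height mu); elim: n mu => // n IH mu; rewrite ltnS => hn.
have [->|mu0] := eqVneq mu 0.
  rewrite /coprod_mul shift0 mulr0 add0r S0 mulr1.
  by apply: in_tens_pure => //; exists 1; rewrite mul1r.
have -> : coprod_mul mu = conv F coprod_mul mu * tpure 1 (phi mu).
  by rewrite conv_coprod_mul -mulrA tpureM theta_phi // mul1r mulr1.
apply: (in_tensM (P := fun=> True) (P' := fun=> True) (Q := lmul_of ec)
                 (Q' := fun b => b = phi mu)) => //; last first.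
- exact: in_tens_pure.
- apply: in_tens_big_seq => nu; rewrite mem_below => hnu.
  (* The term nu = 0 would involve T_mu itself; it vanishes because F_0 = 0. *)
  have [->|nu0] := eqVneq nu 0; first by rewrite F0 mul0r; exact: in_tens0.
  apply: (in_tensM (P := fun=> True) (P' := fun=> True) (Q := fun=> True)
                   (Q' := lmul_of ec)) => //.
  + by move=> b _ _ [c ->]; exists (b * c); rewrite mulrA.
  + exact: in_tensT.
  + apply: IH; apply: leq_trans hn; rewrite -(height_sub hnu) -ltn_subLR ?subnn //.
    by rewrite lt0n height_eq0.
- move=> _ _ [c ->] ->; have [c' E] := phi_ec mu0.
  by exists (c * c'); rewrite -!mulrA E.
Qed.

End SingularRecursion.

(** * The Shapovalov matrix *)

Section ShapovalovData.
Variables (K : fieldType) (r : nat) (D : udata K r).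

Definition affine_t (a b : 'I_r -> root_lattice r -> K) l lambda : D :=
  a l lambda *: ud_t D l + (b l lambda)%:A.

(* [x] has weight [lambda]: moving [t_l] across [x] turns it into
   [a t_l + b]; classically [a = 1], [b = lambda (h_l)], in the quantum case
   [a = q^(lambda (h_l))], [b = 0]. *)
Definition has_weight (a b : 'I_r -> root_lattice r -> K) (C : algType K)
    (j : D -> C) (lambda : root_lattice r) (x : C) : Prop :=
  forall l, j (ud_t D l) * x = x * j (affine_t a b l lambda).

Notation Up := (subalg (ud_gen_p D)).
Notation Um := (subalg (ud_gen_m D)).
Notation Bp := (subalg (fun x : D => ud_gen_p D x \/ ud_gen_0 D x)).

(* [sd_k], [sd_k'] and [sd_h] stand for q^(h_alpha), q^(- h_alpha) and
   [h_alpha]_q, that is 1, 1 and h_alpha classically; [sd_theta mu] is the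
   inverse of phi (- eta_mu), extended to [mu = 0] by its limit value 0. *)
Record shapovalov_data := ShapovalovData {
  sd_k : 'I_r -> D;
  sd_k' : 'I_r -> D;
  sd_h : 'I_r -> D;
  sd_theta : cone r -> D;
  sd_a : 'I_r -> root_lattice r -> K;
  sd_b : 'I_r -> root_lattice r -> K;
  sd_DeltaP : comultiplicative (@ud_Delta _ _ D);
  sd_gammaP : antimultiplicative (@ud_gamma _ _ D);
  sd_calF0 : ud_calF D 0 = 0;
  sd_e_in : forall i, ud_e D i \in subalg_pred (ud_gen_p D);
  sd_t_in : forall l, ud_gen_0 D (ud_t D l);
  sd_Delta_e : forall i,
    ud_Delta (ud_e D i) = tpure (ud_e D i) (sd_k i) + tpure 1 (ud_e D i);
  sd_gamma_k : forall i, ud_gamma (sd_k i) * sd_k i = 1;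
  sd_gamma_e : forall i, ud_gamma (ud_e D i) * sd_k i = - ud_e D i;
  sd_calF_comm : forall i mu,
    shift i (fun nu => tmap val val (ud_calF D nu)) mu * tpure (ud_e D i) (sd_k i) +
      tmap val val (ud_calF D mu) * tpure 1 (ud_e D i) =
    tpure 1 (ud_e D i) * tmap val val (ud_calF D mu) +
      tpure (ud_e D i) (sd_k' i) *
        shift i (fun nu => tmap val val (ud_calF D nu)) mu -
      shift i (fun nu => if nu == 0 then tpure (ud_e D i) (sd_h i) else 0) mu;
  sd_aD : forall l lambda mu, sd_a l (lambda + mu) = sd_a l lambda * sd_a l mu;
  sd_bD : forall l lambda mu,
    sd_b l (lambda + mu) = sd_a l lambda * sd_b l mu + sd_b l lambda;
  sd_a0 : forall l, sd_a l 0 = 1;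
  sd_b0 : forall l, sd_b l 0 = 0;
  sd_wopE : forall w l lambda,
    ud_wop D w (ud_wroot D lambda l) = sd_a l lambda * w + sd_b l lambda;
  sd_calF_weight : forall mu,
    in_tens (fun u : Up => has_weight sd_a sd_b id (cone_lattice mu) (val u))
            (fun v : Um => has_weight sd_a sd_b id (- cone_lattice mu) (val v))
            (ud_calF D mu);
  sd_theta0 : sd_theta 0 = 0;
  sd_theta_num : forall mu, sd_theta mu * ud_phi_num D mu = ud_phi_den D mu;
  sd_num_theta : forall mu, ud_phi_num D mu * sd_theta mu = ud_phi_den D mu;
  sd_theta_den : forall mu, sd_theta mu * ud_phi_den D mu = ud_phi_den D mu * sd_theta mu;
  sd_t_num : forall l mu, ud_t D l * ud_phi_num D mu = ud_phi_num D mu * ud_t D l;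
  sd_t_den : forall l mu, ud_t D l * ud_phi_den D mu = ud_phi_den D mu * ud_t D l;
  sd_denE : forall mu, ud_phi_den D mu = - ud_den D mu (ud_eta D mu);
  sd_e_den : forall i mu c, ud_e D i * ud_den D mu c =
    ud_den D mu (ud_wop D c
      (weight_pairing D (ud_wroot D (cone_lattice (simple_root i))) mu)) * ud_e D i;
  sd_e_num : forall i mu, lmul_of (ud_e D i) (ud_e D i * ud_phi_num D mu);
  sd_e_weight : forall i l,
    tlift (fun u v => u * ud_e D i * ud_gamma v) (ud_Delta (ud_t D l)) =
    ud_wroot D (cone_lattice (simple_root i)) l *: ud_e D i;
  sd_theta_shift : forall i mu (C : algType K) (j : {lrmorphism D -> C}) s,
    has_weight sd_a sd_b j (- cone_lattice mu) s ->
    j (sd_k' i) * s * j (sd_theta mu) - j (sd_h i) * s =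
    j (sd_k i) * s * j (sd_theta (mu + simple_root i));
  sd_wroot_inj : forall mu nu : cone r,
    ud_wroot D (cone_lattice mu) =1 ud_wroot D (cone_lattice nu) -> mu = nu;
  sd_wop_inj : forall (X : lmodType K) (act : Bp -> X -> X) x l w,
    representation act -> x != 0 ->
    (forall b : Bp, val b = ud_t D l -> act b x = w *: x) -> injective (ud_wop D w)
}.

End ShapovalovData.

Arguments affine_t {K r D} a b l lambda.

(** * The components of S over the ring of fractions *)

Section ShapovalovMatrix.
Variables (K : fieldType) (r : nat) (D : udata K r) (sd : shapovalov_data D).
Variables (A : algType K) (iota : {lrmorphism ud_alg D -> A}).
Variables (Ah : unitAlgType K) (loc : {lrmorphism A -> Ah}).
Variable cset : cone r -> K -> Prop.
Hypothesis cset_P : denominator_range iota cset.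
Hypothesis Ah_P : fraction_ring iota loc cset.

Notation Up := (subalg (ud_gen_p D)).
Notation Um := (subalg (ud_gen_m D)).

Let j : {lrmorphism D -> Ah} := loc \o iota.
Let theta mu := j (sd_theta sd mu).

Notation Sh := (shapovalov iota loc).
Notation Fh := (calF iota loc).
Notation ph := (phi iota loc).

Lemma den_unit mu c : mu != 0 -> cset mu c -> j (ud_den D mu c) \is a GRing.unit.
Proof. by move=> mu0 hc; have [h _ _] := Ah_P; apply: h; exists mu, c. Qed.

Lemma phi_den_unit mu : mu != 0 -> j (ud_phi_den D mu) \is a GRing.unit.
Proof.
move=> mu0; rewrite sd_denE // rmorphN unitrN; apply: den_unit => //.
exact: cset_P.1.
Qed.

Lemma phiE mu : ph mu = j (ud_phi_num D mu) * (j (ud_phi_den D mu))^-1.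
Proof. by []. Qed.

Lemma theta_phi mu : mu != 0 -> theta mu * ph mu = 1.
Proof.
move=> mu0; have E : theta mu * j (ud_phi_num D mu) = j (ud_phi_den D mu).
  by rewrite -rmorphM sd_theta_num.
by rewrite phiE mulrA E mulrV ?phi_den_unit.
Qed.

(** Both orders are needed: phi theta = 1 turns the definition of S into its recursion, theta phi =
    1 solves the recursion for T. *)
Lemma phi_theta mu : mu != 0 -> ph mu * theta mu = 1.
Proof.
move=> mu0; have u := phi_den_unit mu0.
have E : GRing.comm (theta mu) (j (ud_phi_den D mu)).
  by rewrite /GRing.comm -!rmorphM sd_theta_den.
have E' : j (ud_phi_num D mu) * theta mu = j (ud_phi_den D mu).
  by rewrite -rmorphM sd_num_theta.
by rewrite phiE -mulrA -(commrV E) mulrA E' mulrV.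
Qed.

Lemma phi_weight0 mu : has_weight (sd_a sd) (sd_b sd) j 0 (ph mu).
Proof.
move=> l; rewrite /affine_t sd_a0 sd_b0 scale1r scale0r addr0 phiE.
have En : j (ud_t D l) * j (ud_phi_num D mu) = j (ud_phi_num D mu) * j (ud_t D l).
  by rewrite -!rmorphM sd_t_num.
have Ed : GRing.comm (j (ud_t D l)) (j (ud_phi_den D mu)).
  by rewrite /GRing.comm -!rmorphM sd_t_den.
by rewrite mulrA En -!mulrA (commrV Ed).
Qed.

(** Moving e_alpha across the fraction shifts the denominator by the weight of e_alpha, and the
    stability of [cset] under weights of A keeps the shifted denominator invertible. *)
Lemma phi_e i mu : mu != 0 -> lmul_of (j (ud_e D i)) (j (ud_e D i) * ph mu).
Proof.
(* Stability of [cset] is granted only for weights of nonzero vectors of A. *)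
move=> mu0; have [e0|e0] := eqVneq (iota (ud_e D i)) 0.
  by exists 0; rewrite /j /= e0 rmorph0 !mul0r.
pose w := ud_wroot D (cone_lattice (simple_root i)).
have ew : weight_vector iota w (iota (ud_e D i)).
  move=> l; rewrite /ad; transitivity (iota (w l *: ud_e D i)); last by rewrite linearZ.
  rewrite -(sd_e_weight sd) /tlift /tsum rmorph_sum; apply: eq_bigr => p _.
  by rewrite !rmorphM.
pose c' := ud_wop D (ud_eta D mu) (weight_pairing D w mu).
have u' : j (ud_den D mu c') \is a GRing.unit.
  apply: den_unit => //; apply: (cset_P.2 w (iota (ud_e D i)) e0 ew mu _).1.
  exact: cset_P.1.
have u := phi_den_unit mu0; rewrite (sd_denE sd) rmorphN in u.
have [x E] := sd_e_num sd i mu.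
have Ee : j (ud_e D i) * j (ud_phi_num D mu) = j x * j (ud_e D i).
  by rewrite -!rmorphM E.
have Ed : j (ud_e D i) * j (ud_den D mu (ud_eta D mu)) =
    j (ud_den D mu c') * j (ud_e D i) by rewrite -!rmorphM (sd_e_den sd).
(* From e num = x e and e den = den' e; the sign comes from [sd_denE]. *)
exists (- (j x * (j (ud_den D mu c'))^-1)).
rewrite phiE (sd_denE sd) rmorphN mulrA Ee; apply: (mulIr u).
by rewrite -!mulrA mulVr // mulr1 mulNr mulrN mulrN opprK -!mulrA Ed mulKr.
Qed.

Lemma calFE mu : Fh mu = tmap (idfun : Up -> Up) (j \o (val : Um -> D)) (ud_calF D mu).
Proof. by []. Qed.

Lemma calF0 : Fh 0 = 0.
Proof. by rewrite calFE (sd_calF0 sd) (tmap0 idfun (j \o val)). Qed.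

Lemma shapovalov_nS n mu : mu != 0 ->
  shapovalov_n iota loc n.+1 mu = conv Fh (shapovalov_n iota loc n) mu * tpure 1 (ph mu).
Proof.
move=> mu0 /=; rewrite (negPf mu0); congr (_ * _).
rewrite /conv /below big_map big_enum_cond /=.
apply: eq_big => [f|f _]; first by rewrite unfold_in /= ?andbT.
by congr (_ * shapovalov_n _ _ _ _); apply/ffunP => i; rewrite !ffunE.
Qed.

(** Each factor F raises the height by at least one. *)
Lemma shapovalov_n_gt_height n mu : (height mu < n)%N -> shapovalov_n iota loc n mu = 0.
Proof.
elim: n mu => // n IH mu; rewrite ltnS => hn.
have [->|mu0] := eqVneq mu 0; first by rewrite /= eqxx.
rewrite shapovalov_nS // /conv big1_seq ?mul0r // => nu /andP[_].
rewrite mem_below => hnu; have [->|nu0] := eqVneq nu 0; first by rewrite calF0 mul0r.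
rewrite IH ?mulr0 //; apply: leq_trans hn.
by rewrite -(height_sub hnu) -ltn_subLR ?subnn // lt0n height_eq0.
Qed.

Lemma shapovalov0 : Sh 0 = 1.
Proof.
rewrite /shapovalov; have -> : height (0 : cone r) = 0%N by apply/eqP; rewrite height_eq0.
by rewrite big_ord1 /= eqxx.
Qed.

Lemma shapovalov_rec mu : mu != 0 -> Sh mu = conv Fh Sh mu * tpure 1 (ph mu).
Proof.
move=> mu0; rewrite {1}/shapovalov big_ord_recl.
have -> : shapovalov_n iota loc (ord0 : 'I_(height mu).+1) mu = 0.
  by rewrite /= (negPf mu0).
rewrite add0r; under eq_bigr => n _ do rewrite lift0 shapovalov_nS //.
rewrite -mulr_suml; congr (_ * _); rewrite /conv exchange_big /=.
apply: eq_big_seq => nu; rewrite mem_below => hnu; rewrite -mulr_sumr.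
have [->|nu0] := eqVneq nu 0; first by rewrite calF0 !mul0r.
congr (_ * _); rewrite /shapovalov.
have hlt : (height (cone_sub mu nu) < height mu)%N.
  by rewrite -(height_sub hnu) -ltn_subLR ?subnn // lt0n height_eq0.
(* Here n runs below the height of mu, in the definition of S_(mu - nu) up to the height of mu - nu;
   the surplus terms vanish. *)
rewrite -(big_mkord xpredT (fun n => shapovalov_n iota loc n (cone_sub mu nu))).
rewrite (big_cat_nat (n := (height (cone_sub mu nu)).+1)) //= big_mkord.
rewrite big_nat_cond [X in _ + X]big1 ?addr0 // => n /andP[/andP[h _] _].
exact: shapovalov_n_gt_height.
Qed.

(** [sd_aD] and [sd_bD] are the composition law of the substitutions t |-> a t + b. *)
Lemma has_weightM (C : algType K) (jj : {lrmorphism D -> C}) lambda mu x y :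
  has_weight (sd_a sd) (sd_b sd) jj lambda x ->
  has_weight (sd_a sd) (sd_b sd) jj mu y ->
  has_weight (sd_a sd) (sd_b sd) jj (lambda + mu) (x * y).
Proof.
move=> hx hy l; have aE nu : jj (affine_t (sd_a sd) (sd_b sd) l nu) =
    sd_a sd l nu *: jj (ud_t D l) + (sd_b sd l nu)%:A.
  by rewrite /affine_t linearD !linearZ rmorph1.
rewrite mulrA hx -!mulrA; congr (_ * _).
rewrite aE mulrDl -scalerAl hy !aE sd_aD sd_bD !mulrDr -!scalerAl -!scalerAr.
rewrite mul1r mulr1 scalerDr !scalerA scalerDl.
by rewrite addrA.
Qed.

Lemma has_weight1 (C : algType K) (jj : {lrmorphism D -> C}) :
  has_weight (sd_a sd) (sd_b sd) jj 0 1.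
Proof.
by move=> l; rewrite mulr1 mul1r /affine_t sd_a0 sd_b0 scale1r scale0r addr0.
Qed.

Lemma cone_latticeD (mu nu : cone r) :
  cone_lattice (mu + nu) = cone_lattice mu + cone_lattice nu.
Proof. by apply/ffunP => l; rewrite !ffunE. Qed.

Lemma cone_lattice0 : cone_lattice (0 : cone r) = 0.
Proof. by apply/ffunP => l; rewrite !ffunE. Qed.

Lemma shapovalov_weight mu :
  in_tens (fun u : Up => has_weight (sd_a sd) (sd_b sd) id (cone_lattice mu) (val u))
          (has_weight (sd_a sd) (sd_b sd) j (- cone_lattice mu)) (Sh mu).
Proof.
have [n] := ubnP (height mu); elim: n mu => // n IH mu; rewrite ltnS => hn.
have [->|mu0] := eqVneq mu 0.
  rewrite shapovalov0; apply: in_tens_pure; rewrite cone_lattice0 ?oppr0.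
    by rewrite rmorph1; exact: (has_weight1 idfun).
  exact: has_weight1.
rewrite shapovalov_rec //.
apply: (in_tensM
  (P := fun u : Up => has_weight (sd_a sd) (sd_b sd) id (cone_lattice mu) (val u))
  (P' := fun u => u = 1) (Q := has_weight (sd_a sd) (sd_b sd) j (- cone_lattice mu))
  (Q' := has_weight (sd_a sd) (sd_b sd) j 0)) => [u _ hu ->|b b' hb hb'||].
- by rewrite mulr1.
- by rewrite -[- _]addr0; apply: has_weightM.
- apply: in_tens_big_seq => nu; rewrite mem_below => hnu.
  have [->|nu0] := eqVneq nu 0; first by rewrite calF0 mul0r; exact: in_tens0.
  have E := cone_subK hnu.
  have hF : in_tens
      (fun u : Up => has_weight (sd_a sd) (sd_b sd) id (cone_lattice nu) (val u))
      (has_weight (sd_a sd) (sd_b sd) j (- cone_lattice nu)) (Fh nu).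
    rewrite calFE; apply: (in_tens_tmap (f := idfun) (g :=
        j \o val) _ _ (sd_calF_weight sd nu)) => // v hv l.
    by have := congr1 j (hv l); rewrite !rmorphM.
  apply: in_tensM hF (IH _ _) => [u u' hu hu'|b b' hb hb'|].
  + rewrite rmorphM -E cone_latticeD addrC.
    exact: (has_weightM (jj := idfun)).
  + by rewrite -E cone_latticeD addrC opprD; exact: has_weightM.
  + apply: leq_trans hn; rewrite -(height_sub hnu) -ltn_subLR ?subnn //.
    by rewrite lt0n height_eq0.
- by apply: in_tens_pure => //; exact: phi_weight0.
Qed.

Definition shapovalov_D mu : tens D Ah := tmap (val : Up -> D) (idfun : Ah -> Ah) (Sh mu).
Definition calF_D mu : tens D Ah := tmap (val : Up -> D) (idfun : Ah -> Ah) (Fh mu).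

Lemma calF_DE mu :
  calF_D mu = tmap (idfun : D -> D) j (tmap (val : Up -> D) (val : Um ->
      D) (ud_calF D mu)).
Proof.
rewrite /calF_D calFE; elim/tens_ind: (ud_calF D mu) => [a b||x y IHx IHy].
- by rewrite (tmap_pure idfun (j \o val)) (tmap_pure val idfun) (tmap_pure val val)
    (tmap_pure idfun j).
- by rewrite (tmap0 idfun (j \o val)) (tmap0 val idfun) (tmap0 val val) (tmap0 idfun j).
- rewrite (tmapD idfun (j \o val)) (tmapD val idfun) (tmapD val val) (tmapD idfun j).
  by rewrite IHx IHy.
Qed.

(** The characteristic property of the left Shapovalov matrix, one weight at a time, with first leg
    in U and second leg in the localized A. *)
Lemma singular_shapovalov i mu :
  in_tens (fun=> True) (lmul_of (j (ud_e D i)))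
    (coprod_mul shapovalov_D i (ud_e D i) (j (ud_e D i)) (j (sd_k sd i)) mu).
Proof.
apply: (@coprod_mul_lideal _ _ _ _ calF_D shapovalov_D i (ud_e D i) (j (ud_e D i))
  (j (sd_k sd i)) (j (sd_k' sd i)) (j (sd_h sd i)) theta ph).
- by rewrite /calF_D calF0 (tmap0 val idfun).
- by rewrite /shapovalov_D shapovalov0 (tmap1 (f := val) (g :=
    idfun) (rmorph1 _) (rmorph1 _)).
- move=> la; have -> : conv calF_D shapovalov_D la =
    tmap (val : Up -> D) (idfun : Ah -> Ah) (conv Fh Sh la).
    by rewrite (tmap_sum val idfun); apply: eq_bigr => nu _;
      rewrite (tmapM (f := val) (g := idfun) (rmorphM _) (rmorphM _)).
  (* In weight 0 both sides vanish, the left one by F_0 = 0 and the right one by theta_0 = 0. *)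
  have [->|la0] := eqVneq la 0.
    rewrite /theta sd_theta0 rmorph0 tpure0r mulr0 /conv big1_seq ?(tmap0 val idfun) //.
    move=> nu; rewrite mem_below => /cone_leP h.
    have -> : nu = 0.
      by apply/ffunP => l; have := h l; rewrite ffunE leqn0 => /eqP.
    by rewrite calF0 mul0r.
  rewrite /shapovalov_D shapovalov_rec // (tmapM (f := val) (g :=
      idfun) (rmorphM _) (rmorphM _)) -mulrA.
  rewrite (tmap_pure val idfun) rmorph1 tpureM mulr1 phi_theta //.
  by rewrite -[tpure 1 1]/(1 : tens D Ah) mulr1.
- move=> la; have := congr1 (tmap (idfun : D -> D) j) (sd_calF_comm sd i la).
  have sh (G : cone r -> tens D D) :
      tmap (idfun : D -> D) j (shift i G la) =
          shift i (fun nu => tmap (idfun : D -> D) j (G nu)) la.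
    by rewrite /shift; case: ifP => // _; rewrite (tmap0 idfun j).
  rewrite !(tmapD idfun j) (tmapN idfun j) !(tmapM (f := idfun) (g :=
      j) (rmorphM _) (rmorphM _)) !(tmap_pure idfun j) !sh.
  rewrite -!calF_DE rmorph1.
  have -> : shift i (fun nu =>
      tmap (idfun : D -> D) j (tmap (val : Up -> D) (val : Um -> D) (ud_calF D nu))) la =
            shift i calF_D la by rewrite /shift; case: ifP => // _; rewrite calF_DE.
  move=> ->; congr (_ - _); rewrite /shift; case: ifP => // _; case: ifP => _.
    by rewrite (tmap_pure idfun j).
  by rewrite (tmap0 idfun j).
- move=> la; have [s hs E] : in_tens (fun=> True)
      (has_weight (sd_a sd) (sd_b sd) j (- cone_lattice la)) (shapovalov_D la).
    by apply: (in_tens_tmap (f := val) (g := idfun) _ _ (shapovalov_weight la)).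
  rewrite E !mulr_sumr !mulr_suml -sumrB; apply: eq_big_seq => p /hs[_ hp].
  rewrite !tpureM !mul1r !mulr1 -tpureBr; congr (tpure _ _).
  exact: sd_theta_shift.
- exact: theta_phi.
- exact: phi_e.
Qed.

End ShapovalovMatrix.

(** * Singular vectors *)

(** A sum over a whole type defaults to 0 when its support is infinite, so each such sum is
    evaluated through an explicit finite list carrying the support. *)
Definition supported (T : nmodType) (I : choiceType) (s : seq I) (f : I -> T) : Prop :=
  uniq s /\ forall i, i \notin s -> f i = 0.

Lemma fsum_supported (T : nmodType) (I : choiceType) (s : seq I) (f : I -> T) :
  supported s f -> \sum_(i \in [set: I]) f i = \sum_(i <- s) f i.
Proof.
case=> us fs; rewrite (fsbigE s) //; last by move=> i _; exact: fs.
by apply: eq_bigl => i; rewrite in_setT.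
Qed.

Lemma finite_supported (T : nmodType) (I : choiceType) (f : I -> T) :
  finite_set [set i | f i != 0]%classic -> exists s, supported s f.
Proof.
move=> /finite_seqP[s E]; exists (undup s); split=> [|i]; first exact: undup_uniq.
rewrite mem_undup => /negP h; apply/eqP/negPn/negP => fi; apply: h.
by have : [set` s]%classic i by rewrite -E.
Qed.

Lemma supported_sum (T : nmodType) (I : choiceType) (s t : seq I) (f : I -> T) :
  supported s f -> supported t f -> \sum_(i <- s) f i = \sum_(i <- t) f i.
Proof. by move=> hs ht; rewrite -(fsum_supported hs) (fsum_supported ht). Qed.

Lemma in_subalg_mono (K : fieldType) (U : algType K) (G G' : U -> Prop) x :
  (forall u, G u -> G' u) -> in_subalg G x -> in_subalg G' x.
Proof.
move=> GG'; elim=> [u /GG' h| |c u v _ hu _ hv|u v _ hu _ hv].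
- exact: InSubalgGen.
- exact: InSubalg1.
- exact: InSubalgLin.
- exact: InSubalgM.
Qed.

(** * The adjoint action *)

Section Adjoint.
Variables (K : fieldType) (r : nat) (D : udata K r).
Variables (A : algType K) (iota : {lrmorphism ud_alg D -> A}).
Hypothesis DeltaP : comultiplicative (@ud_Delta _ _ D).
Hypothesis gammaP : antimultiplicative (@ud_gamma _ _ D).

Definition sandwich (a : A) (t : tens D D) : A :=
  tlift (fun u v => iota u * a * iota (ud_gamma v)) t.

Lemma sandwich_bilin a : bilin (fun u v => iota u * a * iota (@ud_gamma _ _ D v)).
Proof.
have [gl _ _] := gammaP.
split=> [u c v v'|v c u u']; first by rewrite gl linearP mulrDr scalerAr.
by rewrite linearP !mulrDl !scalerAl.
Qed.

(** The order of the factors is right because gamma reverses products. *)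
Lemma sandwichM a s t : sandwich a (s * t) = sandwich (sandwich a t) s.
Proof.
have [_ _ gM] := gammaP; have B := sandwich_bilin.
have sD b : {morph sandwich b : x y / x + y} := tliftD (B b).
have s0 b : sandwich b 0 = 0 := tlift0 (B b).
have aD t' : {morph (fun b => sandwich b t') : x y / x + y}.
  move=> b b'; rewrite /sandwich /tlift /tsum -big_split /=; apply: eq_bigr => p _.
  by rewrite mulrDr mulrDl.
have a0 t' : sandwich 0 t' = 0.
  by rewrite /sandwich /tlift /tsum big1 // => p _; rewrite mulr0 mul0r.
elim/tens_ind: s => [u v||s s' IH IH'].
- elim/tens_ind: t => [u' v'||t t' IH IH'].
  + by rewrite tpureM /sandwich !tlift_pure // gM !rmorphM !mulrA.
  + by rewrite mulr0 !s0 a0.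
  + by rewrite mulrDr !sD IH IH' aD.
- by rewrite mul0r !s0.
- by rewrite mulrDl !sD IH IH'.
Qed.

Lemma adM x y a : ad iota (x * y) a = ad iota x (ad iota y a).
Proof. by have [_ _ DM] := DeltaP; rewrite /ad DM -!/(sandwich _ _) sandwichM. Qed.

Lemma ad_linl a : linear (fun x => ad iota x a).
Proof.
have [Dl _ _] := DeltaP => c x y; rewrite /ad Dl.
exact: (tlift_linear (sandwich_bilin a)).
Qed.

Lemma ad_linr x : linear (ad iota x).
Proof.
move=> c a b; rewrite /ad /tlift /tsum scaler_sumr -big_split /=.
by apply: eq_bigr => p _; rewrite mulrDr mulrDl -scalerAr -scalerAl.
Qed.

End Adjoint.

Section SingularVectors.
Variables (K : fieldType) (r : nat) (D : udata K r) (sd : shapovalov_data D).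
Variables (A : algType K) (iota : {lrmorphism ud_alg D -> A}).
Variable cset : cone r -> K -> Prop.
Hypothesis cset_P : denominator_range iota cset.
Variables (Ah : unitAlgType K) (loc : {lrmorphism A -> Ah}).
Hypothesis Ah_P : fraction_ring iota loc cset.

Notation Up := (subalg (ud_gen_p D)).
Notation Bp := (subalg (fun x : D => ud_gen_p D x \/ ud_gen_0 D x)).

Variables (X : lmodType K) (inc : {linear X -> A}) (pi : Up -> X -> X).
Hypothesis X_sub : ad_submodule iota inc pi.
Variables (I : choiceType) (psi : I -> X) (y : I -> {linear X -> K^o}).
Hypothesis X_bases : dual_bases psi y.
Variable wt : I -> 'I_r -> K.
Hypothesis X_graded : graded pi psi wt.
Hypothesis S_finite : forall i,
  finite_set [set k | S_entry iota loc pi psi y k i != 0]%classic.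

Let j : {lrmorphism D -> Ah} := loc \o iota.
Notation Sh := (shapovalov iota loc).
Notation ad := (ad iota).

(** Read off from the linearity of [ad] through the injection [inc]. *)
Lemma pi_bilin : bilin pi.
Proof.
have [inc_inj piE] := X_sub.
split=> [u c x x'|x c u u']; apply: inc_inj; rewrite linearP !piE.
  by rewrite linearP (ad_linr iota).
by rewrite linearP (ad_linl iota (sd_DeltaP sd) (sd_gammaP sd)).
Qed.

(** With y (x) a viewed as the map x |-> y(x) a, the invariant tensor is the inclusion of X. *)
Lemma invariant_tensorE x : invariant_tensor loc inc psi y x = loc (inc x).
Proof.
have [_ /(_ x)[fin {2}->]] := X_bases; have [s hs] := finite_supported fin.
rewrite /invariant_tensor !(@fsum_supported _ _ s); first by rewrite !linear_sum;
  apply: eq_bigr => i _; rewrite !linearZ.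
- by split=> [|i /hs.2 ->]; [exact: hs.1 | rewrite scale0r].
- by split=> [|i /hs.2 ->]; [exact: hs.1 | rewrite scale0r].
Qed.

Lemma psi_neq0 i : psi i != 0.
Proof.
have [/(_ i i) E _] := X_bases; apply/eqP => p0; move: E.
by rewrite p0 linear0 eqxx => /esym/eqP; rewrite oner_eq0.
Qed.

Lemma bilin_pi (Z : lmodType K) (g : X -> Ah -> Z) x :
  bilin g -> bilin (fun (u : Up) b => g (pi u x) b).
Proof.
move=> gB; split=> [u|b c u u']; first exact: gB.1.
by rewrite (bilinDl pi_bilin) (bilinZl pi_bilin) (gB.2 b).
Qed.

(** Coordinate k of S_mu applied to x; for x = psi_i it is the part of weight mu of the entry
    S_ki. *)
Definition act_coef (mu : cone r) x k : Ah :=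
  tlift (fun (u : Up) (b : Ah) => y k (pi u x) *: b) (Sh mu).

Lemma coef_bilin k : bilin (fun (x : X) (b : Ah) => y k x *: b).
Proof.
split=> [x c b b'|b c x x']; first by rewrite scalerDr !scalerA mulrC.
by rewrite linearP scalerDl scalerA.
Qed.

Lemma act_coef_linear mu k c x x' :
  act_coef mu (c *: x + x') k = c *: act_coef mu x k + act_coef mu x' k.
Proof.
rewrite /act_coef /tlift /tsum scaler_sumr -big_split /=; apply: eq_bigr => p _.
by rewrite (bilinDr pi_bilin) (bilinZr pi_bilin) linearP scalerDl scalerA.
Qed.

(** A single S_mu is a finite sum of pure tensors, so it involves finitely many vectors of X, and
    these have a common finite support in the basis. *)
Lemma expand_act mu x (Z : lmodType K) (g : X -> Ah -> Z) : bilin g ->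
  exists2 s, supported s (act_coef mu x) &
    tlift (fun (u : Up) b => g (pi u x) b) (Sh mu) =
        \sum_(k <- s) g (psi k) (act_coef mu x k).
Proof.
move=> gB; have [_ dual] := X_bases.
have [s us hs] : exists2 s, uniq s & forall p, p \in repr (Sh mu) ->
    forall k, k \notin s -> y k (pi p.1 x) = 0.
  elim: (repr (Sh mu)) => [|p t [s us hs]]; first by exists [::].
  have [/finite_supported[s' hs'] _] := dual (pi p.1 x).
  exists (undup (s' ++ s)) => [|p']; first exact: undup_uniq.
  rewrite inE => /predU1P[->|pt] k; rewrite mem_undup mem_cat negb_or => /andP[k1 k2].
    exact: hs'.2.
  exact: hs pt _ k2.
have cE k : act_coef mu x k = \sum_(p <- repr (Sh mu)) y k (pi p.1 x) *: p.2 by [].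
exists s; first split=> // k ks.
  by rewrite cE big1_seq // => p /andP[_ /hs/(_ k ks)->]; rewrite scale0r.
have -> : tlift (fun (u : Up) b => g (pi u x) b) (Sh mu) =
  \sum_(p <- repr (Sh mu)) g (pi p.1 x) p.2 by [].
under [RHS]eq_bigr => k _.
  rewrite cE (big_morph (g (psi k)) (bilinDr gB (psi k)) (bilin0r gB (psi k))).
  under eq_bigr => p _ do rewrite (bilinZr gB) -(bilinZl gB).
  over.
rewrite exchange_big /=; apply: eq_big_seq => p pr.
have [_ {1}->] := dual (pi p.1 x).
rewrite (@fsum_supported _ _ s); last first.
  by split=> // k ks; rewrite (hs p) ?scale0r.
by rewrite (big_morph (g^~ p.2) (fun u v => bilinDl gB u v p.2) (bilin0l gB p.2)).
Qed.

Lemma up_bp (u : Up) : val u \in subalg_pred (fun x : D => ud_gen_p D x \/ ud_gen_0 D x).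
Proof.
apply/asboolP; apply: in_subalg_mono (asboolP _ (valP u)) => v; by left.
Qed.

Lemma t_bp l : ud_t D l \in subalg_pred (fun x : D => ud_gen_p D x \/ ud_gen_0 D x).
Proof. by apply/asboolP/InSubalgGen; right; exact: (sd_t_in sd). Qed.

(** The first leg of S_mu has weight mu, hence sends psi_i into weight wt_i + mu, where coordinate k
    can be nonzero only if psi_k has that weight. *)
Lemma act_coef_wt mu i k : act_coef mu (psi i) k != 0 ->
  forall l, wt k l = ud_wop D (wt i l) (ud_wroot D (cone_lattice mu) l).
Proof.
have [[act [[actB act1 actM] act_pi act_t]] _ _] := X_graded.
have [dual1 dual] := X_bases; have [inc_inj piE] := X_sub.
have [s hs E] := shapovalov_weight sd iota loc mu.
rewrite /act_coef E tlift_sum; last exact: bilin_pi (coef_bilin k).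
move=> nz; have [p ps nzp] : exists2 p, p \in s & y k (pi p.1 (psi i)) != 0.
  apply: contrapT => H; move/eqP: nz; apply; rewrite big1_seq // => p /andP[_ ps].
  rewrite tlift_pure; last exact: bilin_pi (coef_bilin k).
  have [->|h] := eqVneq (y k (pi p.1 (psi i))) 0; first by rewrite scale0r.
  by case: H; exists p.
move=> l; have [hw _] := hs p ps; have {hw} := hw l.
set u := p.1 in nzp *; move=> hw.
pose bu : Bp := Subalg (up_bp u); pose bt : Bp := Subalg (t_bp l).
(* The torus acts on X only through B^+, so the rule t u = u (a t + b) is restated in that
   subalgebra. *)
pose bw : Bp := sd_a sd l (cone_lattice mu) *: bt + (sd_b sd l (cone_lattice mu))%:A.
have com : bt * bu = bu * bw.
  by apply: val_inj; rewrite !rmorphM; move: hw => /= ->.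
have act_bt : act bt (psi i) = wt i l *: psi i by apply: act_t.
set z := pi u (psi i).
have zE : act bu (psi i) = z by rewrite (act_pi u bu).
have Ez : act bt z = ud_wop D (wt i l) (ud_wroot D (cone_lattice mu) l) *: z.
  rewrite -zE -actM com actM (bilinDl actB) !(bilinZl actB) act1 act_bt.
  by rewrite scalerA -scalerDl (bilinZr actB) -(sd_wopE sd).
(* The second computation of the same coordinate: t is diagonal in the basis psi. *)
have Ek : y k (act bt z) = wt k l * y k z.
  have [fin zs] := dual z; have [s' hs'] := finite_supported fin.
  rewrite {1}zs (@fsum_supported _ _ s'); last first.
    by split=> [|k' /hs'.2 ->]; [exact: hs'.1 | rewrite scale0r].
  rewrite (big_morph (act bt) (bilinDr actB bt) (bilin0r actB bt)) linear_sum.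
  transitivity (\sum_(k' <- s') if k' == k then wt k l * y k z else 0).
    apply: eq_bigr => k' _; rewrite (bilinZr actB) (act_t _ l) // !linearZ /= dual1
        eq_sym.
    by case: eqP => [->|_]; rewrite ?scaler0 // scalerA /GRing.scale /= mulr1 mulrC.
  have [ks|ks] := boolP (k \in s').
    rewrite (bigD1_seq k) ?hs'.1 //= eqxx big1 ?addr0 // => k' /negPf->; exact: erefl.
  rewrite big1_seq => [|k' /andP[_ ks']]; first by rewrite hs'.2 ?mulr0.
  by case: eqP => // kk; rewrite kk (negPf ks) in ks'.
move: Ek; rewrite Ez linearZ /= /GRing.scale /= => /(mulIf nzp) -> //.
Qed.

(** Both weights equal the difference of the weights of psi_k and psi_i; [sd_wop_inj] cancels the
    weight of psi_i, and the torus separates the weights of the cone. *)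
Lemma act_coef_uniq mu nu i k :
  act_coef mu (psi i) k != 0 -> act_coef nu (psi i) k != 0 -> mu = nu.
Proof.
have [[act [act_rep act_pi act_t]] _ _] := X_graded.
move=> /act_coef_wt h1 /act_coef_wt h2; apply: (sd_wroot_inj sd) => l.
apply: (sd_wop_inj sd act_rep (psi_neq0 i) (l := l) (w := wt i l)) => [b hb|].
  exact: act_t.
by rewrite -h1 h2.
Qed.

(** The sum over the cone that defines S_ki has at most one nonzero term. *)
Lemma S_entryE mu i k :
  act_coef mu (psi i) k != 0 -> S_entry iota loc pi psi y k i = act_coef mu (psi i) k.
Proof.
move=> nz; rewrite /S_entry (@fsum_supported _ _ [:: mu]) ?big_seq1 //.
split=> // nu; rewrite inE => ne; apply/eqP/negPn/negP => nz'.
by move/eqP: ne; apply; exact: act_coef_uniq nz' nz.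
Qed.

(** Column i of S_X has finitely many nonzero entries, and each of them accounts for a single mu. *)
Lemma act_coef_psi_finite i : exists2 s, uniq s & forall mu, mu \notin s ->
  forall k, act_coef mu (psi i) k = 0.
Proof.
have [t [_ ht]] := finite_supported (S_finite i).
suff [s hs] : exists s : seq (cone r), forall k, k \in t ->
    forall mu, act_coef mu (psi i) k != 0 -> mu \in s.
  exists (undup s) => [|mu]; first exact: undup_uniq.
  rewrite mem_undup => mus k; apply/eqP/negPn/negP => nz; move/negP: mus; apply.
  apply: (hs k) => //; apply/negPn/negP => kt.
  by have := nz; rewrite -(S_entryE nz) ht ?eqxx.
elim: (t) => [|k t' [s hs]]; first by exists [::].
have [[mu0 h0]|h] := EM (exists mu, act_coef mu (psi i) k != 0).
  exists (mu0 :: s) => k'; rewrite inE => /predU1P[->|k't] mu nz; rewrite inE.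
    by rewrite (act_coef_uniq nz h0) eqxx.
  by rewrite (hs k') ?orbT.
exists s => k'; rewrite inE => /predU1P[->|k't] mu nz; last exact: (hs k').
by case: h; exists mu.
Qed.

Lemma act_coef_finite x : exists2 s, uniq s & forall mu, mu \notin s ->
  forall k, act_coef mu x k = 0.
Proof.
have [_ /(_ x)[fin ->]] := X_bases; have [t ht] := finite_supported fin.
rewrite (@fsum_supported _ _ t); last first.
  by split=> [|i /ht.2 ->]; [exact: ht.1 | rewrite scale0r].
elim: t {ht} => [|i t [s us hs]].
  exists [::] => // mu _ k; rewrite big_nil.
  by have := act_coef_linear mu k (-1) 0 0; rewrite scaler0 addr0 scaleN1r addNr.
have [s' us' hs'] := act_coef_psi_finite i.
exists (undup (s' ++ s)) => [|mu]; first exact: undup_uniq.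
rewrite mem_undup mem_cat negb_or => /andP[k1 k2] k.
by rewrite big_cons act_coef_linear hs' // hs // scaler0 addr0.
Qed.

(** Since [ad] is defined on all of U, this evaluates tensors whose first leg is in U, where the
    ideal membership of T is established. *)
Definition ad_eval x (t : tens D Ah) : Ah := tlift (fun u b => loc (ad u (inc x)) * b) t.

Lemma ad_eval_bilin x : bilin (fun (u : D) b => loc (ad u (inc x)) * b).
Proof.
split=> [u c b b'|b c u u']; first by rewrite mulrDr scalerAr.
by rewrite (ad_linl iota (sd_DeltaP sd) (sd_gammaP sd)) linearP mulrDl scalerAl.
Qed.

Lemma inc_bilin : bilin (fun (x : X) (b : Ah) => loc (inc x) * b).
Proof.
split=> [x c b b'|b c x x']; first by rewrite mulrDr scalerAr.
by rewrite !linearP mulrDl scalerAl.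
Qed.

Lemma ad_eval_shapovalov x mu :
  ad_eval x (shapovalov_D iota loc mu) =
      tlift (fun (u : Up) b => loc (inc (pi u x)) * b) (Sh mu).
Proof.
have [_ piE] := X_sub; have [s _ E] := in_tensT (Sh mu).
have gB := bilin_pi x inc_bilin.
rewrite /shapovalov_D E (tmap_sum val idfun) /ad_eval !tlift_sum //;
  last exact: ad_eval_bilin.
apply: eq_bigr => p _; rewrite (tmap_pure val idfun) !tlift_pure //;
  last exact: ad_eval_bilin.
by rewrite piE.
Qed.

(** If all coordinates vanish, S_mu kills x already in X (x) Ah, before u0 (x) b0 is applied. This
    makes both summands of Delta (e_alpha) S finitely supported on x. *)
Lemma ad_eval_mull_eq0 x mu u0 b0 : (forall k, act_coef mu x k = 0) ->
  ad_eval x (tpure u0 b0 * shapovalov_D iota loc mu) = 0.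
Proof.
move=> h; have [_ piE] := X_sub.
pose g (z : X) (b : Ah) := loc (ad u0 (inc z)) * (b0 * b).
have gB : bilin g.
  split=> [z c b b'|b c z z']; rewrite /g; first by rewrite !mulrDr !scalerAr.
  by rewrite linearP (ad_linr iota) linearP mulrDl scalerAl.
have [s _ E] := expand_act mu x gB.
transitivity (tlift (fun (u : Up) b => g (pi u x) b) (Sh mu)); last first.
  by rewrite E big1 // => k _; rewrite h (bilin0r gB).
have [t _ E'] := in_tensT (Sh mu).
have gB' := bilin_pi x gB.
rewrite /shapovalov_D E' (tmap_sum val idfun) mulr_sumr /ad_eval !tlift_sum //;
  last exact: ad_eval_bilin.
apply: eq_bigr => p _; rewrite (tmap_pure val idfun) tpureM !tlift_pure //;
  last exact: ad_eval_bilin.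
by rewrite /g piE adM //; [exact: (sd_DeltaP sd) | exact: (sd_gammaP sd)].
Qed.

(* [e a = ad e (a) k + a e] for [e] a simple root vector *)
Lemma mul_ad_eval i x t : j (ud_e D i) * ad_eval x t =
  ad_eval x (tpure (ud_e D i) (j (sd_k sd i)) * t) + ad_eval x (tpure 1 (j (ud_e D i))
      * t).
Proof.
have ad_e a : ad (ud_e D i) a * iota (sd_k sd i) =
    iota (ud_e D i) * a - a * iota (ud_e D i).
  have sB := sandwich_bilin iota (sd_gammaP sd) a.
  rewrite /ad (sd_Delta_e sd) tliftD // !tlift_pure // rmorph1 mul1r mulrDl -!mulrA.
  by rewrite -!rmorphM sd_gamma_k sd_gamma_e rmorph1 mulr1 rmorphN mulrN.
have B := ad_eval_bilin x; elim/tens_ind: t => [u b||t t' IH IH'].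
- rewrite !tpureM mul1r /ad_eval !tlift_pure //.
  rewrite (adM iota (sd_DeltaP sd) (sd_gammaP sd)).
  rewrite [loc _ * (j (sd_k sd i) * _)]mulrA [loc _ * (j (ud_e D i) * _)]mulrA.
  rewrite -[j (sd_k sd i)]/(loc (iota _)) -[j (ud_e D i)]/(loc (iota _)).
  by rewrite -!rmorphM ad_e rmorphB mulrBl subrK mulrA -rmorphM.
- by rewrite !mulr0 /ad_eval !tlift0 // mulr0 addr0.
- by rewrite !mulrDr /ad_eval !tliftD // mulrDr -!/(ad_eval x _) IH IH' addrACA.
Qed.

Lemma dual_tens_actE x s : uniq s ->
  (forall mu, mu \notin s -> forall k, act_coef mu x k = 0) ->
  dual_tens_act pi (invariant_tensor loc inc psi y) Sh x =
  \sum_(mu <- s) ad_eval x (shapovalov_D iota loc mu).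
Proof.
move=> us hs.
have E mu : tlift (fun (u : Up) (b : Ah) =>
      invariant_tensor loc inc psi y (pi u x) * b) (Sh mu) =
    ad_eval x (shapovalov_D iota loc mu).
  rewrite ad_eval_shapovalov; congr (tlift _ _).
  by apply/funext => u; apply/funext => b; rewrite invariant_tensorE.
rewrite /dual_tens_act (@fsum_supported _ _ s); first by apply: eq_bigr => mu _.
split=> // mu /hs h.
by rewrite E -[shapovalov_D _ _ _]mul1r ad_eval_mull_eq0.
Qed.

Lemma ad_eval_linear c x x' t : ad_eval (c *: x + x') t = c *: ad_eval x t + ad_eval x' t.
Proof.
rewrite /ad_eval /tlift /tsum scaler_sumr -big_split /=; apply: eq_bigr => p _.
by rewrite !linearP (ad_linr iota) linearP mulrDl scalerAl.
Qed.

Lemma dual_tens_act_linear c x x' :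
  dual_tens_act pi (invariant_tensor loc inc psi y) Sh (c *: x + x') =
  c *: dual_tens_act pi (invariant_tensor loc inc psi y) Sh x +
  dual_tens_act pi (invariant_tensor loc inc psi y) Sh x'.
Proof.
have [s us hs] := act_coef_finite x; have [s' us' hs'] := act_coef_finite x'.
pose t := undup (s ++ s'); have ut : uniq t := undup_uniq _.
have ht mu : mu \notin t -> mu \notin s /\ mu \notin s'.
  by rewrite mem_undup mem_cat negb_or => /andP.
rewrite !(@dual_tens_actE _ t) //.
- by rewrite scaler_sumr -big_split; apply: eq_bigr => mu _; rewrite ad_eval_linear.
- by move=> mu /ht[_ /hs'].
- by move=> mu /ht[/hs].
- by move=> mu /ht[/hs h /hs' h'] k; rewrite act_coef_linear h h' scaler0 addr0.
Qed.

Lemma dual_tens_act_psi i :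
  dual_tens_act pi (invariant_tensor loc inc psi y) Sh (psi i) =
  \sum_(k \in [set: I]%classic) loc (inc (psi k)) * S_entry iota loc pi psi y k i.
Proof.
have [s us hs] := act_coef_psi_finite i; have [t ht] := finite_supported (S_finite i).
rewrite (dual_tens_actE us hs) (@fsum_supported _ _ t); last first.
  by split=> [|k /ht.2 ->]; [exact: ht.1 | rewrite mulr0].
have SE k : S_entry iota loc pi psi y k i = \sum_(mu <- s) act_coef mu (psi i) k.
  rewrite /S_entry (@fsum_supported _ _ s) //; split=> // mu /hs; exact.
under [RHS]eq_bigr => k _ do rewrite SE mulr_sumr.
rewrite exchange_big /=; apply: eq_bigr => mu _; rewrite ad_eval_shapovalov.
have [t' ht' ->] := expand_act mu (psi i) inc_bilin.
apply: supported_sum.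
  by split=> [|k kt]; [exact: ht'.1 | rewrite ht'.2 ?mulr0].
split=> [|k kt]; first exact: ht.1.
(* A nonzero coefficient is the whole entry S_ki, so it cannot lie outside the support of the
   column. *)
have [->|nz] := eqVneq (act_coef mu (psi i) k) 0; first by rewrite mulr0.
by rewrite -(S_entryE nz) ht.2 ?mulr0.
Qed.

Lemma dual_tens_act_dual x :
  dual_tens_act pi (invariant_tensor loc inc psi y) Sh x =
  \sum_(i \in [set: I]%classic) y i x *:
     (\sum_(k \in [set: I]%classic) loc (inc (psi k)) * S_entry iota loc pi psi y k i).
Proof.
have [_ /(_ x)[fin {1}->]] := X_bases; have [t ht] := finite_supported fin.
rewrite !(@fsum_supported _ _ t); try by
  split=> [|i /ht.2 ->]; [exact: ht.1 | rewrite scale0r].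
elim: (t) => [|i t' IH].
  rewrite !big_nil.
  by have := dual_tens_act_linear (-1) 0 0; rewrite scaler0 addr0 scaleN1r addNr.
by rewrite !big_cons dual_tens_act_linear IH dual_tens_act_psi.
Qed.

(** Left multiplication by e_alpha acts as Delta (e_alpha) on S; after regrouping by weight each
    summand is the evaluation of some T_mu, which ends in e_alpha. *)
Lemma e_dual_tens_act i x :
  lmul_of (j (ud_e D i))
    (j (ud_e D i) * dual_tens_act pi (invariant_tensor loc inc psi y) Sh x).
Proof.
have [s us hs] := act_coef_finite x; rewrite (dual_tens_actE us hs) mulr_sumr.
under eq_bigr => mu _ do rewrite mul_ad_eval.
rewrite big_split /=.
set S := shapovalov_D iota loc; set e := ud_e D i; set k := j (sd_k sd i).
pose up (mu : cone r) := mu + simple_root i.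
have up_inj : injective up by exact: can_inj (pred_simpleK i).
(* The summand e (x) k moves weight mu to mu + alpha, so both sums are extended to s together with
   its translate. *)
pose t := undup (s ++ [seq up mu | mu <- s]); have ut : uniq t := undup_uniq _.
have E1 : \sum_(mu <- s) ad_eval x (tpure e k * S mu) =
          \sum_(mu <- t) ad_eval x (tpure e k * shift i S mu).
  transitivity (\sum_(mu <- [seq up mu | mu <- s]) ad_eval x (tpure e k * shift i S mu)).
    by rewrite big_map; apply: eq_bigr => mu _; rewrite shift_add.
  apply: supported_sum; split=> //; first by rewrite map_inj_uniq.
    move=> mu h; rewrite /shift; case: ifP => [hi|_];
      last by rewrite mulr0 /ad_eval (tlift0 (ad_eval_bilin x)).
    apply: ad_eval_mull_eq0; apply: hs; apply: contra h => h.
    by rewrite -(pred_simpleE hi); apply/mapP; exists (pred_simple i mu).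
  move=> mu h; rewrite /shift; case: ifP => [hi|_];
    last by rewrite mulr0 /ad_eval (tlift0 (ad_eval_bilin x)).
  apply: ad_eval_mull_eq0; apply: hs; apply: contra h => h.
  rewrite mem_undup mem_cat -{2}(pred_simpleE hi); apply/orP; right.
  by apply/mapP; exists (pred_simple i mu).
have E2 : \sum_(mu <- s) ad_eval x (tpure 1 (j e) * S mu) =
          \sum_(mu <- t) ad_eval x (tpure 1 (j e) * S mu).
  apply: supported_sum; split=> // mu h; apply: ad_eval_mull_eq0; apply: hs => //.
  by apply: contra h => h; rewrite mem_undup mem_cat h.
rewrite E1 E2 -big_split /=.
apply: (big_ind (lmul_of (j e))) => [|_ _ [a ->] [b ->]|mu _].
- by exists 0; rewrite mul0r.
- by exists (a + b); rewrite mulrDl.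
- have B := ad_eval_bilin x; rewrite /ad_eval -tliftD //.
  have [w hw] := singular_shapovalov sd cset_P Ah_P i mu.
  rewrite -/(coprod_mul S i e (j e) k mu) => ->; rewrite tlift_sum //.
  rewrite big_seq; apply: (big_ind (lmul_of (j e))) => [|_ _ [a ->] [b ->]|p pw].
  + by exists 0; rewrite mul0r.
  + by exists (a + b); rewrite mulrDl.
  + have [_ [c E]] := hw p pw; rewrite tlift_pure // E.
    by exists (loc (ad p.1 (inc x)) * c); rewrite mulrA.
Qed.

Lemma Zvec_singular i x :
  loc (iota (ud_e D i)) *: Zvec iota loc inc pi psi y x = 0.
Proof.
rewrite /Zvec scalerA; have [c] := e_dual_tens_act i x.
rewrite -[j _]/(loc (iota (ud_e D i))) => ->.
rewrite /Vhat1 -[_ *: _]/(lquot_scale _ _) lquot_scale_pi mulr1.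
transitivity (lquot_pi (Jh_gen iota loc) 0); last by rewrite -(subrr 0) lquot_piB subrr.
apply/lquot_piP; rewrite subr0; exists [:: (c, loc (iota (ud_e D i)))].
  by move=> p; rewrite inE => /eqP->; exists i.
by rewrite big_seq1.
Qed.

Lemma Zvec_in_dual_tens :
  (forall x : X, Zvec iota loc inc pi psi y x =
     \sum_(i \in [set: I]%classic)
       (y i x)%:A *:
         ((\sum_(k \in [set: I]%classic)
             loc (inc (psi k)) * S_entry iota loc pi psi y k i) *:
          Vhat1 iota loc)) /\
  in_dual_tens (Vhat_plus iota loc) (Zvec iota loc inc pi psi y).
Proof.
split=> [x|].
  rewrite /Zvec dual_tens_act_dual.
  have [_ /(_ x)[fin _]] := X_bases; have [t ht] := finite_supported fin.
  rewrite !(@fsum_supported _ _ t); first last.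
  - by split=> [|i /ht.2 ->]; [exact: ht.1 | rewrite scale0r].
  - by split=> [|i /ht.2 ->]; [exact: ht.1 | rewrite !scale0r].
  by rewrite scaler_suml; apply: eq_bigr => i _; rewrite scalerA mulr_algl.
split=> [c x x'|x i]; last exact: Zvec_singular.
by rewrite /Zvec dual_tens_act_linear scalerDl scalerA mulr_algl.
Qed.

End SingularVectors.

(** * Root system of a semisimple Lie algebra *)

Section RootSystem.
Variables (K : fieldType) (g : semisimple_lie K).
Hypothesis intr_inj : injective (intr : int -> K).
Notation r := (lie_rank g).
Notation h := (@lie_h K g).
Notation e := (@lie_e K g).
Notation f := (@lie_f K g).
Notation br := (@lie_br K g).
Notation form := (@lie_form K g).
Notation pos := (lie_pos g).
Notation gram := (@gram K g).
Implicit Types (x y z : g) (lambda mu : root_lattice r) (beta : cone r) (i j : 'I_r).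

Lemma brC x y : br x y = - br y x.
Proof.
have B := lie_br_bilin g; have := lie_br_alt (x + y).
rewrite (bilinDl B) !(bilinDr B) !lie_br_alt addr0 add0r => E.
by apply/eqP; rewrite -addr_eq0 E.
Qed.

Lemma brDr x y z : br x (y + z) = br x y + br x z.
Proof. exact: (bilinDr (lie_br_bilin g)). Qed.
Lemma brDl x y z : br (x + y) z = br x z + br y z.
Proof. exact: (bilinDl (lie_br_bilin g)). Qed.
Lemma brZr c x y : br x (c *: y) = c *: br x y.
Proof. exact: (bilinZr (lie_br_bilin g)). Qed.
Lemma brZl c x y : br (c *: x) y = c *: br x y.
Proof. exact: (bilinZl (lie_br_bilin g)). Qed.
Lemma brNr x y : br x (- y) = - br x y.
Proof. by rewrite -scaleN1r brZr scaleN1r. Qed.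
Lemma br_sumr x (J : Type) (s : seq J) (P : pred J) F :
  br x (\sum_(k <- s | P k) F k) = \sum_(k <- s | P k) br x (F k).
Proof. exact: (big_morph (br x) (brDr x) (bilin0r (lie_br_bilin g) x)). Qed.
Lemma br_suml y (J : Type) (s : seq J) (P : pred J) F :
  br (\sum_(k <- s | P k) F k) y = \sum_(k <- s | P k) br (F k) y.
Proof.
exact: (big_morph (br^~ y) (fun u v => brDl u v y) (bilin0l (lie_br_bilin g) y)).
Qed.

Lemma ad_br x y z : br x (br y z) = br (br x y) z + br y (br x z).
Proof.
have J := lie_jacobi x y z; rewrite [br (br x y) z]brC [br x z]brC brNr.
by apply/eqP; rewrite -opprD -addr_eq0 addrA addrAC; apply/eqP.
Qed.

(* The value of the weight [lambda] at [h_i]. *)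
Definition wval lambda i : K := \sum_j (lambda j)%:~R * gram i j.

Lemma wvalD lambda mu i : wval (lambda + mu) i = wval lambda i + wval mu i.
Proof.
by rewrite -big_split /=; apply: eq_bigr => j _; rewrite ffunE rmorphD mulrDl.
Qed.

Lemma wvalN lambda i : wval (- lambda) i = - wval lambda i.
Proof. by rewrite -sumrN; apply: eq_bigr => j _; rewrite ffunE rmorphN mulNr. Qed.

Lemma wval0 i : wval 0 i = 0.
Proof. by rewrite /wval big1 // => j _; rewrite ffunE mul0r. Qed.

Lemma wval_simple i j : wval (cone_lattice (simple_root i)) j = gram j i.
Proof.
rewrite /wval (bigD1 i) //= !ffunE eqxx mul1r big1 ?addr0 // => k /negPf ki.
by rewrite !ffunE ki mul0r.
Qed.

Lemma gram_sym i j : gram i j = gram j i.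
Proof. exact: lie_form_sym. Qed.

Lemma br_h_e i beta : beta \in pos ->
  br (h i) (e beta) = wval (cone_lattice beta) i *: e beta.
Proof.
move=> /lie_cartan_e ->; congr (_ *: _); apply: eq_bigr => j _.
by rewrite ffunE.
Qed.

Lemma br_h_f i beta : beta \in pos ->
  br (h i) (f beta) = wval (- cone_lattice beta) i *: f beta.
Proof.
move=> /lie_cartan_f ->; congr (_ *: _); rewrite wvalN; congr (- _).
by apply: eq_bigr => j _; rewrite ffunE.
Qed.

Lemma span_map_sum (J : eqType) (F : J -> g) (s : seq J) x :
  uniq s -> x \in <<[seq F k | k <- s]>>%VS ->
  exists c, x = \sum_(k <- s) c k *: F k.
Proof.
elim: s x => [|k s IH] x /=.
  by rewrite span_nil memv0 => _ /eqP->; exists (fun=> 0); rewrite big_nil.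
rewrite span_cons => /andP[ks us] /memv_addP[_ /vlineP[c ->] [v vs ->]].
have [c' ->] := IH v us vs.
exists (fun k' => if k' == k then c else c' k'); rewrite big_cons eqxx.
congr (_ + _); apply: eq_big_seq => k' k's; case: eqP => // E.
by rewrite -E k's in ks.
Qed.

Lemma free_map_sum (J : eqType) (F : J -> g) (s : seq J) (c : J -> K) :
  free [seq F k | k <- s] -> \sum_(k <- s) c k *: F k = 0 ->
  forall k, k \in s -> c k = 0.
Proof.
elim: s => [|k s IH] //=; rewrite free_cons big_cons => /andP[ks fs] E.
have mem : \sum_(k' <- s) c k' *: F k' \in <<[seq F k | k <- s]>>%VS.
  rewrite big_seq; apply: memv_suml => k' k's; apply: memvZ.
  by apply: memv_span; apply: map_f.
have c0 : c k = 0.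
  apply: contraNeq ks => ck; have <- : (c k)^-1 *: (c k *: F k) = F k.
    by rewrite scalerA mulVf // scale1r.
  apply: memvZ; move/eqP: E; rewrite addr_eq0 => /eqP ->.
  by rewrite memvN.
move=> k'; rewrite inE => /predU1P[->//|]; apply: IH => //.
by move: E; rewrite c0 scale0r add0r.
Qed.

(** * The root basis and its weights *)

Notation index := ('I_r + (cone r + cone r))%type.

Definition root_index : seq index :=
  [seq inl i | i <- enum 'I_r] ++
  ([seq inr (inl beta) | beta <- pos] ++ [seq inr (inr beta) | beta <- pos]).

Definition root_vector (t : index) : g :=
  match t with inl i => h i | inr (inl beta) => e beta | inr (inr beta) => f beta end.

Definition root_weight (t : index) : root_lattice r :=
  match t with
  | inl i => 0
  | inr (inl beta) => cone_lattice beta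
  | inr (inr beta) => - cone_lattice beta
  end.

Lemma root_basis : basis_of fullv [seq root_vector t | t <- root_index].
Proof.
rewrite /root_index !map_cat; apply: etrans (lie_basis g).
by congr (basis_of _ (_ ++ (_ ++ _))); rewrite -map_comp.
Qed.

Lemma root_index_uniq : uniq root_index.
Proof.
have inl_inj (T T' : Type) : injective (@inl T T') by move=> ? ? [].
have inr_inj (T T' : Type) : injective (@inr T T') by move=> ? ? [].
rewrite !cat_uniq (map_inj_uniq (@inl_inj _ _)) enum_uniq.
rewrite (map_inj_uniq (inj_comp (@inr_inj _ _) (@inl_inj _ _))) lie_pos_uniq.
rewrite (map_inj_uniq (inj_comp (@inr_inj _ _) (@inr_inj _ _))) lie_pos_uniq andbT /=.
apply/andP; split; apply/hasPn => t.
  by rewrite mem_cat => /orP[] /mapP[b _ ->]; apply/negP => /mapP[].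
by case/mapP => b _ ->; apply/negP => /mapP[].
Qed.

Lemma br_h_root i t : t \in root_index ->
  br (h i) (root_vector t) = wval (root_weight t) i *: root_vector t.
Proof.
rewrite !mem_cat => /orP[|/orP[]] /mapP[b bs ->] /=.
- by rewrite lie_h_abelian wval0 scale0r.
- exact: br_h_e.
- exact: br_h_f.
Qed.

Lemma root_sum x : exists k, x = \sum_(t <- root_index) k t *: root_vector t.
Proof.
apply: span_map_sum; first exact: root_index_uniq.
by rewrite (span_basis root_basis) memvf.
Qed.

(** A central vector spans an abelian ideal. *)
Lemma central_eq0 v : (forall t, t \in root_index -> br v (root_vector t) = 0) -> v = 0.
Proof.
move=> hv; have hv' x : br v x = 0.
  have [k ->] := root_sum x; rewrite br_sumr big1_seq // => t /andP[_ /hv ts].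
  by rewrite brZr ts scaler0.
apply/eqP; rewrite -memv0 -(@lie_semisimple _ g <[v]>) ?memv_line //.
  by move=> x _ /vlineP[c ->]; rewrite brZr brC hv' oppr0 scaler0 mem0v.
by move=> _ y /vlineP[c ->] _; rewrite brZl hv' scaler0.
Qed.

(** The combination of the h_i with coefficients c acts by zero on the root basis, so it is central,
    hence zero, and the h_i are independent. *)
Lemma gram_nondeg (c : 'I_r -> K) :
  (forall j, \sum_i c i * gram i j = 0) -> forall i, c i = 0.
Proof.
move=> hc; have wc lambda : \sum_i c i * wval lambda i = 0.
  under eq_bigr => i _ do rewrite mulr_sumr.
  rewrite exchange_big /= big1 // => j _.
  under eq_bigr => i _ do rewrite mulrCA.
  by rewrite -mulr_sumr hc mulr0.
have v0 : \sum_i c i *: h i = 0.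
  apply: central_eq0 => t tI; rewrite br_suml.
  under eq_bigr => i _ do rewrite brZl br_h_root // scalerA.
  by rewrite -scaler_suml wc scale0r.
have [_ fr] := andP root_basis.
pose k (t : index) := match t with inl i => c i | inr _ => 0 end.
have k0 : \sum_(t <- root_index) k t *: root_vector t = 0.
  rewrite /root_index !big_cat !big_map -enumT big_enum /= v0.
  by rewrite !big1 ?addr0 // => b _; rewrite scale0r.
move=> i; apply: (free_map_sum fr k0 (k := inl i)).
by rewrite mem_cat map_f ?mem_enum.
Qed.

Lemma wval_inj lambda mu : wval lambda =1 wval mu -> lambda = mu.
Proof.
move=> E; apply/ffunP => i; apply: intr_inj; apply/eqP; rewrite -subr_eq0; apply/eqP.
apply: (gram_nondeg (c := fun i => (lambda i)%:~R - (mu i)%:~R)) => j.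
have /eqP := E j; rewrite -subr_eq0 -sumrB => /eqP E'.
by rewrite -[RHS]E'; apply: eq_bigr => k _; rewrite gram_sym mulrBl.
Qed.

Definition lie_weight lambda x := forall i, br (h i) x = wval lambda i *: x.

Lemma lie_weight_br lambda mu x y :
  lie_weight lambda x -> lie_weight mu y -> lie_weight (lambda + mu) (br x y).
Proof. by move=> hx hy i; rewrite ad_br hx hy brZl brZr wvalD scalerDl. Qed.

Lemma lie_weight_e beta : beta \in pos -> lie_weight (cone_lattice beta) (e beta).
Proof. by move=> hb i; exact: br_h_e. Qed.
Lemma lie_weight_f beta : beta \in pos -> lie_weight (- cone_lattice beta) (f beta).
Proof. by move=> hb i; exact: br_h_f. Qed.
(** If a basis vector has another weight, some h_i separates the two eigenvalues, and independence
    of the root basis forces its coefficient to vanish. *)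
Lemma lie_weight_sum lambda x : lie_weight lambda x ->
  exists k, x = \sum_(t <- root_index | root_weight t == lambda) k t *: root_vector t.
Proof.
move=> hx; have [k xE] := root_sum x; exists k.
have [_ fr] := andP root_basis.
rewrite [LHS]xE (bigID (fun t =>
    root_weight t == lambda)) /= [X in _ + X]big1_seq ?addr0 //.
move=> t /andP[tl tI].
have [i hi] : exists i, wval (root_weight t) i != wval lambda i.
  apply: contrapT => H; move/eqP: tl; apply; apply: wval_inj => i.
  by apply/eqP/negPn/negP => hi; apply: H; exists i.
have E : \sum_(t <- root_index) (k t * (wval (root_weight t) i - wval lambda i)) *:
    root_vector t = 0.
  have := hx i; rewrite {1}xE br_sumr xE scaler_sumr => /eqP.
  rewrite -subr_eq0 -sumrB => /eqP E'; rewrite -[RHS]E'.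
  apply: eq_big_seq => s sI; rewrite brZr br_h_root // !scalerA -scalerBl mulrBr.
  by rewrite [_ * k s]mulrC.
have /eqP := free_map_sum fr E tI.
by rewrite mulf_eq0 subr_eq0 (negPf hi) orbF => /eqP->; rewrite scale0r.
Qed.

Lemma cone_lattice_inj : injective (@cone_lattice r).
Proof. by move=> a b /ffunP E; apply/ffunP => i; have := E i; rewrite !ffunE => -[]. Qed.

Lemma cone_lattice_opp (a b : cone r) : cone_lattice a = - cone_lattice b -> a = 0.
Proof.
move=> /ffunP E; apply/ffunP => i; have := E i; rewrite !ffunE => H.
by move: H; case: (a i) => // n; case: (b i).
Qed.

Lemma pos_neq0 beta : beta \in pos -> beta != 0.
Proof. by apply: contraTneq => ->; exact: lie_pos_neq0. Qed.

Lemma lie_weight_none lambda x : lie_weight lambda x ->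
  (forall t, t \in root_index -> root_weight t != lambda) -> x = 0.
Proof.
move=> /lie_weight_sum[k ->] H; rewrite big1_seq // => t /andP[/eqP tl tI].
by move: (H t tI); rewrite tl eqxx.
Qed.

Lemma lie_weight_uniq t x : t \in root_index ->
  (forall s, s \in root_index -> root_weight s = root_weight t -> s = t) ->
  lie_weight (root_weight t) x -> exists c, x = c *: root_vector t.
Proof.
move=> tI tu /lie_weight_sum[k ->]; exists (k t).
rewrite big_mkcond (bigD1_seq t) ?root_index_uniq //= eqxx.
rewrite big1_seq ?addr0 // => s /andP[st sI]; case: eqP => // E.
by rewrite (tu s sI E) eqxx in st.
Qed.

Lemma mem_index_e beta : (inr (inl beta) \in root_index) = (beta \in pos).
Proof.
rewrite !mem_cat; apply/or3P/idP => [[] /mapP[b bp] //|bp]; first by case=> ->.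
by apply: Or32; exact: map_f.
Qed.
Lemma mem_index_f beta : (inr (inr beta) \in root_index) = (beta \in pos).
Proof.
rewrite !mem_cat; apply/or3P/idP => [[] /mapP[b bp] //|bp]; first by case=> ->.
by apply: Or33; exact: map_f.
Qed.

(** The weight beta occurs once in the root basis, and pairing with f_beta reads off the
    coefficient. *)
Lemma lie_weight_eE beta x : beta \in pos -> lie_weight (cone_lattice beta) x ->
  x = form x (f beta) *: e beta.
Proof.
move=> bp hx; have [||c ->] := lie_weight_uniq (t := inr (inl beta)) _ _ hx.
- by rewrite mem_index_e.
- move=> [i|[b|b]] /=; rewrite ?mem_index_e ?mem_index_f => sI.
  + by rewrite -cone_lattice0 => /cone_lattice_inj E; have := pos_neq0 bp;
    rewrite -E eqxx.
  + by move/cone_lattice_inj->.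
  + by move/esym/cone_lattice_opp => E; have := pos_neq0 bp; rewrite E eqxx.
- by rewrite (bilinZl (lie_form_bilin g)) lie_dual // /GRing.scale /= mulr1.
Qed.

Lemma lie_weight_fE beta x : beta \in pos -> lie_weight (- cone_lattice beta) x ->
  x = form (e beta) x *: f beta.
Proof.
move=> bp hx; have [||c ->] := lie_weight_uniq (t := inr (inr beta)) _ _ hx.
- by rewrite mem_index_f.
- move=> [i|[b|b]] /=; rewrite ?mem_index_e ?mem_index_f => sI.
  + move/eqP; rewrite -oppr0 eqr_opp -cone_lattice0 => /eqP/cone_lattice_inj E.
    by have := pos_neq0 bp; rewrite -E eqxx.
  + by move/cone_lattice_opp => E; have := pos_neq0 sI; rewrite E eqxx.
  + by move/oppr_inj/cone_lattice_inj->.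
- by rewrite (bilinZr (lie_form_bilin g)) lie_dual // /GRing.scale /= mulr1.
Qed.

(** Vectors of weight 0 lie in the span of the h_i, on which the form is nondegenerate by
    [gram_nondeg]. *)
Lemma lie_weight0_eq0 x : lie_weight 0 x -> (forall j, form x (h j) = 0) -> x = 0.
Proof.
move=> /lie_weight_sum[k xE] xh.
have xE' : x = \sum_i k (inl i) *: h i.
  rewrite xE /root_index !big_cat !big_map -enumT big_enum_cond /= eqxx.
  rewrite [X in _ + (X + _)]big1_seq; last first.
    move=> b /andP[/eqP]; rewrite -cone_lattice0 => /cone_lattice_inj -> H.
    by have := pos_neq0 H; rewrite eqxx.
  rewrite [X in _ + (_ + X)]big1_seq ?addr0 //; last first.
  move=> b /andP[/eqP]; rewrite -oppr0 => /oppr_inj; rewrite -cone_lattice0.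
  by move/cone_lattice_inj => -> H; have := pos_neq0 H; rewrite eqxx.
have k0 := gram_nondeg (c := fun i => k (inl i)).
rewrite xE' big1 // => i _; rewrite k0 ?scale0r // => j.
rewrite -[RHS](xh j) xE'.
rewrite (big_morph (form^~ (h j)) (fun u v =>
    bilinDl (lie_form_bilin g) u v (h j)) (bilin0l (lie_form_bilin g) (h j))).
by apply: eq_bigr => l _; rewrite (bilinZl (lie_form_bilin g)).
Qed.

(** * Brackets with simple root vectors *)

Notation ea i := (e (simple_root i)).
Notation fa i := (f (simple_root i)).

(** The difference of the two sides has weight 0 and, by invariance and duality, is orthogonal to
    every h_j. *)
Lemma br_e_f i : br (ea i) (fa i) = h i.
Proof.
have ps := lie_pos_simple i; have B := lie_form_bilin g.
apply/eqP; rewrite -subr_eq0; apply/eqP; apply: lie_weight0_eq0 => [j|j].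
  rewrite brDr brNr lie_h_abelian oppr0 addr0 wval0 scale0r.
  by rewrite (lie_weight_br (lie_weight_e ps) (lie_weight_f ps)) subrr wval0 scale0r.
rewrite (bilinDl B) -scaleN1r (bilinZl B) lie_form_inv brC (lie_weight_f ps).
rewrite wvalN wval_simple scaleNr opprK (bilinZr B) lie_dual // /GRing.scale /= mulr1.
by rewrite gram_sym mulN1r subrr.
Qed.

Definition br_coef i beta : K :=
  if beta + simple_root i \in pos
  then form (br (ea i) (e beta)) (f (beta + simple_root i)) else 0.

Lemma br_e_e i beta : beta \in pos ->
  br (ea i) (e beta) = br_coef i beta *: e (beta + simple_root i).
Proof.
move=> bp; have ps := lie_pos_simple i.
have := lie_weight_br (lie_weight_e ps) (lie_weight_e bp).
rewrite -cone_latticeD addrC /br_coef => hw; case: ifPn => np.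
  exact: lie_weight_eE.
rewrite scale0r; apply: lie_weight_none hw _ => -[l|[b|b]].
- move=> _; rewrite /= -cone_lattice0; apply/eqP => /cone_lattice_inj/ffunP/(_ i).
  by have := addsimple_gt0 i beta; rewrite cone0E => /[swap] <-.
- rewrite mem_index_e => bI; apply: contra np => /eqP/cone_lattice_inj <-; exact: bI.
- rewrite mem_index_f => bI; apply/eqP => /esym/cone_lattice_opp/ffunP/(_ i).
  by have := addsimple_gt0 i beta; rewrite cone0E => /[swap] ->.
Qed.

Definition has_pred i beta := (0 < beta i)%N && (pred_simple i beta \in pos).

(** A negative root -b is excluded by height: beta + b = alpha_i would split height 1 into two
    positive heights. *)
Lemma weight_pred_none i beta t : beta \in pos -> beta != simple_root i ->
  ~~ has_pred i beta -> t \in root_index ->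
  root_weight t != cone_lattice beta - cone_lattice (simple_root i).
Proof.
move=> bp bs np; rewrite -subr_eq0 opprB addrA.
move: t => [l|[b|b]]; rewrite /= ?mem_index_e ?mem_index_f => tI.
- rewrite add0r subr_eq0; apply: contra bs => /eqP/cone_lattice_inj ->; exact: eqxx.
- rewrite -cone_latticeD subr_eq0; apply: contra np => /eqP/cone_lattice_inj <-.
  by rewrite /has_pred addsimple_gt0 pred_simpleK.
- rewrite addrAC -opprD addrC -cone_latticeD subr_eq0.
  apply/eqP => /cone_lattice_inj /(congr1 (@height r)).
  rewrite heightD; have := pos_neq0 bp; have := pos_neq0 tI.
  rewrite -!height_eq0; have -> : height (simple_root i) = 1%N.
    rewrite /height (bigD1 i) //= ffunE eqxx big1 // => l /negPf li.
    by rewrite ffunE li.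
  by case: (height b) => // n; case: (height beta) => // m _ _; rewrite addnS.
Qed.

Lemma has_pred_simple i : ~~ has_pred i (simple_root i).
Proof.
rewrite /has_pred; apply/negP => /andP[_ /pos_neq0/eqP]; apply.
by apply/ffunP => l; rewrite !ffunE subnn.
Qed.

Lemma br_f_e i beta : beta \in pos -> beta != simple_root i ->
  br (fa i) (e beta) =
  if has_pred i beta
  then form (br (fa i) (e beta)) (f (pred_simple i beta)) *: e (pred_simple i beta)
  else 0.
Proof.
move=> bp bs; have ps := lie_pos_simple i.
have := lie_weight_br (lie_weight_f ps) (lie_weight_e bp); rewrite addrC => hw.
case: ifPn => [/andP[bi pb]|np]; last first.
  by apply: lie_weight_none hw _ => t; exact: weight_pred_none.
apply: lie_weight_eE => //; move: hw; rewrite -{1}(pred_simpleE bi) cone_latticeD.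
by rewrite addrK.
Qed.

(** By invariance of the form, [ad e_i] on the f_beta is minus the transpose of [ad e_i] on the
    e_beta; this is the invariance of the tensor F. *)
Lemma br_e_f_pred i beta : beta \in pos -> beta != simple_root i ->
  br (ea i) (f beta) =
  if has_pred i beta then - br_coef i (pred_simple i beta) *: f (pred_simple i beta)
  else 0.
Proof.
move=> bp bs; have ps := lie_pos_simple i; have B := lie_form_bilin g.
have := lie_weight_br (lie_weight_e ps) (lie_weight_f bp); rewrite addrC => hw.
case: ifPn => [/andP[bi pb]|np]; last first.
  apply: (lie_weight_none hw) => -[l|[b|b]] tI; rewrite -eqr_opp opprD opprK.
  - by rewrite oppr0; exact: (weight_pred_none bp bs np tI).
  - apply: (weight_pred_none bp bs np (t := inr (inr b))).
    by rewrite mem_index_f -mem_index_e.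
  - rewrite /= opprK; apply: (weight_pred_none bp bs np (t := inr (inl b))).
    by rewrite mem_index_e -mem_index_f.
rewrite (lie_weight_fE pb (x := br _ _)); last first.
  move: hw; rewrite -{1}(pred_simpleE bi) cone_latticeD opprD -addrA.
  by rewrite addNr addr0.
rewrite /br_coef pred_simpleE // bp -lie_form_inv brC -scaleN1r.
by rewrite (bilinZl B) scaleN1r.
Qed.

Lemma br_fe_e i beta : beta \in pos ->
  br (h i) (e beta) = br (ea i) (br (fa i) (e beta)) - br (fa i) (br (ea i) (e beta)).
Proof. by move=> bp; rewrite ad_br br_e_f addrK. Qed.

Lemma lie_e_neq0 beta : beta \in pos -> e beta != 0.
Proof.
move=> bp; apply/eqP => e0; have := lie_dual bp.
by rewrite e0 (bilin0l (lie_form_bilin g)) => /esym/eqP; rewrite oner_eq0.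
Qed.

(* The trace of [ad h_i = [ad e_i, ad f_i]] on the span of the [e_beta], [h_i]
   and [f_i] vanishes: [tr_term] is the diagonal entry of the product of
   [ad e_i] and [ad f_i] there, and the sum telescopes along the i-strings. *)
Lemma sum_pos_simple i : \sum_(beta <- pos) wval (cone_lattice beta) i = gram i i.
Proof.
have ps := lie_pos_simple i.
pose tr_term beta := if (beta \in pos) && has_pred i beta then
  form (br (fa i) (e beta)) (f (pred_simple i beta)) * br_coef i (pred_simple i beta)
  else 0.
have E beta : beta \in pos -> wval (cone_lattice beta) i =
    tr_term beta - tr_term (beta + simple_root i) +
    (if beta == simple_root i then gram i i else 0).
  move=> bp; have := br_fe_e i bp; rewrite br_h_e // br_e_e // brZr.
  have -> : br_coef i beta *: br (fa i) (e (beta + simple_root i)) =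
            tr_term (beta + simple_root i) *: e beta.
    rewrite /tr_term /has_pred addsimple_gt0 pred_simpleK bp /= andbT.
    case: ifPn => np; last by rewrite /br_coef (negPf np) !scale0r.
    rewrite [in LHS]br_f_e //; last first.
      apply/eqP => /ffunP E; have /eqP := pos_neq0 bp; apply.
      apply/ffunP => l; have := E l; rewrite cone_addE cone0E => /eqP.
      by rewrite -[X in _ == X]add0n eqn_add2r => /eqP.
    by rewrite /has_pred addsimple_gt0 pred_simpleK bp /= scalerA [br_coef _ _ * _]mulrC.
  have -> : br (ea i) (br (fa i) (e beta)) =
      (tr_term beta + if beta == simple_root i then gram i i else 0) *: e beta.
    (* At beta = alpha_i the product passes through h_i instead of a root vector; this is the only
       term that does not telescope. *)
    have [->|bs] := eqVneq beta (simple_root i).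
      rewrite /tr_term (negPf (has_pred_simple i)) andbF add0r.
      by rewrite [br (fa i) _]brC br_e_f brNr brC opprK br_h_e // wval_simple.
    rewrite addr0 br_f_e // /tr_term bp; case: ifPn => [/andP[bi pb]|_] /=.
      by rewrite brZr br_e_e // scalerA pred_simpleE.
    by rewrite (bilin0r (lie_br_bilin g)) scale0r.
  rewrite -scalerBl => /eqP; rewrite -subr_eq0 -scalerBl scaler_eq0.
  by rewrite (negPf (lie_e_neq0 bp)) orbF subr_eq0 addrAC => /eqP.
rewrite (eq_big_seq _ E) big_split sumrB /=.
have -> : \sum_(beta <- pos) tr_term (beta + simple_root i) =
    \sum_(beta <- pos) tr_term beta.
  transitivity (\sum_(beta <- [seq b + simple_root i | b <- pos]) tr_term beta).
    by rewrite big_map.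
  apply: supported_sum; split.
  - by rewrite (map_inj_uniq (can_inj (pred_simpleK i))) lie_pos_uniq.
  - move=> beta nb; rewrite /tr_term; case: ifP => // /andP[_ /andP[bi pb]].
    by case/negP: nb; apply/mapP; exists (pred_simple i beta); rewrite ?pred_simpleE.
  - exact: lie_pos_uniq.
  - by move=> beta /negPf nb; rewrite /tr_term nb.
rewrite subrr add0r (bigD1_seq (simple_root i)) ?lie_pos_uniq //= eqxx.
by rewrite big1 ?addr0 // => b /negPf->.
Qed.

Lemma pairing_simple i beta :
  pairing (simple_root i) beta = wval (cone_lattice beta) i.
Proof.
rewrite /pairing (bigD1 i) //= [X in _ + X]big1 ?addr0 => [|l /negPf li].
  by apply: eq_bigr => k _; rewrite !ffunE eqxx mul1r.
by rewrite big1 // => k _; rewrite ffunE li !mul0r.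
Qed.

End RootSystem.

(** * The quantum case *)

Section QCommutation.
Variables (K : fieldType) (q : K) (C : algType K).
Hypothesis q0 : q != 0.
Implicit Types k x : C.

Definition qcomm (n : int) k x : Prop := k * x = q ^ n *: (x * k).

Lemma qcomm0P k x : qcomm 0 k x <-> GRing.comm k x.
Proof. by rewrite /qcomm expr0z scale1r. Qed.

Lemma qcomm1 x : qcomm 0 1 x.
Proof. by apply/qcomm0P/commr_sym/commr1. Qed.

Lemma qcommM m n k k' x : qcomm m k x -> qcomm n k' x -> qcomm (m + n) (k * k') x.
Proof.
move=> hk hk'; rewrite /qcomm -mulrA hk' -scalerAr [in LHS]mulrA hk -scalerAl scalerA.
by rewrite -mulrA expfzDr // mulrC.
Qed.

Lemma qcommV n k k' x : k * k' = 1 -> k' * k = 1 -> qcomm n k x -> qcomm (- n) k' x.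
Proof.
move=> kk' k'k hk; have /(congr1 (fun z => k' * z * k')) := hk.
rewrite mulrA k'k mul1r -scalerAr -scalerAl -!mulrA kk' mulr1 => E.
by rewrite /qcomm E scalerA -expfzDr // addNr expr0z scale1r.
Qed.

Lemma qcommX n k x (m : nat) : qcomm n k x -> qcomm (m%:Z * n) (k ^+ m) x.
Proof.
move=> hk; elim: m => [|m IH]; first by rewrite mul0r expr0; exact: qcomm1.
by rewrite exprS intS mulrDl mul1r; exact: qcommM.
Qed.

Lemma qcomm_prod (I : Type) (s : seq I) (n : I -> int) (m : I -> nat) (k : I -> C) x :
  (forall i, qcomm (n i) (k i) x) ->
  qcomm (\sum_(i <- s) (m i)%:Z * n i) (\prod_(i <- s) k i ^+ m i) x.
Proof.
move=> hk; elim: s => [|i s IH]; first by rewrite !big_nil; exact: qcomm1.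
by rewrite !big_cons; apply: qcommM => //; exact: qcommX.
Qed.

End QCommutation.

(** * The commutative torus generated by the q^h *)

Section QuantumTorus.
Variables (K : fieldType) (g : semisimple_lie K) (C : algType K).
Notation r := (lie_rank g).
Variables (k k' : 'I_r -> C).
Hypothesis k_inv : forall i, k i * k' i = 1 /\ k' i * k i = 1.
Hypothesis k_comm : forall i j, GRing.comm (k i) (k j).

(** Commuting is q-commuting with exponent 0, here at q = 1, so the rule for inverses applies. *)
Lemma k_k'_comm i j : GRing.comm (k i) (k' j).
Proof.
have q1 : (1 : K) != 0 := oner_neq0 _.
apply/commr_sym/(qcomm0P 1); rewrite -[0 : int]oppr0.
by apply: (qcommV q1 (k_inv j).1 (k_inv j).2); apply/qcomm0P.
Qed.

Lemma k'_k'_comm i j : GRing.comm (k' i) (k' j).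
Proof.
have q1 : (1 : K) != 0 := oner_neq0 _.
apply/(qcomm0P 1); rewrite -[0 : int]oppr0.
by apply: (qcommV q1 (k_inv i).1 (k_inv i).2); apply/qcomm0P; exact: k_k'_comm.
Qed.

Lemma quantum_k0 : quantum_k (g := g) k 0 = 1.
Proof. by apply: big1 => i _; rewrite ffunE expr0. Qed.

Lemma quantum_kK mu : quantum_k (g := g) k mu * quantum_k (g := g) k' mu = 1.
Proof.
rewrite /quantum_k -prodrM_comm => [|i j _ _]; last first.
  by apply/commrX/commr_sym/commrX/commr_sym; exact: k_k'_comm.
rewrite big1 // => i _; rewrite -exprMn_comm; last exact: k_k'_comm.
by rewrite (k_inv i).1 expr1n.
Qed.

Lemma quantum_k_simple i : quantum_k (g := g) k (simple_root i) = k i.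
Proof.
rewrite /quantum_k (eq_bigr (fun l => if l == i then k i else 1)).
  by rewrite -big_mkcond big_pred1_eq.
by move=> l _; rewrite ffunE; case: eqP => [->|_]; rewrite ?expr1 ?expr0.
Qed.

Lemma quantum_kD mu nu :
  quantum_k (g := g) k (mu + nu) = quantum_k (g := g) k mu * quantum_k (g := g) k nu.
Proof.
rewrite /quantum_k -prodrM_comm => [|i j _ _]; last first.
  by apply/commrX/commr_sym/commrX/commr_sym.
by apply: eq_bigr => i _; rewrite ffunE exprD.
Qed.

End QuantumTorus.

Section QuantumData.
Variables (K : fieldType) (g : semisimple_lie K).
Hypothesis intr_inj : injective (intr : int -> K).
Notation r := (lie_rank g).
Variables (q : K) (b : 'I_r -> 'I_r -> int) (d : 'I_r -> nat) (U : algType K).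
Variables (e f kk kk' : 'I_r -> U) (Delta Delta_tilde : U -> tens U U).
Variables (gamma : U -> U).
Variable Rc : completed r (subalg (quantum_gen_p e)) (subalg (quantum_gen_m f)).
Hypothesis q0 : q != 0.
Hypothesis q_root : forall n, (0 < n)%N -> q ^+ n != 1.
Hypothesis bP : normalized_form b d.
Hypothesis UP : quantum_group q b d e f kk kk'.
Hypothesis DeltaP : quantum_Delta e f kk kk' Delta.
Hypothesis Delta_tildeP : quantum_Delta_tilde e f kk kk' Delta_tilde.
Hypothesis gammaP : quantum_gamma e f kk kk' gamma.
Hypothesis RcP : quantum_Rcheck q b kk Delta Delta_tilde Rc.

Notation D := (quantum_udata q b kk kk' Delta gamma Rc).
Notation s := (int_eta_shift (g := g) b).
Notation kmu := (quantum_k (g := g) kk).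
Notation kmu' := (quantum_k (g := g) kk').
Notation c := ((q - q^-1)^-1).
Implicit Types (mu nu : cone r) (lambda : root_lattice r) (i l : 'I_r).

Lemma expq_inj (m n : int) : q ^ m = q ^ n -> m = n.
Proof.
move=> E; have E1 : q ^ (m - n) = 1.
  by rewrite expfzDr // E -expfzDr // subrr expr0z.
apply/eqP; rewrite -subr_eq0; move: E1; case: (m - n) => [[|k]|k] // E1.
  by have := q_root (n := k.+1) isT; rewrite -E1 exprnP eqxx.
have := q_root (n := k.+1) isT; rewrite NegzE -invr_expz in E1.
by rewrite exprnP -[_ ^ _]invrK E1 invr1 eqxx.
Qed.

Lemma kk_inv i : kk i * kk' i = 1 /\ kk' i * kk i = 1.
Proof. by have [[h _ _ _ _] _] := UP; exact: h. Qed.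

Lemma kk_comm i l : GRing.comm (kk i) (kk l).
Proof. by have [[_ h _ _ _] _] := UP; exact: h. Qed.

Lemma kk_e i l : qcomm q (b i l) (kk i) (e l).
Proof. by have [[_ _ h _ _] _] := UP; have [] := h i l. Qed.

Lemma b_sym i l : b i l = b l i.
Proof. by apply: intr_inj; rewrite -!bP.1; exact: gram_sym. Qed.

Lemma wval_b lambda i : wval lambda i = (\sum_l lambda l * b i l)%:~R.
Proof. by rewrite rmorph_sum; apply: eq_bigr => l _; rewrite bP.1 rmorphM. Qed.

(** The integer (mu, alpha_i). *)
Definition cone_b mu i : int := \sum_l (mu l)%:Z * b l i.

Lemma cone_b_simple i l : cone_b (simple_root i) l = b i l.
Proof.
rewrite /cone_b (bigD1 i) //= ffunE eqxx mul1r big1 ?addr0 // => k /negPf ki.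
by rewrite ffunE ki mul0r.
Qed.

Lemma wval_cone_b mu i : wval (cone_lattice mu) i = (cone_b mu i)%:~R.
Proof.
rewrite wval_b; congr (_%:~R); apply: eq_bigr => l _; rewrite ffunE b_sym; exact: erefl.
Qed.

Lemma int_pairingDl mu nu la :
  int_pairing (g := g) b (mu + nu) la =
      int_pairing (g := g) b mu la + int_pairing (g := g) b nu la.
Proof.
rewrite /int_pairing -big_split; apply: eq_bigr => i _; rewrite -big_split.
by apply: eq_bigr => l _; rewrite ffunE PoszD !mulrDl.
Qed.

Lemma int_pairingC mu nu : int_pairing (g := g) b mu nu = int_pairing (g := g) b nu mu.
Proof.
rewrite /int_pairing exchange_big; apply: eq_bigr => i _; apply: eq_bigr => l _.
by rewrite b_sym [(mu _)%:Z * _]mulrC.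
Qed.

Lemma int_pairing_simple mu i : int_pairing (g := g) b mu (simple_root i) = cone_b mu i.
Proof.
apply: eq_bigr => l _; rewrite (bigD1 i) //= ffunE eqxx mulr1 big1 ?addr0 // =>
    k /negPf ki.
by rewrite ffunE ki mulr0 mul0r.
Qed.

(** Twice (alpha, rho) cancels (alpha, alpha), so the numerator changes by -2 (mu, alpha). Being a
    multiple of 2, this passes through the integer division whatever the parity of the numerator. *)
Lemma int_eta_shift_simple mu i : s (mu + simple_root i) = s mu - cone_b mu i.
Proof.
rewrite /int_eta_shift.
have -> : \sum_(beta <- lie_pos g) int_pairing (g := g) b (mu + simple_root i) beta -
    int_pairing (g := g) b (mu + simple_root i) (mu + simple_root i) =
    - cone_b mu i * 2 + (\sum_(beta <- lie_pos g) int_pairing (g := g) b mu beta -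
       int_pairing (g := g) b mu mu).
  have rho : \sum_(beta <- lie_pos g) int_pairing (g := g) b (simple_root i) beta =
             cone_b (simple_root i) i.
    apply: intr_inj; rewrite rmorph_sum -wval_cone_b wval_simple -sum_pos_simple //.
    by apply: eq_bigr => beta _; rewrite int_pairingC int_pairing_simple wval_cone_b.
  under eq_bigr => beta _ do rewrite int_pairingDl.
  rewrite big_split /= rho int_pairingDl [int_pairing b mu (_ + _)]int_pairingC.
  rewrite [int_pairing b (simple_root i) (_ + _)]int_pairingC !int_pairingDl.
  rewrite !int_pairing_simple [int_pairing b (simple_root i) mu]int_pairingC.
  rewrite int_pairing_simple; ring.
by rewrite divzMDl // addrC.
Qed.

Lemma int_eta_shift0 : s 0 = 0.
Proof.
have p0 nu : int_pairing (g := g) b 0 nu = 0.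
  rewrite /int_pairing big1 // => i _; rewrite big1 // => l _.
  by rewrite ffunE !mul0r.
by rewrite /int_eta_shift big1 ?p0 // => nu _; rewrite p0.
Qed.

(* q^(eta_mu) and q^(- eta_mu) *)
Definition qeta mu : U := q ^ s mu *: kmu mu.
Definition qeta' mu : U := q ^ (- s mu) *: kmu' mu.

Lemma kk'_inv i : kk' i * kk i = 1 /\ kk i * kk' i = 1.
Proof. by have [] := kk_inv i. Qed.

Lemma kk'_comm i l : GRing.comm (kk' i) (kk' l).
Proof. exact: k'_k'_comm kk_inv kk_comm i l. Qed.

Lemma qetaK mu : qeta mu * qeta' mu = 1.
Proof.
rewrite /qeta /qeta' -scalerAl -scalerAr scalerA -expfzDr // subrr expr0z scale1r.
exact: (quantum_kK kk_inv kk_comm).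
Qed.

Lemma qetaK' mu : qeta' mu * qeta mu = 1.
Proof.
rewrite /qeta /qeta' -scalerAl -scalerAr scalerA -expfzDr // addNr expr0z scale1r.
exact: (quantum_kK kk'_inv kk'_comm).
Qed.

Lemma qcomm_kmu mu i : qcomm q (cone_b mu i) (kmu mu) (e i).
Proof. by apply: (qcomm_prod q0 (index_enum _) mu) => // l; exact: kk_e. Qed.

Lemma qcomm_kmu' mu i : qcomm q (- cone_b mu i) (kmu' mu) (e i).
Proof.
rewrite /cone_b -sumrN; under eq_bigr => l _ do rewrite -mulrN.
apply: (qcomm_prod q0 (index_enum _) mu) => // l.
exact: (qcommV q0 (kk_inv l).1 (kk_inv l).2 (kk_e l i)).
Qed.

Lemma kk_kmu l mu : GRing.comm (kk l) (kmu mu).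
Proof. by apply: commr_prod => i _; apply: commrX; exact: kk_comm. Qed.

Lemma kk_kmu' l mu : GRing.comm (kk l) (kmu' mu).
Proof. by apply: commr_prod => i _; apply: commrX;
  exact: k_k'_comm kk_inv kk_comm l i. Qed.

(** With phi(z) = q^(-z) / [z]_q, the inverse of phi(- eta) is q^(- eta) [- eta]_q = (q^(-2 eta) -
    1) / (q - q^(-1)). *)
Definition qtheta mu : U := c *: (qeta' mu * qeta' mu - 1).

Lemma qthetaM mu : qtheta mu * qeta mu = c *: (qeta' mu - qeta mu).
Proof. by rewrite -scalerAl mulrBl -mulrA qetaK' mulr1 mul1r. Qed.

Lemma qthetaM' mu : qeta mu * qtheta mu = c *: (qeta' mu - qeta mu).
Proof. by rewrite -scalerAr mulrBr mulrA qetaK mulr1 mul1r. Qed.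

Lemma qtheta_den mu : GRing.comm (qtheta mu) (c *: (qeta' mu - qeta mu)).
Proof.
by rewrite /GRing.comm -{1}qthetaM' mulrA qthetaM.
Qed.

Lemma quantum_wrootD lambda lambda' l :
  quantum_wroot q b (lambda + lambda') l =
  quantum_wroot q b lambda l * quantum_wroot q b lambda' l.
Proof.
rewrite /quantum_wroot -expfzDr // -big_split; congr (_ ^ _).
by apply: eq_bigr => i _; rewrite ffunE mulrDl.
Qed.

Lemma quantum_wroot0 l : quantum_wroot q b 0 l = 1.
Proof. by rewrite /quantum_wroot big1 ?expr0z // => i _; rewrite ffunE mul0r. Qed.

Lemma quantum_wroot_cone mu l : quantum_wroot q b (cone_lattice mu) l = q ^ cone_b mu l.
Proof.
rewrite /quantum_wroot; congr (_ ^ _); apply: eq_bigr => i _.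
by rewrite ffunE b_sym.
Qed.

Lemma quantum_wroot_opp mu l : quantum_wroot q b (- cone_lattice mu) l =
    q ^ (- cone_b mu l).
Proof.
rewrite /quantum_wroot -sumrN; congr (_ ^ _); apply: eq_bigr => i _.
by rewrite !ffunE mulNr b_sym.
Qed.

Lemma quantum_weightP lambda (x : U) : quantum_weight q b kk lambda x ->
  has_weight (D := D) (fun l la => quantum_wroot q b la l) (fun _ _ => 0) id lambda x.
Proof. by move=> hx l; rewrite /affine_t scale0r addr0 -scalerAr; exact: hx. Qed.

Notation Rv := (fun mu => tmap val val (Rc mu)).

(** The two summands of the coproduct of e_i have first legs of weights alpha_i and 0; this is the
    component of first weight mu of the intertwining relation. *)
Lemma Rcheck_comm i mu :
  shift i Rv mu * tpure (e i) (kk i) + Rv mu * tpure 1 (e i) =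
  tpure 1 (e i) * Rv mu + tpure (e i) (kk' i) * shift i Rv mu.
Proof.
have [_ _ Rint] := RcP; pose al : root_lattice r := cone_lattice (simple_root i).
have al0 : al != 0.
  apply/eqP => /ffunP/(_ i); rewrite !ffunE eqxx => /eqP; by [].
pose a (x : U) (la : root_lattice r) : tens U U :=
  if la == 0 then tpure 1 (e i) else tpure (e i) x.
have aE x : \sum_(la <- [:: 0; al]) a x la = tpure (e i) x + tpure 1 (e i).
  by rewrite big_cons big_seq1 /a eqxx (negPf al0) addrC.
have [_ /(_ i)[_ De _ _]] := DeltaP; have [_ /(_ i)[_ Dte _ _]] := Delta_tildeP.
have w0 : quantum_weight q b kk 0 1.
  by move=> l; rewrite quantum_wroot0 scale1r mulr1 mul1r.
have wal : quantum_weight q b kk al (e i).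
  by move=> l; rewrite quantum_wroot_cone cone_b_simple b_sym; exact: kk_e.
have := Rint (e i) [:: 0; al] (a (kk i)) (a (kk' i)) _ _ _ _ (cone_lattice mu).
rewrite !big_cons !big_nil !addr0 /a !eqxx (negPf al0).
have ext0 : lattice_ext Rv (cone_lattice mu) = Rv mu.
  rewrite /lattice_ext ifT; last by apply/forallP => l; rewrite ffunE.
  by congr (tmap _ _ (Rc _)); apply/ffunP => l; rewrite !ffunE.
have extal : lattice_ext Rv (cone_lattice mu - al) = shift i Rv mu.
  rewrite /lattice_ext /shift; have [hi|ni] := ltnP 0%N (mu i).
    have le l : ((l == i) <= mu l)%N by case: eqP => [->|_].
    rewrite ifT; last by apply/forallP => l; rewrite !ffunE subr_ge0 lez_nat.
    congr (tmap _ _ (Rc _)); apply/ffunP => l; rewrite !ffunE.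
    by rewrite subzn.
  rewrite ifF //; apply/negbTE/negP => /forallP/(_ i).
  by rewrite !ffunE eqxx subr_ge0 lez_nat leqNgt ltnS ni.
rewrite subr0 ext0 extal => H; rewrite addrC; apply: H.
- by rewrite /= inE eq_sym al0.
- move=> la; rewrite !inE => /orP[]/eqP->; rewrite /a ?eqxx ?(negPf al0);
    by split; apply: in_tens_pure.
- by rewrite De addrC.
- by rewrite Dte addrC.
Qed.

Notation qa := (fun l la => quantum_wroot q b la l).
Notation qb := (fun _ _ => 0 : K).

(** Rcheck intertwines exactly, but the subtracted 1 (x) 1 does not: it leaves e (x) (k - k'), which
    after division by q - q^(-1) is the defect e (x) [h]_q. *)
Lemma quantum_calF_comm i mu :
  shift i (fun nu => tmap val val (quantum_calF q Rc nu)) mu * tpure (e i) (kk i) +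
    tmap val val (quantum_calF q Rc mu) * tpure 1 (e i) =
  tpure 1 (e i) * tmap val val (quantum_calF q Rc mu) +
    tpure (e i) (kk' i) * shift i (fun nu => tmap val val (quantum_calF q Rc nu)) mu -
    shift i (fun nu => if nu == 0 then tpure (e i) (c *: (kk i - kk' i)) else 0) mu.
Proof.
set H := shift i (fun nu => if nu == 0 then _ else _) mu.
pose one (nu : cone r) : tens U U := if nu == 0 then 1 else 0.
have FE nu : tmap (val : _ -> U) (val : _ -> U) (quantum_calF q Rc nu) =
    c *: (Rv nu - one nu).
  rewrite /quantum_calF (tmapZ val val) (tmapD val val) (tmapN val val);
    congr (_ *: (_ - _)).
  rewrite /one; case: ifP => _; last exact: (tmap0 val val).
  exact: (tmap1 (f := val) (g := val) (rmorph1 _) (rmorph1 _)).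
have sFE : shift i (fun nu =>
    tmap (val : _ -> U) (val : _ -> U) (quantum_calF q Rc nu)) mu =
    c *: (shift i Rv mu - shift i one mu).
  by rewrite /shift; case: ifP => _; rewrite ?FE // subrr scaler0.
have oneC x : one mu * x = x * one mu.
  by rewrite /one; case: ifP => _; rewrite ?mul1r ?mulr1 ?mul0r ?mulr0.
have soneC : c *: (shift i one mu * tpure (e i) (kk i)) =
    c *: (tpure (e i) (kk' i) * shift i one mu) + H.
  rewrite /H /shift; case: ifP => _; last by rewrite mul0r mulr0 scaler0 addr0.
  rewrite /one; case: ifP => _; last by rewrite mul0r mulr0 scaler0 addr0.
  by rewrite mul1r mulr1 tpureZr tpureBr -scalerDr addrCA subrr addr0.
rewrite FE sFE -!tens_scalerAl -!tens_scalerAr !mulrBl !mulrBr !scalerBr.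
rewrite soneC oneC addrACA -scalerDr Rcheck_comm scalerDr !opprD.
rewrite [in RHS]addrACA -[RHS]addrA; congr (_ + _).
by rewrite -[RHS]addrA [RHS]addrC.
Qed.

(** Let Q and Q' be q^(-2 eta) at mu and at mu + alpha. The terms without Q or Q' agree on both
    sides, so the claim is k' x Q = k x Q', which follows from the weight of x and the shift of
    eta. *)
Lemma quantum_theta_shift i mu (C : algType K) (j : {lrmorphism U -> C}) (x : C) :
  has_weight (D := D) qa qb j (- cone_lattice mu) x ->
  j (kk' i) * x * j (qtheta mu) - j (c *: (kk i - kk' i)) * x =
  j (kk i) * x * j (qtheta (mu + simple_root i)).
Proof.
move=> hx; set m := cone_b mu i.
have xk : qcomm q (- m) (j (kk i)) x.
  have := hx i; rewrite /affine_t scale0r addr0 linearZ /= quantum_wroot_opp => E.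
  by rewrite /qcomm E scalerAr.
have xk' : qcomm q m (j (kk' i)) x.
  rewrite -[m]opprK; apply: (qcommV q0 _ _ xk).
    by rewrite -rmorphM (kk_inv i).1 rmorph1.
  by rewrite -rmorphM (kk_inv i).2 rmorph1.
have k'P l : GRing.comm (kk' l) (kmu' mu).
  by apply: commr_prod => l' _; apply: commrX; exact: kk'_comm.
have qeS : qeta' (mu + simple_root i) = q ^ m *: (kk' i * qeta' mu).
  rewrite /qeta' int_eta_shift_simple (quantum_kD kk'_comm) quantum_k_simple.
  by rewrite -k'P -scalerAr scalerA -expfzDr // opprB.
(* What remains of k' x Q = k x Q' once k and k' have been moved to the right of x. *)
have sq : q ^ (- m) *: (kk i * (qeta' (mu + simple_root i) * qeta' (mu + simple_root
    i))) =
          q ^ m *: (kk' i * (qeta' mu * qeta' mu)).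
  have c2 : kk' i * qeta' mu = qeta' mu * kk' i.
    by rewrite /qeta' -scalerAl -scalerAr k'P.
  rewrite qeS; move: (qeta' mu) c2 => z c2.
  rewrite -!scalerAl -!scalerAr !scalerA -!expfzDr // addKr.
  by congr (_ *: _); rewrite !mulrA (kk_inv i).1 mul1r c2 -!mulrA c2.
rewrite /qtheta; move: (qeta' mu * _) (qeta' _ * _) sq => Q Q' sq.
rewrite !linearZ !linearB rmorph1 /= -!scalerAr -!scalerAl -scalerBr; congr (_ *: _).
rewrite !mulrBr !mulrBl !mulr1 opprB addrA subrK; congr (_ - _).
have := congr1 j sq; rewrite !linearZ /= !rmorphM => jsq.
by rewrite xk' xk -!scalerAl -!mulrA [LHS]scalerAr [RHS]scalerAr jsq.
Qed.

Lemma quantum_weight_pairing i mu :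
  weight_pairing D (quantum_wroot q b (cone_lattice (simple_root i))) mu =
      q ^ cone_b mu i.
Proof.
rewrite /weight_pairing /=.
have it n x : iter n ( *%R x) (1 : K) = x ^+ n by elim: n => //= n ->; rewrite exprS.
rewrite /cone_b (big_morph (fun n : int => q ^ n) (id1 := 1) (op1 := *%R)) //; last first.
  by move=> m n; rewrite expfzDr.
apply: eq_bigr => l _; rewrite it quantum_wroot_cone cone_b_simple.
by rewrite b_sym exprnP exprz_exp mulrC.
Qed.

Lemma quantum_e_den i mu (x : K) :
  e i * (c *: (x^-1 *: kmu mu - x *: kmu' mu)) =
  (c *: ((x * q ^ cone_b mu i)^-1 *: kmu mu - (x * q ^ cone_b mu i) *: kmu' mu)) * e i.
Proof.
rewrite -scalerAr -scalerAl; congr (_ *: _); rewrite mulrBr mulrBl -!scalerAr -!scalerAl.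
rewrite qcomm_kmu qcomm_kmu' !scalerA invfM; congr (_ *: _ - _ *: _).
  by rewrite -mulrA mulVf ?mulr1 // expfz_neq0.
by rewrite -mulrA -expfzDr // subrr expr0z mulr1.
Qed.

Lemma quantum_calF_weight mu :
  in_tens (fun u : subalg (quantum_gen_p e) =>
             has_weight (D := D) qa qb id (cone_lattice mu) (val u))
          (fun v : subalg (quantum_gen_m f) =>
             has_weight (D := D) qa qb id (- cone_lattice mu) (val v))
          (quantum_calF q Rc mu).
Proof.
have [Rc0 Rcw _] := RcP; rewrite /quantum_calF; have [->|mu0] := eqVneq mu 0.
  by rewrite Rc0 subrr scaler0; exact: in_tens0.
have [t ht ->] := Rcw mu; rewrite subr0 scaler_sumr; apply: in_tens_big_seq => p pt.
have [h1 h2] := ht p pt; rewrite -tpureZl; apply: in_tens_pure;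
  last exact: quantum_weightP.
apply: quantum_weightP => l; rewrite linearZ /= -scalerAr h1 -!scalerAl.
by rewrite !scalerA mulrC.
Qed.

Lemma quantum_shapovalov_data : shapovalov_data D.
Proof.
have [DM De] := DeltaP; have [gM ge] := gammaP; have [Rc0 _ _] := RcP.
refine (@ShapovalovData K r D kk kk' (fun i => c *: (kk i - kk' i)) qtheta qa qb
  DM gM _ _ _ _ _ _ quantum_calF_comm _ _ _ _ _ quantum_calF_weight
  _ qthetaM qthetaM' qtheta_den _ _ _ _ _ _ quantum_theta_shift _ _).
- by rewrite /= /quantum_calF Rc0 eqxx subrr scaler0.
- by move=> i; apply/asboolP/InSubalgGen; exists i.
- by move=> l; exists l; left.
- by move=> i; have [] := De i.
- by move=> i /=; have [_ _ -> _] := ge i; exact: (kk_inv i).2.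
- by move=> i /=; have [-> _ _ _] := ge i; rewrite mulNr -mulrA (kk_inv i).2 mulr1.
- by move=> l la la'; exact: quantum_wrootD.
- by move=> *; rewrite mulr0 addr0.
- exact: quantum_wroot0.
- by [].
- by move=> w l la /=; rewrite addr0 mulrC.
- rewrite /qtheta /qeta' int_eta_shift0 oppr0 expr0z scale1r quantum_k0 mulr1 subrr.
  exact: scaler0.
- by move=> l mu; rewrite /= -scalerAr -scalerAl kk_kmu.
- move=> l mu; rewrite /= -scalerAr -scalerAl; congr (_ *: _).
  by rewrite mulrBr mulrBl -!scalerAr -!scalerAl kk_kmu kk_kmu'.
- by move=> mu; rewrite /= -[RHS]scalerN opprB invr_expz opprK.
- by move=> i mu x; rewrite /= quantum_weight_pairing; exact: quantum_e_den.
- move=> i mu; exists (q ^ (- cone_b mu i) *: qeta mu).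
  rewrite /= /qeta -scalerAr -!scalerAl qcomm_kmu !scalerA mulrAC -expfzDr //.
  by rewrite addNr expr0z mul1r.
- move=> i l /=; have [_ _ -> _] := De l; have [_ _ gk _] := ge l.
  rewrite tlift_pure; last first.
    exact: (sandwich_bilin (D := D) idfun gM).
  rewrite gk kk_e -scalerAl -mulrA (kk_inv l).1 mulr1 quantum_wroot_cone.
  by rewrite cone_b_simple b_sym.
- move=> mu nu E; apply: cone_lattice_inj; apply: wval_inj => // l.
  rewrite !wval_cone_b; congr (_%:~R); apply: expq_inj.
  by rewrite -!quantum_wroot_cone; exact: E.
(* q^(h_l) is invertible in B^+, so its eigenvalue on a nonzero vector is nonzero and can be
   cancelled. *)
- move=> X act x l w [actB act1 actM] x0 hw; apply: mulfI.
  have tl : kk l \in subalg_pred (fun z : D => ud_gen_p D z \/ ud_gen_0 D z).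
    by apply/asboolP/InSubalgGen; right; exists l; left.
  have tl' : kk' l \in subalg_pred (fun z : D => ud_gen_p D z \/ ud_gen_0 D z).
    by apply/asboolP/InSubalgGen; right; exists l; right.
  apply: contraNneq x0 => w0; rewrite -(act1 x).
  have -> : 1 = Subalg tl' * Subalg tl.
    by apply: val_inj; rewrite rmorph1 rmorphM /= (kk_inv l).2.
  by rewrite actM hw // w0 scale0r (bilin0r actB).
Qed.

End QuantumData.

(** * The classical case *)

Section ClassicalData.
Variables (K : fieldType) (g : semisimple_lie K).
Hypothesis intr_inj : injective (intr : int -> K).
Notation r := (lie_rank g).
Variables (U : algType K) (iota : g -> U).
Variables (Delta : U -> tens U U) (gamma : U -> U).
Hypothesis UP : enveloping_algebra iota.
Hypothesis DeltaP : classical_Delta iota Delta.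
Hypothesis gammaP : classical_gamma iota gamma.

Notation D := (classical_udata iota Delta gamma).
Notation pos := (lie_pos g).
Notation H := (classical_h iota).
Notation ea i := (iota (lie_e (simple_root i))).
Implicit Types (mu nu : cone r) (lambda : root_lattice r) (i l : 'I_r).

Lemma iotaP : linear iota. Proof. by have [[h _] _] := UP. Qed.
Lemma iotaZ a x : iota (a *: x) = a *: iota x.
Proof.
have z : iota 0 = 0.
  by have := iotaP (-1) 0 0; rewrite scaler0 addr0 scaleN1r addNr.
by have := iotaP a x 0; rewrite !addr0 z addr0.
Qed.
Lemma iota0 : iota 0 = 0.
Proof. by rewrite -(scale0r 0) iotaZ scale0r. Qed.

Lemma iota_br x y : iota (lie_br x y) = iota x * iota y - iota y * iota x.
Proof. by have [[_ h] _] := UP. Qed.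

Lemma iota_weight lambda x l : lie_weight lambda x ->
  iota (lie_h l) * iota x = iota x * iota (lie_h l) + wval lambda l *: iota x.
Proof. by move=> /(_ l) hx; rewrite -iotaZ -hx iota_br addrC subrK. Qed.

Lemma two_neq0 : (2 : K) != 0.
Proof. by apply/eqP => /(intr_inj (x1 := 2) (x2 := 0)). Qed.

Lemma pairingDl mu nu la : pairing (mu + nu) la = pairing mu la + pairing nu la.
Proof.
rewrite /pairing -big_split; apply: eq_bigr => i _; rewrite -big_split.
by apply: eq_bigr => l _; rewrite ffunE natrD !mulrDl.
Qed.

Lemma pairingC mu nu : pairing mu nu = pairing nu mu.
Proof.
rewrite /pairing exchange_big; apply: eq_bigr => i _; apply: eq_bigr => l _.
by rewrite gram_sym [(mu _)%:R * _]mulrC.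
Qed.

(** Here (alpha, rho) cancels half of (alpha, alpha), and only the cross term survives. *)
Lemma eta_shift_simple mu i :
  eta_shift (mu + simple_root i) = eta_shift mu - wval (cone_lattice mu) i.
Proof.
rewrite /eta_shift /rho_pairing.
under eq_bigr => beta _ do rewrite pairingDl pairing_simple.
rewrite big_split /= (sum_pos_simple intr_inj).
rewrite pairingDl pairing_simple [pairing mu (_ + _)]pairingC pairingDl pairing_simple.
rewrite cone_latticeD wvalD wval_simple.
by have := two_neq0 => h2; field.
Qed.

Lemma eta_shift0 : eta_shift (0 : cone r) = 0.
Proof.
have p0 nu : pairing 0 nu = 0.
  by rewrite /pairing big1 // => i _; rewrite big1 // => l _; rewrite ffunE !mul0r.
by rewrite /eta_shift /rho_pairing big1 ?p0 ?mulr0 ?subrr // => nu _; rewrite p0.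
Qed.

Lemma classical_h0 : H 0 = 0.
Proof. by rewrite /classical_h big1 // => i _; rewrite ffunE scale0r. Qed.

Lemma classical_hD mu i : H (mu + simple_root i) = H mu + iota (lie_h i).
Proof.
rewrite /classical_h; under eq_bigr => l _ do rewrite cone_addE natrD scalerDl.
rewrite big_split /=; congr (_ + _); rewrite (bigD1 i) //= ffunE eqxx scale1r.
by rewrite big1 ?addr0 // => l /negPf li; rewrite ffunE li scale0r.
Qed.

Lemma iota_h_comm i l : GRing.comm (iota (lie_h i)) (iota (lie_h l)).
Proof. by apply/eqP; rewrite -subr_eq0 -iota_br lie_h_abelian iota0. Qed.

Lemma classical_h_e mu i :
  ea i * H mu = (H mu - (wval (cone_lattice mu) i)%:A) * ea i.
Proof.
rewrite mulrBl -scalerAl mul1r /classical_h mulr_sumr mulr_suml /wval scaler_suml -sumrB.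
apply: eq_bigr => l _; rewrite -scalerAr -scalerAl.
rewrite (iota_weight l (lie_weight_e (lie_pos_simple i))) wval_simple scalerDr.
by rewrite ffunE scalerA gram_sym addrK.
Qed.

Lemma calF_val mu : tmap val val (classical_calF iota mu) =
  if mu \in pos then tpure (iota (lie_e mu)) (iota (lie_f mu)) else 0.
Proof.
rewrite /classical_calF; case: {-}_ / boolP => [pmu|/negPf ->].
  by rewrite pmu (tmap_pure val val).
by rewrite (tmap0 val val).
Qed.

(** Commuting with 1 (x) e_i produces e_mu (x) [e_i, f_mu], commuting with e_i (x) 1 produces
    [e_i, e_(mu - alpha)] (x) f_(mu - alpha). They cancel by invariance except at mu = alpha_i,
    where only e_i (x) h_i remains. *)
Lemma classical_calF_comm i mu :
  shift i (fun nu => tmap val val (classical_calF iota nu)) mu * tpure (ea i) 1 +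
    tmap val val (classical_calF iota mu) * tpure 1 (ea i) =
  tpure 1 (ea i) * tmap val val (classical_calF iota mu) +
    tpure (ea i) 1 * shift i (fun nu => tmap val val (classical_calF iota nu)) mu -
    shift i (fun nu => if nu == 0 then tpure (ea i) (iota (lie_h i)) else 0) mu.
Proof.
set F := tmap val val (classical_calF iota mu).
set G := shift i (fun nu => tmap val val _) mu.
have FE : F * tpure 1 (ea i) = tpure 1 (ea i) * F -
    (if mu \in pos then tpure (iota (lie_e mu)) (iota (lie_br (lie_e (simple_root i))
        (lie_f mu))) else 0).
  rewrite /F calF_val; case: ifP => _; last by rewrite mul0r mulr0 subrr.
  by rewrite !tpureM mulr1 mul1r iota_br tpureBr opprB addrC subrK.
have GE : G * tpure (ea i) 1 = tpure (ea i) 1 * G -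
    (if has_pred i mu then br_coef i (pred_simple i mu) *:
       tpure (iota (lie_e mu)) (iota (lie_f (pred_simple i mu))) else 0).
  rewrite /G /shift /has_pred; case: ifP => [hi|_]; last by rewrite mul0r mulr0 subrr.
  rewrite calF_val /=; case: ifP => [pp|_]; last by rewrite mul0r mulr0 subrr.
  have E : br_coef i (pred_simple i mu) *: iota (lie_e mu) =
      ea i * iota (lie_e (pred_simple i mu)) - iota (lie_e (pred_simple i mu)) * ea i.
    by rewrite -iotaZ -iota_br br_e_e // pred_simpleE.
  by rewrite !tpureM mulr1 mul1r -tpureZl E tpureBl opprB addrC subrK.
rewrite FE GE addrACA -opprD [X in X - _]addrC; congr (_ - _).
have [->|ms] := eqVneq mu (simple_root i).
  rewrite (negPf (has_pred_simple i)) lie_pos_simple add0r br_e_f //.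
  rewrite /shift ffunE eqxx /= ifT //; apply/eqP/ffunP => l; rewrite !ffunE; exact: subnn.
have -> : shift i (fun nu => if nu == 0 then tpure (ea i) (iota (lie_h i)) else 0) mu = 0.
  rewrite /shift; case: ifP => // hi; case: eqP => // E.
  by case/eqP: ms; rewrite -(pred_simpleE hi) E add0r.
(* If only one of mu and mu - alpha_i is a positive root, the corresponding bracket is itself
   zero. *)
case: ifPn => hp; case: ifPn => pm; rewrite ?addr0 ?add0r //.
- rewrite br_e_f_pred // hp iotaZ tpureZr -scalerDl subrr scale0r //.
- case/andP: hp => hi pp; rewrite /br_coef pred_simpleE // (negPf pm) scale0r //.
- by rewrite br_e_f_pred // (negPf hp) iota0 tpure0r.
Qed.

Notation ca := (fun _ _ => 1 : K).
Notation cb := (fun l la => wval la l).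

Lemma iota_has_weight lambda x : lie_weight lambda x ->
  has_weight (D := D) ca cb id lambda (iota x).
Proof.
move=> hx l; rewrite /affine_t /= scale1r (iota_weight l hx) mulrDr.
by rewrite -scalerAr mulr1.
Qed.

(** Since phi(z) = 1/z, the inverse of phi(- eta) is - eta. *)
Definition ctheta mu : U := - (H mu + (eta_shift mu)%:A).

(** Moving h_i across x subtracts (mu, alpha_i), and h_i - (mu, alpha_i) is the difference of eta at
    mu + alpha_i and at mu. *)
Lemma classical_theta_shift i mu (C : algType K) (j : {lrmorphism U -> C}) (x : C) :
  has_weight (D := D) ca cb j (- cone_lattice mu) x ->
  j 1 * x * j (ctheta mu) - j (iota (lie_h i)) * x =
      j 1 * x * j (ctheta (mu + simple_root i)).
Proof.
move=> hx; have := hx i; rewrite /affine_t /= scale1r wvalN => ->.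
rewrite rmorph1 mul1r -mulrBr -rmorphB; congr (_ * j _).
rewrite /ctheta classical_hD eta_shift_simple; move: (eta_shift mu) => s.
by rewrite scalerBl scaleNr !opprD !opprK -!addrA; congr (_ + _); rewrite addrCA.
Qed.

Lemma classical_weight_pairing i mu :
  weight_pairing D (ud_wroot D (cone_lattice (simple_root i))) mu =
  wval (cone_lattice mu) i.
Proof.
rewrite /weight_pairing /wval /=; apply: eq_bigr => l _.
have it n (x : K) : iter n ( +%R x) 0 = n%:R * x.
  by elim: n => [|n IH]; rewrite ?mul0r //= IH -addn1 natrD mulrDl mul1r addrC.
by rewrite it -/(wval (cone_lattice (simple_root i)) l) wval_simple gram_sym ffunE.
Qed.

Lemma classical_calF_weight mu :
  in_tens (fun u : subalg (classical_gen_p iota) =>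
             has_weight (D := D) ca cb id (cone_lattice mu) (val u))
          (fun v : subalg (classical_gen_m iota) =>
             has_weight (D := D) ca cb id (- cone_lattice mu) (val v))
          (classical_calF iota mu).
Proof.
rewrite /classical_calF; case: {-}_ / boolP => [pmu|_]; last exact: in_tens0.
apply: in_tens_pure; apply: iota_has_weight; first exact: lie_weight_e.
exact: lie_weight_f.
Qed.

Lemma iota_h_theta l mu : iota (lie_h l) * ctheta mu = ctheta mu * iota (lie_h l).
Proof.
rewrite /ctheta mulrN mulNr mulrDr mulrDl -scalerAr -scalerAl mulr1 mul1r.
congr (- (_ + _)); rewrite /classical_h mulr_sumr mulr_suml; apply: eq_bigr => i _.
by rewrite -scalerAr -scalerAl iota_h_comm.
Qed.

Lemma classical_shapovalov_data : shapovalov_data D.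
Proof.
have [DM De] := DeltaP; have [gM ge] := gammaP; have [_ g1 _] := gM.
refine (@ShapovalovData K r D (fun=> 1) (fun=> 1) (fun i => iota (lie_h i)) ctheta ca cb
  DM gM _ _ _ _ _ _ classical_calF_comm _ _ _ _ _ classical_calF_weight
  _ _ _ _ _ iota_h_theta _ _ _ _ classical_theta_shift _ _).
- rewrite /= /classical_calF; case: {-}_ / boolP => // p0.
  by have := pos_neq0 p0; rewrite eqxx.
- by move=> i; apply/asboolP/InSubalgGen; exists (simple_root i) => //;
  exact: lie_pos_simple.
- by move=> l; exists l.
- by move=> i; exact: De.
- by move=> i; rewrite /= g1 mulr1.
- by move=> i; rewrite /= ge mulr1.
- by move=> *; rewrite mulr1.
- by move=> l la la'; rewrite mul1r wvalD addrC.
- by [].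
- exact: wval0.
- by move=> w l la; rewrite mul1r.
- by rewrite /ctheta classical_h0 eta_shift0 scale0r addr0 oppr0.
- by move=> mu; rewrite /= mulr1.
- by move=> mu; rewrite /= mul1r.
- by [].
- by move=> l mu; rewrite /= mulr1 mul1r.
- by move=> mu; rewrite /= scaleNr opprK.
- move=> i mu x; rewrite classical_weight_pairing /= mulrBr classical_h_e -scalerAr mulr1.
  by rewrite scalerDl opprD addrA addrAC [RHS]mulrBl -scalerAl mul1r.
- by move=> i mu; exists 1; rewrite /= mulr1 mul1r.
- move=> i l /=; rewrite De tliftD; last first.
    exact: (sandwich_bilin (D := D) idfun gM).
  rewrite !tlift_pure; try exact: (sandwich_bilin (D := D) idfun gM).
  rewrite g1 ge mulr1 mul1r mulrN.
  by rewrite (iota_weight l (lie_weight_e (lie_pos_simple i))) addrAC subrr add0r.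
- by move=> mu nu E; apply: cone_lattice_inj; apply: wval_inj.
- by move=> X act x l w _ _ _; exact: addrI.
Qed.

End ClassicalData.

Theorem proposition6p1 (R : realType) (g : semisimple_lie R[i])
    (U : udata R[i] (lie_rank g)) (U_P : is_U U)
    (A : algType R[i]) (iota : {lrmorphism ud_alg U -> A})
    (iota_inj : injective iota)
    (A_diag : ad_diagonalizable iota) (A_free : free_bimodule iota)
    (cset : cone (lie_rank g) -> R[i] -> Prop)
    (cset_P : denominator_range iota cset)
    (Ah : unitAlgType R[i]) (loc : {lrmorphism A -> Ah})
    (Ah_P : fraction_ring iota loc cset)
    (wp_P : extremal_projector iota loc cset)
    (X : lmodType R[i]) (inc : {linear X -> A})
    (pi : subalg (ud_gen_p U) -> X -> X)
    (X_sub : ad_submodule iota inc pi)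
    (I : choiceType) (psi : I -> X) (y : I -> {linear X -> R[i]^o})
    (X_bases : dual_bases psi y)
    (wt : I -> 'I_(lie_rank g) -> R[i]) (X_graded : graded pi psi wt)
    (S_finite : forall i,
       finite_set [set k | S_entry iota loc pi psi y k i != 0]%classic) :
  (forall x : X, Zvec iota loc inc pi psi y x =
     \sum_(i \in [set: I]%classic)
       (y i x)%:A *:
         ((\sum_(k \in [set: I]%classic)
             loc (inc (psi k)) * S_entry iota loc pi psi y k i) *:
          Vhat1 iota loc)) /\
  in_dual_tens (Vhat_plus iota loc) (Zvec iota loc inc pi psi y).
Proof.
have intr_inj : injective (intr : int -> R[i]) by exact: intr_inj.
(* [is_U] is a proposition while [shapovalov_data] is not, so the data are obtained only up to
   inhabitation, which suffices for a propositional goal. *)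
have [sd] : inhabited (shapovalov_data U).
  case: U_P => [U0 iota0 Delta gamma U0P DeltaP gammaP | q b d U0 e f kk kk' Delta
      Delta_tilde gamma Rc q0 q_root bP U0P DeltaP Delta_tildeP gammaP RcP]; constructor.
    exact: classical_shapovalov_data.
  exact: quantum_shapovalov_data q_root bP U0P DeltaP Delta_tildeP gammaP RcP.
exact: (Zvec_in_dual_tens sd cset_P Ah_P X_sub X_bases X_graded S_finite).
Qed.
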